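(* Let $A,B,C,D$ be independent random points, each uniformly distributed in the closed unit disk $\mathbb{D}=\{x\in\mathbb{R}^2:\|x\|\le 1\}$. Let $S_{AB}=\{(1-\alpha)A+\alpha B:\alpha\in[0,1]\}$, $S_{CD}=\{(1-\alpha)C+\alpha D:\alpha\in[0,1]\}$, and let $$\Theta=\arccos\left(\frac{(B-A)^T(D-C)}{\|B-A\|\,\|D-C\|}\right)\in[0,\pi],$$ which is defined almost surely. For $0<\theta<\pi$ define $$g^*(\theta):=\frac{1}{2\pi}\sum_{\varepsilon\in\{-1,1\}}\int_0^1\int_0^1 g^*_{1,\varepsilon}(\rho_{AB},\rho_{CD},\theta)\,\mathbf{1}_{\left\{\sqrt{1-\rho_{AB}^2}\,|\sin\theta|\ \ge\ |\rho_{AB}\cos\theta+\varepsilon\rho_{CD}|\right\}}\,\mathrm{d}\rho_{AB}\,\mathrm{d}\rho_{CD},$$ where $$g^*_{1,\varepsilon}(\rho_{AB},\rho_{CD},\theta):=\left(\frac{4}{\pi}\right)^2\sqrt{1-\rho_{AB}^2}\,\sqrt{1-\rho_{CD}^2}\left[1-\frac{\rho_{AB}^2+\rho_{CD}^2+2\varepsilon\rho_{AB}\rho_{CD}\cos\theta}{\sin^2\theta}\right]^2\mathbf{1}_{\{\rho_{AB},\rho_{CD}\in[0,1]\}}.$$ Set $g^*(0)=g^*(\pi)=0$ and $c:=\int_0^\pi g^*(s)\,\mathrm{d}s$. Then $$c=\mathbb{P}\left(S_{AB}\cap S_{CD}\neq\varnothing\right)=\frac13\left(1-\frac{35}{12\pi^2}\right)=0.234826627014\ldots,$$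 and the conditional density of $\Theta$ given the event $\{S_{AB}\cap S_{CD}\neq\varnothing\}$ is $$g(\theta)=\frac{g^*(\theta)}{c}\,\mathbf{1}_{\{\theta\in(0,\pi)\}}.$$ Equivalently, $$\mathbb{P}\left(\Theta\le\theta\mid S_{AB}\cap S_{CD}\neq\varnothing\right)=\int_0^\theta g(s)\,\mathrm{d}s,\qquad 0\le\theta\le\pi.$$
   Context: $\|\cdot\|$ is the Euclidean norm on $\mathbb{R}^2$, $v^T$ denotes transpose, and $\mathbf{1}_E$ denotes the indicator of the condition $E$. ''Uniformly distributed in $\mathbb{D}$'' means having density $1/\pi$ with respect to Lebesgue measure on $\mathbb{D}$. The segments are labeled, so $S_{AB}$ has orientation vector $B-A$ and $S_{CD}$ has orientation vector $D-C$; both vectors are nonzero except on a null event, so $\Theta$ is well defined almost surely. In the definition of $g^*$, the symbols $\rho_{AB}$ and $\rho_{CD}$ are simply real integration variables in $[0,1]$. *)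

(* Defs.v *)
From HB Require Import structures.
From mathcomp Require Import all_boot all_order all_algebra.
From mathcomp Require Import all_classical all_reals all_analysis.

Set Implicit Arguments.
Unset Strict Implicit.
Unset Printing Implicit Defensive.

Import Order.TTheory GRing.Theory Num.Theory.
Import numFieldNormedType.Exports.

Local Open Scope classical_set_scope.
Local Open Scope ring_scope.

(* The library norm on [R * R] is the max norm, so the Euclidean one is defined
   here through the dot product. *)
Definition dot2 (R : realType) (u v : R * R) : R := u.1 * v.1 + u.2 * v.2.

Definition norm2 (R : realType) (u : R * R) : R := Num.sqrt (dot2 u u).

Definition unit_disk (R : realType) : set (R * R) := [set x | norm2 x <= 1].

Definition segment (R : realType) (x y : R * R) : set (R * R) :=
  [set (1 - a) *: x + a *: y | a in `[0, 1]%classic].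

(* When [u] or [v] is zero the quotient is 0, whence the value pi / 2. *)
Definition angle (R : realType) (u v : R * R) : R :=
  acos (dot2 u v / (norm2 u * norm2 v)).

Definition mutually_independent (d d' : measure_display) (T : measurableType d)
    (T' : measurableType d') (R : realType) (P : probability T R) (I : finType)
    (X : I -> {RV P >-> T'}) : Prop :=
  forall (J : {set I}) (E : I -> set T'),
    (forall i, i \in J -> measurable (E i)) ->
    P (\bigcap_(i in [set` J]) X i @^-1` E i)
      = (\prod_(i in J) P (X i @^-1` E i))%E.

Definition uniform_in_disk (d : measure_display) (T : measurableType d)
    (R : realType) (P : probability T R) (X : {RV P >-> (R * R)%type}) : Prop :=
  forall E : set (R * R), measurable E ->
    distribution P X E
      = (\int[lebesgue_measure \x lebesgue_measure]_(x in E `&` @unit_disk R)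
           (pi^-1)%:E)%E.

Definition cond_prob (d : measure_display) (T : measurableType d)
    (R : realType) (P : probability T R) (E F : set T) : R :=
  fine (P (E `&` F)) / fine (P F).

Definition cond_density (d : measure_display) (T : measurableType d)
    (R : realType) (P : probability T R) (X : T -> R) (F : set T)
    (f : R -> R) : Prop :=
  [/\ measurable_fun setT f,
      forall x, 0 <= f x
    & forall E : set R, measurable E ->
        (cond_prob P (X @^-1` E) F)%:E
          = (\int[lebesgue_measure]_(x in E) (f x)%:E)%E].

(* Keeps the condition [b] out of [nat_scope], where [b%:R] would parse it. *)
Definition ind (R : realType) (b : bool) : R := b%:R.

Definition gstar1 (R : realType) (e rAB rCD theta : R) : R :=
  (4 / pi) ^+ 2 * Num.sqrt (1 - rAB ^+ 2) * Num.sqrt (1 - rCD ^+ 2)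
  * (1 - (rAB ^+ 2 + rCD ^+ 2 + 2 * e * rAB * rCD * cos theta)
         / sin theta ^+ 2) ^+ 2
  * ind R ((0 <= rAB <= 1) && (0 <= rCD <= 1)).

Definition gstar_integrand (R : realType) (e theta rAB rCD : R) : R :=
  gstar1 e rAB rCD theta
  * ind R (Num.sqrt (1 - rAB ^+ 2) * `|sin theta|
           >= `|rAB * cos theta + e * rCD|).

Definition gstar (R : realType) (theta : R) : R :=
  if 0 < theta < pi then
    (2 * pi)^-1 *
    \sum_(e <- [:: -1; 1])
      \int[lebesgue_measure]_(rCD in `[0, 1])
        \int[lebesgue_measure]_(rAB in `[0, 1])
          @gstar_integrand R e theta rAB rCD
  else 0.

Definition gstar_mass (R : realType) : R :=
  \int[lebesgue_measure]_(s in `[0, pi]) gstar s.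

Definition gdens (R : realType) (theta : R) : R :=
  gstar theta / gstar_mass R * ind R (0 < theta < pi).

(* Main.v *)
Require Import Defs.
From HB Require Import structures.
From mathcomp Require Import all_boot all_order all_algebra.
From mathcomp Require Import all_classical all_reals all_analysis.
From mathcomp Require Import measurable_realfun ring lra.

(* Crossing and angle are invariant under rigid motions, so a four-point integral
   over the disk can be evaluated with [A B] horizontal, at the price of the
   Jacobian [r = |B - A|], and with [D - C] in polar coordinates [q, t]. For a
   fixed angle [t], a crossing configuration is described by the crossing point
   [X] and by the positions of the end points on the two chords through [X].
   Integrating the Jacobian [r] over the positions on the chord at distance [u]
   from the origin gives [h u * (1 - |X|^2)], with [h u = sqrt (1 - u^2)], and
   likewise for the other chord at distance [w]; the product of the two is the
   integrand of [gstar].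

   For the value of [c], count over the three pairings of four points in general
   position: the number of pairs whose line separates the other two points, plus
   the number of crossing pairings, is always 3. Hence [6 q + 3 c = 3], where [q]
   is the probability that the line [A B] separates [C] from [D]. Given [A B] on
   a horizontal line of height [u], that is twice the product of the areas of the
   two caps cut off by the line, an elementary integral after [u = sin x]. *)

Set Implicit Arguments.
Unset Strict Implicit.
Unset Printing Implicit Defensive.

Import Order.TTheory GRing.Theory Num.Theory.
Import numFieldNormedType.Exports.

Local Open Scope classical_set_scope.
Local Open Scope ring_scope.

(** * Integrals of nonnegative measurable functions *)

Definition nnm d (T : measurableType d) (R : realType) (f : T -> \bar R) :=
  measurable_fun setT f /\ forall x, (0 <= f x)%E.

Section nnm.
Context d1 d2 (T1 : measurableType d1) (T2 : measurableType d2) (R : realType).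
Local Open Scope ereal_scope.

Lemma nnmD (f g : T1 -> \bar R) : nnm f -> nnm g -> nnm (fun x => f x + g x).
Proof.
move=> [mf f0] [mg g0]; split; first exact: emeasurable_funD.
by move=> x; exact: adde_ge0.
Qed.

Lemma nnmM (f g : T1 -> \bar R) : nnm f -> nnm g -> nnm (fun x => f x * g x).
Proof.
move=> [mf f0] [mg g0]; split; first exact: emeasurable_funM.
by move=> x; exact: mule_ge0.
Qed.

Lemma nnm_comp (f : T2 -> \bar R) (g : T1 -> T2) :
  nnm f -> measurable_fun setT g -> nnm (fun x => f (g x)).
Proof. by move=> [mf f0] mg; split => // ; exact: measurableT_comp. Qed.

Lemma nnm_EFin (f : T1 -> R) : measurable_fun setT f ->
  (forall x, 0 <= f x)%R -> nnm (fun x => (f x)%:E).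
Proof. by move=> mf f0; split; [exact/measurable_EFinP|move=> x; rewrite lee_fin]. Qed.

Lemma nnm_integral (m : {sigma_finite_measure set T2 -> \bar R})
    (f : T1 -> T2 -> \bar R) :
  nnm (fun z : T1 * T2 => f z.1 z.2) -> nnm (fun x => \int[m]_y f x y).
Proof.
move=> [mf f0]; split; last first.
  by move=> x; apply: integral_ge0 => y _; exact: (f0 (x, y)).
exact: (measurable_fun_fubini_tonelli_F _ mf f0).
Qed.

Lemma tonelli_swap (m1 : {sigma_finite_measure set T1 -> \bar R})
    (m2 : {sigma_finite_measure set T2 -> \bar R}) (f : T1 -> T2 -> \bar R) :
  nnm (fun z : T1 * T2 => f z.1 z.2) ->
  \int[m1]_x \int[m2]_y f x y = \int[m2]_y \int[m1]_x f x y.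
Proof. by move=> [mf f0]; exact: (fubini_tonelli _ mf f0). Qed.

Lemma tonelli_prod (m1 : {sigma_finite_measure set T1 -> \bar R})
    (m2 : {sigma_finite_measure set T2 -> \bar R}) (f : T1 * T2 -> \bar R) :
  nnm f -> \int[m1 \x m2]_z f z = \int[m1]_x \int[m2]_y f (x, y).
Proof. by move=> [mf f0]; exact: (fubini_tonelli1 _ mf f0). Qed.

Lemma nnm_integralZl (m : {measure set T1 -> \bar R}) (k : \bar R)
    (f : T1 -> \bar R) : 0 <= k -> nnm f ->
  \int[m]_x (k * f x) = k * \int[m]_x f x.
Proof. by move=> k0 [mf f0]; rewrite ge0_integralZl. Qed.

Lemma nnm_integralZr (m : {measure set T1 -> \bar R}) (k : \bar R)
    (f : T1 -> \bar R) : 0 <= k -> nnm f ->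
  \int[m]_x (f x * k) = \int[m]_x f x * k.
Proof. by move=> k0 [mf f0]; rewrite ge0_integralZr. Qed.

Lemma nnm_integralD (m : {measure set T1 -> \bar R})
    (f g : T1 -> \bar R) : nnm f -> nnm g ->
  \int[m]_x (f x + g x) = \int[m]_x f x + \int[m]_x g x.
Proof. by move=> [mf f0] [mg g0]; rewrite ge0_integralD. Qed.

Import HBNNSimple.

Lemma integral_density (nu mu : {measure set T1 -> \bar R}) (g : T1 -> R) (f : T1 -> \bar R) :
  (forall E, measurable E -> nu E = \int[mu]_(x in E) (g x)%:E) ->
  nnm (EFin \o g) -> nnm f ->
  \int[nu]_x f x = \int[mu]_x (f x * (g x)%:E).
Proof.
move=> nuE [mg g0] [mf f0]; pose h := nnsfun_approx measurableT mf.
have hf x : (h n x)%:E @[n --> \oo] --> f x.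
  by apply: cvg_nnsfun_approx => // y _; exact: f0.
transitivity (limn (fun n => \int[nu]_x (h n x)%:E)).
  rewrite -monotone_convergence//.
  - by apply: eq_integral => x _; apply/esym/cvg_lim => //; exact: hf.
  - by move=> n; exact/measurable_EFinP/measurable_funP.
  - by move=> n x _; rewrite lee_fin.
  - by move=> x _ a b ab; rewrite lee_fin; exact/lefP/nd_nnsfun_approx.
transitivity (limn (fun n => \int[mu]_x ((h n x)%:E * (g x)%:E))); last first.
  rewrite -monotone_convergence//.
  - apply: eq_integral => x _; apply/cvg_lim => //.
    exact: cvgeZr.
  - by move=> n; apply: emeasurable_funM => //; exact/measurable_EFinP/measurable_funP.
  - by move=> n x _; apply: mule_ge0; [rewrite lee_fin|exact: g0].
  - move=> x _ a b ab; apply: lee_wpmul2r; first exact: g0.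
    by rewrite lee_fin; exact/lefP/nd_nnsfun_approx.
congr (limn _); apply/funext => n.
under eq_integral do rewrite fimfunE -fsumEFin//.
under [RHS]eq_integral => x _.
  rewrite fimfunE -fsumEFin// ge0_mule_fsuml; last first.
    by move=> r; rewrite EFinM nnfun_muleindic_ge0.
  over.
rewrite !ge0_integral_fsum//; last 4 first.
- move=> r; apply: emeasurable_funM => //.
  by apply/measurable_EFinP/measurable_funM.
- by move=> r x _; apply: mule_ge0; [rewrite EFinM nnfun_muleindic_ge0|exact: g0].
- by move=> r; apply/measurable_EFinP/measurable_funM.
- by move=> r x _; rewrite EFinM nnfun_muleindic_ge0.
apply: eq_fsbigr => r _; have [r0|r0] := leP 0%R r; last first.
  rewrite !integral0_eq// => x _.
  - by rewrite preimage_nnfun0// indic0 mulr0 mul0e.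
  - by rewrite preimage_nnfun0// indic0 mulr0.
have mI : nnm (fun x => (\1_(h n @^-1` [set r]) x : R)%:E).
  by apply: nnm_EFin => // x; rewrite indicE.
under eq_integral do rewrite EFinM.
rewrite nnm_integralZl ?lee_fin//.
under [RHS]eq_integral do rewrite EFinM -muleA.
rewrite nnm_integralZl ?lee_fin//; last exact: nnmM.
congr (_ * _); rewrite integral_indic// setIT nuE// integral_mkcond.
by apply: eq_integral => x _; rewrite epatch_indic muleC.
Qed.

End nnm.

Lemma measurable_ind (R : realType) (D : set bool) : measurable_fun D (@ind R).
Proof. by []. Qed.

Lemma ind_ge0 (R : realType) b : 0 <= ind R b.
Proof. exact: ler0n. Qed.

Lemma indT (R : realType) : ind R true = 1.
Proof. by []. Qed.

Lemma indF (R : realType) : ind R false = 0.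
Proof. by []. Qed.

Lemma ind_and (R : realType) a b : ind R (a && b) = ind R a * ind R b.
Proof. by case: a; case: b; rewrite ?indT ?indF ?mulr1 ?mulr0. Qed.

Section basic_meas.
Context (R : realType).
Lemma measurable_sin : measurable_fun setT (@sin R).
Proof. by apply: continuous_measurable_fun; exact: continuous_sin. Qed.
Lemma measurable_cos : measurable_fun setT (@cos R).
Proof. by apply: continuous_measurable_fun; exact: continuous_cos. Qed.
Lemma measurable_sqrt : measurable_fun setT (@Num.sqrt R).
Proof. by apply: continuous_measurable_fun; exact: sqrt_continuous. Qed.
Lemma measurable_inv : measurable_fun setT (@GRing.inv R).
Proof.
have -> : @GRing.inv R = fun x => if x == 0 then 0 else x^-1.
  by apply/funext => x; case: eqVneq => // ->; rewrite invr0.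
apply: measurable_fun_if => //.
  exact: measurable_fun_eqr.
rewrite setTI; apply: open_continuous_measurable_fun; last first.
  move=> x; rewrite inE/= => /negbT x0; exact: inv_continuous.
rewrite (_ : _ @^-1` _ = ~` [set 0]).
  by apply: closed_openC.
by apply/seteqP; split => x/=; [move=> /eqP|move/eqP/negbTE].
Qed.
End basic_meas.

Ltac meas_step :=
  match goal with
  | |- measurable_fun _ (fun x => x) => exact: measurable_id
  | H : measurable_fun setT ?F |- measurable_fun _ ?F => exact: H
  | |- measurable_fun _ fst => exact: measurable_fst
  | |- measurable_fun _ snd => exact: measurable_snd
  | |- measurable_fun _ (fun x => ?c) => exact: measurable_cst
  | |- measurable_fun _ (fun x => (@?f x, @?g x)) => apply: measurable_fun_pair
  | |- measurable_fun _ (fun x => ((@?f x) + (@?g x))%R) =>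
      apply: (@measurable_funD _ _ _ _ f g)
  | |- measurable_fun _ (fun x => ((@?f x) * (@?g x))%R) =>
      apply: (@measurable_funM _ _ _ _ f g)
  | |- measurable_fun _ (fun x => (- (@?f x))%R) =>
      apply: (@measurable_funN _ _ _ _ f)
  | |- measurable_fun _ (fun x => ((@?f x) ^+ ?n)%R) =>
      apply: (@measurable_funX _ _ _ _ f n)
  | |- measurable_fun _ (fun x => (@?f x) && (@?g x)) =>
      apply: (@measurable_and _ _ _ f g)
  | |- measurable_fun _ (fun x => (@?f x) || (@?g x)) =>
      apply: (@measurable_or _ _ _ f g)
  | |- measurable_fun _ (fun x => ~~ (@?f x)) =>
      apply: (@measurable_neg _ _ _ f)
  | |- measurable_fun _ (fun x => ((@?f x) <= (@?g x))%R) =>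
      apply: (@measurable_fun_ler _ _ _ _ f g)
  | |- measurable_fun _ (fun x => ((@?f x) < (@?g x))%R) =>
      apply: (@measurable_fun_ltr _ _ _ _ f g)
  | |- measurable_fun _ (fun x => ((@?f x) == (@?g x))%R) =>
      apply: (@measurable_fun_eqr _ _ _ _ f g)
  | |- measurable_fun _ (fun x => Num.max (@?f x) (@?g x)) =>
      apply: (@measurable_maxr _ _ _ _ f g)
  | |- measurable_fun _ (fun x => `|@?f x|%R) =>
      apply: (measurableT_comp (@normr_measurable _ setT) (g := f))
  | |- measurable_fun _ (fun x => sin (@?f x)) =>
      apply: (measurableT_comp (@measurable_sin _) (g := f))
  | |- measurable_fun _ (fun x => cos (@?f x)) =>
      apply: (measurableT_comp (@measurable_cos _) (g := f))
  | |- measurable_fun _ (fun x => Num.sqrt (@?f x)) =>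
      apply: (measurableT_comp (@measurable_sqrt _) (g := f))
  | |- measurable_fun _ (fun x => ((@?f x)^-1)%R) =>
      apply: (measurableT_comp (@measurable_inv _) (g := f))
  | |- measurable_fun _ (fun x => ind _ (@?f x)) =>
      apply: (measurableT_comp (@measurable_ind _ setT) (g := f))
  | |- measurable_fun _ (fun x => ((@?f x)%:E)) =>
      apply/measurable_EFinP
  | |- measurable_fun _ (fun x => fst (@?f x)) =>
      apply: (measurableT_comp measurable_fst (g := f))
  | |- measurable_fun _ (fun x => snd (@?f x)) =>
      apply: (measurableT_comp measurable_snd (g := f))
  | H : measurable_fun setT ?F |- measurable_fun _ (fun x => ?F (@?g x)) =>
      apply: (measurableT_comp H (g := g))
  | H : nnm ?F |- measurable_fun _ (fun x => ?F (@?g x)) =>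
      apply: (measurableT_comp (proj1 H) (g := g))
  end.
Ltac meas := rewrite /=; repeat meas_step.

(* [lebesgue_measure] lives on [measurableTypeR R], whose measure display is not
   the one carried by [R] in [R * R]; [leb] is the same set function over [R].
   It is locked because the two are convertible, at a prohibitive cost. *)
Section leb_measure.
Context {R : realType}.
Local Notation mu := (@lebesgue_measure R).
Local Open Scope ereal_scope.

Definition leb_fun : set R -> \bar R := mu.
Let leb0 : leb_fun set0 = 0. Proof. exact: (measure0 mu). Qed.
Let leb_ge0 A : 0 <= leb_fun A. Proof. exact: (measure_ge0 mu). Qed.
Let leb_sigma_additive : semi_sigma_additive leb_fun.
Proof. exact: (@measure_semi_sigma_additive _ _ _ mu). Qed.
Let leb_sigma_finite : sigma_finite setT leb_fun.
Proof. exact: (sigma_finiteT mu). Qed.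

HB.instance Definition _ :=
  isMeasure.Build _ _ _ leb_fun leb0 leb_ge0 leb_sigma_additive.
HB.instance Definition _ :=
  Measure_isSigmaFinite.Build _ _ _ leb_fun leb_sigma_finite.

End leb_measure.

HB.lock Definition leb {R : realType} : {sigma_finite_measure set R -> \bar R} :=
  @leb_fun R.

Section leb.
Context {R : realType}.
Local Notation mu := (@lebesgue_measure R).
Local Open Scope ereal_scope.

Let toR (x : R) : measurableTypeR R := x.
Let mtoR : measurable_fun setT toR. Proof. by move=> _ Y mY; rewrite setTI. Qed.

Lemma lebE (D : set R) (f : R -> \bar R) : measurable D ->
  measurable_fun D f -> (forall x, D x -> 0 <= f x) ->
  \int[leb]_(x in D) f x = \int[mu]_(x in D) f x.
Proof.
rewrite leb.unlock.
move=> mD mf f0; have mt := mtoR.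
rewrite [RHS](@eq_measure_integral _ _ _ _ (pushforward leb_fun toR))//.
by rewrite (@ge0_integral_pushforward _ _ _ _ _ _ mt leb_fun)// => x /set_mem; exact: f0.
Qed.

Lemma leb_itv (i : interval R) : leb [set` i] =
  (if i.1 < i.2 then (i.2 : \bar R) - i.1 else 0)%E.
Proof. by rewrite leb.unlock; exact: lebesgue_measure_itv. Qed.

Lemma leb_opp (A : set R) : measurable A -> leb (-%R @^-1` A) = leb A.
Proof. by rewrite leb.unlock => mA; exact: lebesgue_measureN. Qed.

Lemma leb_unique (nu : {measure set R -> \bar R}) :
  (forall a b : R, leb `]a, b]%classic = nu `]a, b]%classic) ->
  forall A, measurable A -> leb A = nu A.
Proof.
rewrite leb.unlock; move=> lebnu A mA; have mt := mtoR.
apply: (@lebesgue_measure_unique R (pushforward nu toR)) => //.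
by move=> _ [[a b] _ <-]; exact: lebnu.
Qed.

End leb.

Section affine.
Context {R : realType}.
Local Notation mu := (@leb R).
Local Open Scope ereal_scope.

Let leb_shift (a : R) (A : set R) : measurable A ->
  mu A = pushforward mu (fun x => x + a)%R A.
Proof.
have mphi : measurable_fun setT (fun x : R => (x + a)%R) by meas.
move=> mA; apply: (leb_unique (nu := pushforward mu (fun x => x + a)%R)) => //.
move=> b c; rewrite -[RHS]/(mu ((fun x => x + a)%R @^-1` `]b, c]%classic)).
rewrite (_ : _ @^-1` _ = `]b - a, c - a]%classic)%R; last first.
  by apply/seteqP; split => x /=; rewrite !in_itv/= ltrBlDr lerBrDr.
rewrite !leb_itv/= !lte_fin ltrD2r; case: ifPn => // _.
by rewrite -!EFinB; congr (_%:E); ring.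
Qed.

Lemma integral_shift (a : R) (f : R -> \bar R) : nnm f ->
  \int[mu]_x f (x + a)%R = \int[mu]_x f x.
Proof.
move=> [mf f0].
have mphi : measurable_fun setT (fun x : R => (x + a)%R) by meas.
rewrite -(@ge0_integral_pushforward _ _ _ _ _ _ mphi mu setT f)//.
by apply: eq_measure_integral => //= A mA _; apply/esym; exact: leb_shift.
Qed.

Lemma integral_scale (k : R) (f : R -> \bar R) : (0 < k)%R -> nnm f ->
  \int[mu]_x (k%:E * f (k * x)%R) = \int[mu]_x f x.
Proof.
move=> k0 nf; have [mf f0] := nf.
have mphi : measurable_fun setT (fun x : R => (k * x)%R) by meas.
pose nu := mscale (NngNum (ltW k0)) (pushforward mu (fun x => k * x)%R).
have nuE A : measurable A -> mu A = nu mphi A.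
  apply: leb_unique => b c.
  rewrite -[RHS]/(k%:E * mu ((fun x => k * x)%R @^-1` `]b, c]%classic)).
  rewrite (_ : _ @^-1` _ = `](b / k), (c / k)]%classic)%R; last first.
    apply/seteqP; split => x /=.
      by rewrite !in_itv/= ltr_pdivrMr// ler_pdivlMr// mulrC.
    by rewrite !in_itv/= ltr_pdivrMr// ler_pdivlMr// mulrC.
  rewrite !leb_itv/= !lte_fin ltr_pM2r ?invr_gt0//.
  case: ifPn => // _; last by rewrite mule0.
  by rewrite -!EFinB -EFinM; congr (_%:E); field; exact: lt0r_neq0.
rewrite nnm_integralZl ?lee_fin ?ltW//; last exact: (nnm_comp nf).
rewrite -(@ge0_integral_pushforward _ _ _ _ _ _ mphi mu setT f)//.
rewrite -[X in X%:E]/(NngNum (ltW k0))%:num.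
rewrite -(@ge0_integral_mscale _ _ _ (pushforward mu (fun x => k * x)%R))//.
by apply: eq_measure_integral => //= A mA _; apply/esym; exact: nuE.
Qed.

Lemma integral_reflect (f : R -> \bar R) : nnm f ->
  \int[mu]_x f (- x)%R = \int[mu]_x f x.
Proof.
move=> [mf f0].
have mphi : measurable_fun setT (fun x : R => (- x)%R) by meas.
rewrite -(@ge0_integral_pushforward _ _ _ _ _ _ mphi mu setT f)//.
by apply: eq_measure_integral => //= A mA _; exact: leb_opp.
Qed.

End affine.

Ltac nonneg := repeat first
  [ exact: ind_ge0 | exact: sqr_ge0 | exact: sqrtr_ge0 | exact: normr_ge0
  | exact: ler0n | assumption | exact: pi_ge0
  | by rewrite le_max lexx | by rewrite invr_ge0
  | apply: mulr_ge0 | apply: addr_ge0 ].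

Ltac nnm_step :=
  match goal with
  | H : nnm ?F |- nnm ?F => exact: H
  | |- nnm (fun x => mule (@?f x) (@?g x)) => apply: (@nnmM _ _ _ f g)
  | |- nnm (fun x => GRing.add (@?f x) (@?g x)) => apply: (@nnmD _ _ _ f g)
  | |- nnm (fun x => EFin (@?f x)) => apply: (@nnm_EFin _ _ _ f); [by meas|move=> ? /=; nonneg]
  | H : nnm ?F |- nnm (fun x => ?F (@?g x)) => apply: (nnm_comp H (g := g)); by meas
  | |- nnm (fun x => \int[_]_y (@?F x y))%E => apply: (@nnm_integral _ _ _ _ _ _ F)
  end.
Ltac nnmt := rewrite /=; repeat (nnm_step; rewrite /=).

Section planar_measure.
Context (R : realType).
Local Notation mu := (@leb R).
Local Open Scope ereal_scope.

Lemma planar_sigma_finite : sigma_finite setT (mu \x mu).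
Proof.
have /sigma_finiteP[F [TF ndF Foo]] := sigma_finiteT mu.
exists (fun n => F n `*` F n).
  rewrite -setXTT TF predeqE => -[x y]; split => [|[n _ []/= ? ?]]; last first.
    by split; exists n.
  move=> [/= [n _ Fnx] [k _ Fky]]; exists (maxn n k) => //; split.
  - by move: x Fnx; exact/subsetPset/ndF/leq_maxl.
  - by move: y Fky; exact/subsetPset/ndF/leq_maxr.
move=> k; have [mF Fk] := Foo k.
split; first exact: measurableX.
by rewrite product_measure1E// lte_mul_pinfty// ge0_fin_numE.
Qed.

End planar_measure.

(* The library's canonical instance for product measures only covers products
   of probabilities. *)
HB.lock Definition leb2 {R : realType} :
    {sigma_finite_measure set (R * R)%type -> \bar R} :=
  HB.pack_for {sigma_finite_measure set (R * R)%type -> \bar R} (@leb R \x @leb R)%E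
    (Measure_isSigmaFinite.Build _ _ _ (@leb R \x @leb R)%E (planar_sigma_finite R)).

Section planar.
Context {R : realType}.
Local Notation mu := (@leb R).
Local Notation mu2 := (@leb2 R).
Local Open Scope ereal_scope.

Lemma planarE (f : R * R -> \bar R) : nnm f ->
  \int[mu2]_z f z = \int[mu]_x \int[mu]_y f (x, y).
Proof. by rewrite leb2.unlock => nf; exact: (tonelli_prod mu mu nf). Qed.

Lemma planarEr (f : R * R -> \bar R) : nnm f ->
  \int[mu2]_z f z = \int[mu]_y \int[mu]_x f (x, y).
Proof.
by move=> nf; rewrite (planarE nf); apply: tonelli_swap; nnmt.
Qed.

Lemma planar_shear1 (k : R) (f : R * R -> \bar R) : nnm f ->
  \int[mu2]_z f (z.1 + k * z.2, z.2)%R = \int[mu2]_z f z.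
Proof.
move=> nf; rewrite (planarEr nf) planarEr/=; last by nnmt.
apply: eq_integral => y _.
rewrite (@integral_shift _ (k * y)%R (fun x => f (x, y)))//.
by nnmt.
Qed.

Lemma planar_shear2 (k : R) (f : R * R -> \bar R) : nnm f ->
  \int[mu2]_z f (z.1, z.2 + k * z.1)%R = \int[mu2]_z f z.
Proof.
move=> nf; rewrite (planarE nf) planarE/=; last by nnmt.
apply: eq_integral => x _.
rewrite (@integral_shift _ (k * x)%R (fun y => f (x, y)))//.
by nnmt.
Qed.

Lemma planar_shift (v : R * R) (f : R * R -> \bar R) : nnm f ->
  \int[mu2]_z f (z.1 + v.1, z.2 + v.2)%R = \int[mu2]_z f z.
Proof.
move=> nf; rewrite (planarE nf) planarE/=; last by nnmt.
rewrite -(@integral_shift _ v.1 (fun x => \int[mu]_y f (x, y))); last by nnmt.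
apply: eq_integral => x _.
rewrite (@integral_shift _ v.2 (fun y => f (x + v.1, y)%R))//.
by nnmt.
Qed.

Lemma planar_reflect (f : R * R -> \bar R) : nnm f ->
  \int[mu2]_z f (z.1, - z.2)%R = \int[mu2]_z f z.
Proof.
move=> nf; rewrite (planarE nf) planarE/=; last by nnmt.
apply: eq_integral => x _.
by rewrite (@integral_reflect _ (fun y => f (x, y)))//; nnmt.
Qed.

Definition prot (c s : R) (z : R * R) : R * R :=
  (c * z.1 - s * z.2, s * z.1 + c * z.2)%R.

(* A rotation other than the half turn is a product of three shears. *)
Lemma planar_rot (c s : R) (f : R * R -> \bar R) :
  (c ^+ 2 + s ^+ 2 = 1)%R -> c != (-1)%R -> nnm f ->
  \int[mu2]_z f (prot c s z) = \int[mu2]_z f z.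
Proof.
move=> cs1 cN1 nf.
have c1 : (1 + c)%R != 0%R by rewrite addrC -(opprK 1%R) subr_eq0.
pose k := (- (s / (1 + c)))%R.
pose f1 z := f (z.1 + k * z.2, z.2)%R.
pose f2 z := f1 (z.1, z.2 + s * z.1)%R.
have nf1 : nnm f1 by rewrite /f1; nnmt.
have nf2 : nnm f2 by rewrite /f2; nnmt.
rewrite -[RHS](planar_shear1 k)// -/(f1 _) -[RHS](planar_shear2 s)//.
rewrite -[RHS](planar_shear1 k nf2); apply: eq_integral => z _.
have kc : (k * (1 + c) = - s)%R by rewrite /k mulNr mulfVK.
have ks : (k * s = c - 1)%R.
  apply: (mulIf c1); rewrite mulrAC kc mulNr -expr2.
  by rewrite -[X in (- X)%R](addKr (c ^+ 2)%R) cs1; ring.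
rewrite /f2 /f1 /prot /=; congr (f (_, _)).
  rewrite mulrDr (mulrDr s) (mulrDr k (s * _)%R) !mulrA ks.
  transitivity (z.1 * c + (k * (1 + c)) * z.2)%R; first by rewrite kc; ring.
  by ring.
by rewrite (mulrDr s) (mulrA s k) (mulrC s k) ks; ring.
Qed.

End planar.

Section density_measure.
Context d (T : measurableType d) (R : realType).
Variables (m : {measure set T -> \bar R}) (g : T -> R).
Hypothesis ng : nnm (EFin \o g).
Local Open Scope ereal_scope.

Definition density_measure (E : set T) := \int[m]_(x in E) (g x)%:E.

Let density0 : density_measure set0 = 0.
Proof. exact: integral_set0. Qed.

Let density_ge0 E : 0 <= density_measure E.
Proof. by apply: integral_ge0 => x _; case: ng => _; exact. Qed.

Let density_sigma_additive : semi_sigma_additive density_measure.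
Proof.
have [mg g0] := ng.
move=> /= F mF tF mUF; rewrite /density_measure; apply: cvg_toP.
  apply: ereal_nondecreasing_is_cvgn => p q pq.
  apply: lee_sum_nneg_natr => // k _ _.
  by apply: integral_ge0 => /= x _; exact: g0.
rewrite ge0_integral_bigcup//=; first exact: measurable_funTS.
by move=> x _; exact: g0.
Qed.

HB.instance Definition _ := isMeasure.Build _ _ _ density_measure
  density0 density_ge0 density_sigma_additive.

Definition densm : {measure set T -> \bar R} := density_measure.

End density_measure.

Section cotangent.
Context {R : realType}.
Local Notation mu := (@leb R).
Local Open Scope ereal_scope.

Let w (x : R) : R := (ind R (- (pi / 2) < x < pi / 2) * (cos x) ^- 2)%R.

Let tan' (x : R) : R := tan x.

Let mtan : measurable_fun setT tan'.
Proof. by rewrite /tan' /tan; meas. Qed.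

Let nw : nnm (EFin \o w).
Proof.
rewrite /w; apply: nnm_EFin; first by meas.
by move=> x; rewrite mulr_ge0 ?ind_ge0// invr_ge0 sqr_ge0.
Qed.

Let tan_density (E : set R) : measurable E ->
  mu E = pushforward (densm mu nw) tan' E.
Proof.
have mphi := mtan.
move=> mE; apply: (leb_unique (nu := pushforward (densm mu nw) tan')) => // a b.
rewrite -[RHS]/(\int[mu]_(x in tan' @^-1` `]a, b]) (w x)%:E)%E.
rewrite integral_mkcond (_ : _ \_ _ =
  ((fun x => ((cos x) ^- 2)%:E) \_ `]atan a, atan b])); last first.
  apply/funext => x; rewrite /patch /= /w.
  case: (boolP (- (pi / 2) < x < pi / 2)%R) => xpi; last first.
    rewrite indF mul0r if_same; case: ifPn => // /set_mem/=.
    rewrite in_itv/= => /andP[ax xb].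
    by move: xpi; rewrite (lt_trans (atan_gtNpi2 _) ax) (le_lt_trans xb (atan_ltpi2 _)).
  rewrite indT mul1r; congr (if _ then _ else _); apply/idP/idP => /set_mem/=;
    rewrite in_itv/= => /andP[ax xb]; apply/mem_set; rewrite /= in_itv/=.
    by rewrite -[x]tanK ?in_itv//= lt_atan//=; exact: le_atan.
  apply/andP; split.
    by rewrite ltNge; apply: contraTN ax => /le_atan; rewrite tanK ?in_itv//= -leNgt.
  by rewrite leNgt; apply: contraTN xb => /lt_atan; rewrite tanK ?in_itv//= -ltNge.
rewrite -integral_mkcond; have [ab|ba] := ltP a b; last first.
  rewrite leb_itv/= lte_fin ltNge ba/= set_itv_ge ?integral_set0//.
  by rewrite bnd_simp -leNgt; exact: le_atan.
have cosn0 x : x \in `[atan a, atan b] -> cos x != 0%R.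
  rewrite in_itv/= => /andP[ax xb]; apply/lt0r_neq0/cos_gt0_pihalf.
  by rewrite (lt_le_trans (atan_gtNpi2 _) ax) (le_lt_trans xb (atan_ltpi2 _)).
have ccos : {within `[atan a, atan b], continuous (fun x : R => (cos x) ^- 2)%R}.
  apply: continuous_in_subspaceT => x /[1!inE]/= xab.
  apply: (@continuousV _ _ (fun x : R => (cos x) ^+ 2)%R x).
    by rewrite sqrf_eq0 cosn0.
  apply: (@continuous_comp _ _ _ (@cos R) (fun y : R => y ^+ 2)%R).
    exact: continuous_cos.
  exact: exprn_continuous.
rewrite lebE//; last 2 first.
- by apply: measurable_funTS; meas.
- by move=> x _; rewrite lee_fin invr_ge0 sqr_ge0.
rewrite integral_itv_obnd_cbnd; last first.
  by apply/measurable_EFinP; apply: measurable_funTS; meas.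
have ctan x : x \in `[atan a, atan b] -> {for x, continuous (@tan R)}.
  by move=> /cosn0; exact: continuous_tan.
have dtan x : x \in `[atan a, atan b] -> is_derive x 1%R (@tan R) ((cos x)^-2)%R.
  by move=> /cosn0; exact: is_derive_tan.
have sub x : x \in `]atan a, atan b[ -> x \in `[atan a, atan b].
  by apply: subset_itv_oo_cc.
rewrite (@continuous_FTC2 _ _ (@tan R)) ?lt_atan//.
- by rewrite leb_itv/= lte_fin ab !atanK.
- split.
  + by move=> x /sub /dtan[].
  + apply: cvg_at_right_filter; apply: ctan.
    by rewrite in_itv/= lexx ltW// lt_atan.
  + apply: cvg_at_left_filter; apply: ctan.
    by rewrite in_itv/= lexx ltW// lt_atan.
- by move=> x /sub /dtan h; rewrite derive1E derive_val.
Qed.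

Lemma integral_tan (f : R -> \bar R) : nnm f ->
  \int[mu]_x f x = \int[mu]_x (f (tan x) * (w x)%:E).
Proof.
move=> nf; have [mf f0] := nf.
have mt := mtan.
rewrite (@eq_measure_integral _ _ _ _ (pushforward (densm mu nw) tan')); last first.
  by move=> A mA _; exact: tan_density.
rewrite (@ge0_integral_pushforward _ _ _ _ _ _ mt (densm mu nw) setT f)//.
rewrite preimage_setT (@integral_density _ _ _ _ mu w (f \o tan'))//.
exact: (nnm_comp nf).
Qed.

Lemma integral_cot (f : R -> \bar R) : nnm f ->
  \int[mu]_x f x =
  \int[mu]_x (f (cos x / sin x)%R * (ind R (0 < x < pi) * (sin x) ^- 2)%:E).
Proof.
move=> nf; have mt := mtan; rewrite integral_tan//.
have n1 : nnm (fun x => f (tan x) * (w x)%:E).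
  by apply: nnmM => //; apply: (nnm_comp nf).
rewrite -integral_reflect// -(@integral_shift _ (- (pi / 2))%R); last first.
  by apply: (nnm_comp n1); meas.
apply: eq_integral => x _; rewrite opprD opprK /w /tan (addrC (- x)%R).
rewrite cosB sinB cos_pihalf sin_pihalf !mul0r !mul1r add0r subr0.
congr (f _ * (ind R _ * _)%:E).
by apply/idP/idP => /andP[? ?]; apply/andP; split; lra.
Qed.

End cotangent.

Section integral_ind.
Context d (T : measurableType d) (R : realType) (m : {measure set T -> \bar R}).
Local Open Scope ereal_scope.

Lemma integral_ind (b : T -> bool) (f : T -> \bar R) :
  \int[m]_x ((ind R (b x))%:E * f x) = \int[m]_(x in [set x | b x]) f x.
Proof.
rewrite [RHS]integral_mkcond; apply: eq_integral => x _; rewrite patchE.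
case: (boolP (b x)) => bx; first by rewrite mem_set// indT mul1e.
by rewrite memNset ?indF ?mul0e//; exact/negP.
Qed.

Lemma nnm_integral_ge0 (f : T -> \bar R) : nnm f -> 0 <= \int[m]_x f x.
Proof. by move=> [_ f0]; apply: integral_ge0 => x _. Qed.

End integral_ind.

Section polar.
Context {R : realType}.
Local Notation mu := (@leb R).
Local Notation mu2 := (@leb2 R).
Local Open Scope ereal_scope.

Lemma integral_fold (f : R -> \bar R) : nnm f ->
  \int[mu]_x f x = \int[mu]_x ((ind R (0 < x)%R)%:E * (f x + f (- x)%R)).
Proof.
move=> nf.
have -> : \int[mu]_x f x =
    \int[mu]_x ((ind R (0 < x)%R)%:E * f x + ((ind R (0 < - x)%R)%:E * f x
      + (ind R (x == 0)%R)%:E * f x)).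
  apply: eq_integral => x _.
  by rewrite oppr_gt0; case: (ltgtP x 0%R) => _;
    rewrite ?indT ?indF ?mul0e ?mul1e ?adde0 ?add0e.
have n1 : nnm (fun x : R => (ind R (0 < x)%R)%:E * f x) by nnmt.
have n2 : nnm (fun x : R => (ind R (0 < - x)%R)%:E * f x) by nnmt.
have n3 : nnm (fun x : R => (ind R (x == 0)%R)%:E * f x) by nnmt.
rewrite nnm_integralD//; last exact: nnmD.
rewrite nnm_integralD//.
rewrite (integral_ind mu (fun x : R => x == 0)%R) (_ : [set x | _] = [set 0%R]); last first.
  by apply/seteqP; split => x /eqP.
have [mf f0] := nf; rewrite (@lebE _ [set 0%R])//; last exact: measurable_funTS.
rewrite integral_set1 adde0 -(integral_reflect n2) -nnm_integralD//; last first.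
  by nnmt.
apply: eq_integral => x _; rewrite opprK ge0_muleDr//; by apply: (proj2 nf).
Qed.

Lemma integral_polar (f : R * R -> \bar R) : nnm f ->
  \int[mu2]_z f z =
  \int[mu]_t ((ind R (0 < t < pi)%R)%:E * \int[mu]_r ((Num.max 0 r)%:E *
     (f (r * cos t, r * sin t)%R + f (r * cos t, - (r * sin t))%R))).
Proof.
move=> nf; rewrite planarEr// integral_fold; last by nnmt.
pose F x y := f (x, y) + f (x, - y)%R.
transitivity (\int[mu]_y \int[mu]_m ((Num.max 0 y)%:E * F (y * m)%R y)).
  apply: eq_integral => y _.
  case: (ltP 0%R y) => y0; last first.
    rewrite indF mul0e integral0_eq// => x _.
    by rewrite mul0e.
  rewrite indT mul1e -nnm_integralD; [|by nnmt..].
  rewrite -(@integral_scale _ y (fun x => F x y))//; last by rewrite /F; nnmt.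
rewrite tonelli_swap; last by rewrite /F; nnmt.
rewrite [LHS]integral_cot; last by rewrite /F; nnmt.
apply: eq_integral => t _.
case: (boolP (0 < t < pi)%R) => t0pi; last by rewrite indF mul0r mule0 mul0e.
rewrite indT !mul1r mul1e.
have s0 : (0 < sin t)%R by apply: sin_gt0_pi.
have s0' := ltW s0.
rewrite -(@integral_scale _ (sin t)
  (fun y => (Num.max 0%R y)%:E * F (y * (cos t / sin t))%R y))//; last first.
  by rewrite /F; nnmt.
rewrite -nnm_integralZr; [| |by rewrite /F; nnmt]; last first.
  by rewrite lee_fin invr_ge0 sqr_ge0.
apply: eq_integral => r _.
have -> : (sin t * r * (cos t / sin t) = r * cos t)%R by field; exact: lt0r_neq0.
rewrite /F (mulrC (sin t)).
have -> : Num.max 0%R (r * sin t)%R = (Num.max 0 r * sin t)%R.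
  by rewrite -{1}(mul0r (sin t)) maxr_pMl// ltW.
rewrite !muleA -EFinM muleAC -EFinM; congr (_%:E * _).
by field; exact: lt0r_neq0.
Qed.

Lemma integral_ind_cst (a b c : R) : (a <= b)%R ->
  \int[mu]_x ((ind R (a < x < b)%R)%:E * c%:E) = (c * (b - a))%:E.
Proof.
move=> ab; rewrite (integral_ind mu (fun x : R => a < x < b)%R).
rewrite (_ : [set x | _] = `]a, b[%classic); last first.
  by apply/seteqP; split => x /=; rewrite in_itv.
rewrite integral_cst//= leb_itv/= lte_fin.
case: ltP => ab'; first by rewrite -EFinB EFinM.
by rewrite mule0 (le_anti (introT andP (conj ab ab'))) subrr mulr0.
Qed.

Lemma integral_rot_invariant (f : R * R -> \bar R) : nnm f ->
  (forall (c s : R) z, (c ^+ 2 + s ^+ 2 = 1)%R -> c != (-1)%R -> f (prot c s z) = f z) ->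
  \int[mu2]_z f z = (2 * pi)%:E * \int[mu]_r ((Num.max 0 r)%:E * f (r, 0%R)).
Proof.
move=> nf rotf; rewrite integral_polar//.
set I := \int[mu]_r ((Num.max 0 r)%:E * f (r, 0%R)).
have I0 : 0 <= I by apply: nnm_integral_ge0; nnmt.
transitivity (\int[mu]_t ((ind R (0 < t < pi)%R)%:E * (2%:E * I))).
  apply: eq_integral => t _.
  case: (boolP (0 < t < pi)%R) => t0pi; last by rewrite indF !mul0e.
  have cN1 : cos t != (-1)%R.
    rewrite -cospi; apply/eqP => /cos_inj; rewrite !in_itv/= !lexx pi_ge0.
    case/andP: t0pi => t0 tpi; rewrite (ltW t0) (ltW tpi) => /(_ isT isT) tE.
    by move: tpi; rewrite tE ltxx.
  congr (_ * _); rewrite /I -nnm_integralZl//; last by nnmt.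
  apply: eq_integral => r _.
  have -> : (r * cos t, r * sin t)%R = prot (cos t) (sin t) (r, 0%R).
    by rewrite /prot /= !mulr0 subr0 addr0 !(mulrC r).
  have -> : (r * cos t, - (r * sin t))%R = prot (cos t) (- sin t) (r, 0%R).
    by rewrite /prot /= !mulr0 subr0 addr0 !(mulrC r) mulNr.
  rewrite !rotf ?sqrrN ?cos2Dsin2//.
  by rewrite [RHS]muleCA -[2%R]/(1 + 1)%R EFinD ge0_muleDl// mul1e.
rewrite nnm_integralZr; [| |by nnmt]; last exact: mule_ge0.
have -> : \int[mu]_x (ind R (0 < x < pi)%R)%:E = pi%:E.
  transitivity (\int[mu]_x ((ind R (0 < x < pi)%R)%:E * 1%:E)).
    by apply: eq_integral => x _; rewrite mule1.
  by rewrite integral_ind_cst ?pi_ge0// subr0 mul1r.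
by rewrite muleA -EFinM mulrC.
Qed.

End polar.

(** * Configurations of two and four points *)

Section two_points.
Context {R : realType}.
Local Notation mu := (@leb R).
Local Notation mu2 := (@leb2 R).
Local Notation V := (R * R)%type.
Local Open Scope ereal_scope.

Lemma measurable_prot (c s : R) : measurable_fun setT (@prot R c s).
Proof. by rewrite /prot; meas. Qed.

Lemma two_points_rot (F : V * V -> \bar R) : nnm F ->
  (forall (c s : R) A B, (c ^+ 2 + s ^+ 2 = 1)%R -> c != (-1)%R ->
    F (prot c s A, prot c s B) = F (A, B)) ->
  \int[mu2]_A \int[mu2]_B F (A, B) =
  (2 * pi)%:E * \int[mu]_r ((Num.max 0%R r)%:E *
     \int[mu2]_A F (A, (A.1 + r, A.2)%R)).
Proof.
move=> nF rotF; pose psi (v : V) := \int[mu2]_A F (A, (v.1 + A.1, v.2 + A.2)%R).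
have npsi : nnm psi by rewrite /psi; nnmt.
have psiE v : psi v = \int[mu2]_A F (A, (v.1 + A.1, v.2 + A.2)%R) by [].
transitivity (\int[mu2]_v psi v).
  transitivity (\int[mu2]_A \int[mu2]_v F (A, (v.1 + A.1, v.2 + A.2)%R));
    last by apply: tonelli_swap; nnmt.
  apply: eq_integral => A _; symmetry.
  by apply: (@planar_shift _ A (fun B => F (A, B))); nnmt.
clearbody psi; rewrite integral_rot_invariant//; last first.
  move=> c s v cs cN1; have mprot := measurable_prot c s.
  rewrite !psiE.
  rewrite -(@planar_rot _ _ _ (fun A => F (A, ((prot c s v).1 + A.1, (prot c s v).2 + A.2)%R)) cs cN1); last by nnmt.
  apply: eq_integral => A _; rewrite -(@rotF c s A)//; congr (F (_, _)).
  by rewrite /prot/=; congr (_, _); ring.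
congr (_ * _); apply: eq_integral => r _; congr (_ * _); rewrite psiE.
by apply: eq_integral => A _ /=; rewrite add0r addrC.
Qed.

End two_points.

Section four_points.
Context {R : realType}.
Local Notation mu := (@leb R).
Local Notation mu2 := (@leb2 R).
Local Notation V := (R * R)%type.
Local Open Scope ereal_scope.

Variable F : (V * V) * (V * V) -> \bar R.
Hypothesis nF : nnm F.

Hypothesis rotF : forall (c s : R) A B C D, (c ^+ 2 + s ^+ 2 = 1)%R -> c != (-1)%R ->
  F ((prot c s A, prot c s B), (prot c s C, prot c s D)) = F ((A, B), (C, D)).

Lemma four_points_rot :
  \int[mu2]_A \int[mu2]_B \int[mu2]_C \int[mu2]_D F ((A, B), (C, D)) =
  (2 * pi)%:E * \int[mu]_r ((Num.max 0%R r)%:E *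
     \int[mu2]_A \int[mu2]_C \int[mu2]_D F ((A, (A.1 + r, A.2)%R), (C, D))).
Proof.
apply: (@two_points_rot _ (fun z => \int[mu2]_C \int[mu2]_D F (z, (C, D)))).
  by nnmt.
move=> c s A B cs cN1; have mprot := @measurable_prot R c s.
rewrite -(@planar_rot _ _ _ (fun C => \int[mu2]_D F ((prot c s A, prot c s B), (C, D))) cs cN1); last by nnmt.
apply: eq_integral => C _.
rewrite -(@planar_rot _ _ _ (fun D => F ((prot c s A, prot c s B), (prot c s C, D))) cs cN1); last by nnmt.
by apply: eq_integral => D _; rewrite rotF.
Qed.

Hypothesis reflF : forall A B C D : V,
  F (((A.1, - A.2), (B.1, - B.2)), ((C.1, - C.2), (D.1, - D.2)))%R
  = F ((A, B), (C, D)).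

Lemma four_points_polar :
  \int[mu2]_A \int[mu2]_B \int[mu2]_C \int[mu2]_D F ((A, B), (C, D)) =
  (4 * pi)%:E * \int[mu]_t ((ind R (0 < t < pi)%R)%:E *
    \int[mu]_q ((Num.max 0%R q)%:E * \int[mu]_r ((Num.max 0%R r)%:E *
     \int[mu2]_A \int[mu2]_C
       F ((A, (A.1 + r, A.2)%R), (C, (C.1 + q * cos t, C.2 + q * sin t)%R))))).
Proof.
rewrite four_points_rot.
pose Psi (v : V) := \int[mu]_r ((Num.max 0%R r)%:E *
  \int[mu2]_A \int[mu2]_C F ((A, (A.1 + r, A.2)%R), (C, (C.1 + v.1, C.2 + v.2)%R))).
have nPsi : nnm Psi by rewrite /Psi; nnmt.
transitivity ((2 * pi)%:E * \int[mu2]_v Psi v).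
  apply: (congr1 (mule _)); rewrite /Psi.
  transitivity (\int[mu]_r \int[mu2]_v ((Num.max 0%R r)%:E *
    \int[mu2]_A \int[mu2]_C F ((A, (A.1 + r, A.2)%R), (C, (C.1 + v.1, C.2 + v.2)%R))));
    last by apply: tonelli_swap; nnmt.
  apply: eq_integral => r _; symmetry.
  etransitivity; first by apply: nnm_integralZl; [rewrite lee_fin le_max lexx|nnmt].
  apply: (congr1 (mule _)); symmetry.
  transitivity (\int[mu2]_A \int[mu2]_v \int[mu2]_C F ((A, (A.1 + r, A.2)%R), (C, (C.1 + v.1, C.2 + v.2)%R)));
    last by apply: tonelli_swap; nnmt.
  apply: eq_integral => A _.
  transitivity (\int[mu2]_C \int[mu2]_v F ((A, (A.1 + r, A.2)%R), (C, (C.1 + v.1, C.2 + v.2)%R)));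
    last by apply: tonelli_swap; nnmt.
  apply: eq_integral => C _; symmetry.
  under eq_integral => v _ do rewrite (addrC C.1) (addrC C.2).
  by apply: (@planar_shift _ C (fun D => F ((A, (A.1 + r, A.2)%R), (C, D)))); nnmt.
have refl_Psi (x y : R) : Psi (x, - y)%R = Psi (x, y).
  rewrite /Psi; apply: eq_integral => r _; apply: (congr1 (mule _)).
  rewrite -planar_reflect; last by nnmt.
  apply: eq_integral => A _ /=; rewrite -planar_reflect; last by nnmt.
  apply: eq_integral => C _ /=; rewrite -[RHS]reflF/=.
  by rewrite -opprD.
rewrite (integral_polar nPsi) (_ : (4 * pi = 2 * pi * 2)%R); last by ring.
rewrite (EFinM (2 * pi)%R) -muleA; apply: (congr1 (mule _)).
transitivity (2%:E * \int[mu]_t ((ind R (0 < t < pi)%R)%:E *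
    \int[mu]_q ((Num.max 0%R q)%:E * Psi (q * cos t, q * sin t)%R))); last by [].
clearbody Psi; symmetry.
etransitivity; first by symmetry; apply: nnm_integralZl; [|nnmt].
apply: eq_integral => t _; rewrite muleCA; apply: (congr1 (mule _)).
etransitivity; first by symmetry; apply: nnm_integralZl; [|nnmt].
apply: eq_integral => q _; rewrite muleCA; apply: (congr1 (mule _)).
by rewrite refl_Psi -[2%R]/(1 + 1)%R EFinD ge0_muleDl// mul1e.
Qed.

End four_points.

Section one_dim.
Context {R : realType}.
Local Notation mu := (@leb R).
Local Notation mu2 := (@leb2 R).
Local Open Scope ereal_scope.

Lemma integral_indicE (i : interval R) (f : R -> \bar R) :
  \int[mu]_x ((ind R (x \in i))%:E * f x) = \int[mu]_(x in [set` i]) f x.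
Proof. exact: (integral_ind mu (fun x => x \in i)). Qed.

Lemma integral_FTC (f F : R -> R) (a b : R) : (a <= b)%R ->
  (forall x : R, is_derive x 1%R F (f x)) -> continuous f ->
  (forall x, (a <= x <= b)%R -> (0 <= f x)%R) ->
  \int[mu]_x ((ind R (a <= x <= b)%R)%:E * (f x)%:E) = (F b - F a)%:E.
Proof.
move=> ab dF cf f0.
have -> : \int[mu]_x ((ind R (a <= x <= b)%R)%:E * (f x)%:E) =
    \int[mu]_(x in `[a, b]%classic) (f x)%:E.
  rewrite -integral_indicE; apply: eq_integral => x _.
  by rewrite in_itv.
rewrite lebE//; last first.
  by apply/measurable_EFinP; apply: measurable_funTS; exact: continuous_measurable_fun.
move: ab; rewrite le_eqVlt => /predU1P[->|ab].
  by rewrite set_itv1 integral_set1 subrr.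
have cF : continuous F.
  by move=> x; apply/differentiable_continuous/derivable1_diffP; case: (dF x).
rewrite (@continuous_FTC2 _ f F)//.
- exact: continuous_subspaceT.
- split.
  + by move=> x _; case: (dF x).
  + by apply: cvg_at_right_filter; exact: cF.
  + by apply: cvg_at_left_filter; exact: cF.
- by move=> x _; rewrite derive1E; have := dF x => h; rewrite derive_val.
Qed.

Lemma integral_affine (a b k m : R) : (a <= b)%R ->
  (forall x, (a <= x <= b)%R -> (0 <= k + m * x)%R) ->
  \int[mu]_x ((ind R (a <= x <= b)%R)%:E * (k + m * x)%:E) =
  ((k + m * (a + b) / 2) * (b - a))%:E.
Proof.
move=> ab km0.
pose F x := (k * x + m / 2 * x ^+ 2)%R.
have dF (x : R) : is_derive x 1%R F (k + m * x)%R.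
  by apply: is_derive_eq; rewrite /GRing.scale/=; field.
rewrite (integral_FTC ab dF)//; last first.
  move=> x; apply: continuousD; first exact: cst_continuous.
  by apply: continuousM; [exact: cst_continuous|exact: id].
by rewrite /F; congr (_%:E); field.
Qed.

Lemma integral_square (a b k : R) : (a <= b)%R ->
  \int[mu]_x ((ind R (a <= x <= b)%R)%:E * ((k - x) ^+ 2)%:E) =
  (((k - a) ^+ 3 - (k - b) ^+ 3) / 3)%:E.
Proof.
move=> ab.
pose F x := (- ((k - x) ^+ 3 / 3))%R.
have dF (x : R) : is_derive x 1%R F ((k - x) ^+ 2)%R.
  by apply: is_derive_eq; rewrite /GRing.scale/=; field.
rewrite (integral_FTC ab dF).
- by rewrite /F; congr (_%:E); field.
- move=> x.
  apply: (@continuous_comp _ _ _ (fun x => k - x)%R (fun y : R => y ^+ 2)%R).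
    by apply: continuousB; [exact: cst_continuous|exact: id].
  exact: exprn_continuous.
- by move=> x _; exact: sqr_ge0.
Qed.

End one_dim.

(** * Chords of the disk *)

Definition disk (R : realType) (z : R * R) : bool := z.1 ^+ 2 + z.2 ^+ 2 <= 1.

Definition chord (R : realType) (x : R) : R := Num.sqrt (1 - x ^+ 2).

Section chord_moment.
Context {R : realType}.
Local Notation mu := (@leb R).
Local Notation mu2 := (@leb2 R).
Local Notation h := (@chord R).

Lemma chord_ge0 (x : R) : 0 <= h x.
Proof. exact: sqrtr_ge0. Qed.

Lemma chord_sqr (x : R) : x ^+ 2 <= 1 -> h x ^+ 2 = 1 - x ^+ 2.
Proof. by move=> x1; rewrite sqr_sqrtr// subr_ge0. Qed.

Lemma chordN (x : R) : h (- x) = h x.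
Proof. by rewrite /chord sqrrN. Qed.

Lemma sqr_le_chord (x y : R) : (y ^+ 2 + x ^+ 2 <= 1) = (x ^+ 2 <= 1) && (- h x <= y <= h x).
Proof.
rewrite -ler_norml.
have [x1|x1] := leP (x ^+ 2) 1; last first.
  by apply/negbTE; rewrite -ltNge (lt_le_trans x1)// lerDr sqr_ge0.
rewrite /= -lerBrDr -chord_sqr// -[LHS]ler_sqrt ?sqr_ge0//.
by rewrite !sqrtr_sqr (ger0_norm (chord_ge0 x)).
Qed.

Local Open Scope ereal_scope.

(* [t] and [q] are the distances from [X = (x, y)] to the end points of a
   segment through [X] of direction [(c, s)]. *)
Lemma chord_moment_aux (x y c s t q : R) : (c ^+ 2 + s ^+ 2 = 1)%R ->
  [&& 0 <= t, 0 <= q, disk (x - t * c, y - t * s) & disk (x + q * c, y + q * s)]%R =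
  [&& x ^+ 2 + y ^+ 2 <= 1, 0 <= t <= h (x * s - y * c) + (x * c + y * s)
   & 0 <= q <= h (x * s - y * c) - (x * c + y * s)]%R.
Proof.
move=> cs.
set rho := (x * s - y * c)%R; set m := (x * c + y * s)%R.
have xy : (x ^+ 2 + y ^+ 2 = m ^+ 2 + rho ^+ 2)%R.
  rewrite -[LHS]mulr1 -cs /m /rho; ring.
have d1 : disk (x - t * c, y - t * s)%R = ((m - t) ^+ 2 + rho ^+ 2 <= 1)%R.
  rewrite /disk/=; congr (_ <= _)%R.
  transitivity ((x ^+ 2 + y ^+ 2) - 2 * t * m + t ^+ 2 * (c ^+ 2 + s ^+ 2))%R.
    by rewrite /m; ring.
  by rewrite xy cs; ring.
have d2 : disk (x + q * c, y + q * s)%R = ((q + m) ^+ 2 + rho ^+ 2 <= 1)%R.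
  rewrite /disk/=; congr (_ <= _)%R.
  transitivity ((x ^+ 2 + y ^+ 2) + 2 * q * m + q ^+ 2 * (c ^+ 2 + s ^+ 2))%R.
    by rewrite /m; ring.
  by rewrite xy cs; ring.
rewrite xy d1 d2; clearbody rho m; apply/idP/idP.
- move=> /and4P[t0 q0 D1 D2].
  have mr : (m ^+ 2 + rho ^+ 2 <= 1)%R.
    rewrite leNgt; apply/negP => H.
    have E1 : ((m - t) ^+ 2 = m ^+ 2 - 2 * (t * m) + t ^+ 2)%R by ring.
    have E2 : ((q + m) ^+ 2 = m ^+ 2 + 2 * (q * m) + q ^+ 2)%R by ring.
    have t2 := sqr_ge0 t; have q2 := sqr_ge0 q; rewrite E1 in D1; rewrite E2 in D2.
    have [m0|m0] := leP 0%R m; first by have := mulr_ge0 q0 m0; lra.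
    by have := mulr_ge0_le0 t0 (ltW m0); lra.
  rewrite mr t0 q0/=; move: D1 D2; rewrite !sqr_le_chord => /and3P[_ ? ?] /and3P[_ ? ?].
  by apply/andP; split; lra.
- move=> /and3P[mr /andP[t0 tle] /andP[q0 qle]]; rewrite t0 q0/=.
  move: mr; rewrite !sqr_le_chord => /and3P[-> m1 m2]/=.
  by apply/and3P; split; [apply/andP; split| |]; lra.
Qed.

Lemma chord_moment (x y c s : R) : (c ^+ 2 + s ^+ 2 = 1)%R ->
  \int[mu]_r ((Num.max 0%R r)%:E * \int[mu]_t
     (ind R [&& 0 <= t <= r, disk (x - t * c, y - t * s)
              & disk (x + (r - t) * c, y + (r - t) * s)]%R)%:E) =
  (ind R (x ^+ 2 + y ^+ 2 <= 1)%R *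
    (h (x * s - y * c) * (1 - (x ^+ 2 + y ^+ 2))))%:E.
Proof.
move=> cs.
pose a := (h (x * s - y * c) + (x * c + y * s))%R.
pose b := (h (x * s - y * c) - (x * c + y * s))%R.
pose I t r : \bar R := (Num.max 0%R r)%:E * (ind R [&& 0 <= t <= r, disk (x - t * c, y - t * s)
              & disk (x + (r - t) * c, y + (r - t) * s)]%R)%:E.
transitivity (\int[mu]_r \int[mu]_t I t r).
  apply: eq_integral => r _; symmetry; apply: nnm_integralZl.
    by rewrite lee_fin le_max lexx.
  by rewrite /disk; nnmt.
transitivity (\int[mu]_t \int[mu]_r I t r).
  by apply: tonelli_swap; rewrite /I /disk; nnmt.
transitivity (\int[mu]_t \int[mu]_q I t (q + t)%R).
  apply: eq_integral => t _; symmetry; apply: (@integral_shift _ t (I t)).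
  by rewrite /I /disk; nnmt.
have IE t q : I t (q + t)%R = (ind R (x ^+ 2 + y ^+ 2 <= 1)%R)%:E *
    ((ind R (0 <= t <= a)%R)%:E * ((ind R (0 <= q <= b)%R)%:E * (t + 1 * q)%:E)).
  have := chord_moment_aux x y t q cs; rewrite -/a -/b => E.
  rewrite /I lerDr addrK.
  transitivity ((Num.max 0%R (q + t))%:E * (ind R
      [&& 0 <= t, 0 <= q, disk (x - t * c, y - t * s) & disk (x + q * c, y + q * s)]%R)%:E).
    by rewrite -andbA.
  rewrite E (ind_and _ (x ^+ 2 + y ^+ 2 <= 1)%R) (ind_and _ (0 <= t <= a)%R) -!EFinM.
  congr (_%:E).
  case: (boolP (0 <= t <= a)%R) => [/andP[t0 _]|_]; last by rewrite indF; ring.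
  case: (boolP (0 <= q <= b)%R) => [/andP[q0 _]|_]; last by rewrite indF; ring.
  by rewrite (max_idPr (addr_ge0 q0 t0)); ring.
transitivity (\int[mu]_t \int[mu]_q ((ind R (x ^+ 2 + y ^+ 2 <= 1)%R)%:E *
    ((ind R (0 <= t <= a)%R)%:E * ((ind R (0 <= q <= b)%R)%:E * (t + 1 * q)%:E)))).
  by apply: eq_integral => t _; apply: eq_integral => q _; exact: IE.
case: (boolP (x ^+ 2 + y ^+ 2 <= 1)%R) => xy1; last first.
  rewrite indF mul0r integral0_eq// => t _; rewrite integral0_eq// => q _.
  by rewrite mul0e.
have xy : (x ^+ 2 + y ^+ 2 = (x * c + y * s) ^+ 2 + (x * s - y * c) ^+ 2)%R.
  rewrite -[LHS]mulr1 -cs; ring.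
move: (xy1); rewrite xy sqr_le_chord => /and3P[r1 m1 m2].
have a0 : (0 <= a)%R by rewrite /a; lra.
have b0 : (0 <= b)%R by rewrite /b; lra.
transitivity (\int[mu]_t ((ind R (0 <= t <= a)%R)%:E * (b ^+ 2 / 2 + b * t)%:E)).
  apply: eq_integral => t _.
  case: (boolP (0 <= t <= a)%R) => [/andP[t0 _]|_]; last first.
    by rewrite indF mul0e integral0_eq// => q _; rewrite mul0e mule0.
  under eq_integral => q _ do rewrite indT !mul1e.
  rewrite indT mul1e integral_affine//; first by congr (_%:E); field.
  by move=> q /andP[q0 _]; rewrite addr_ge0// mul1r.
rewrite integral_affine//; last first.
  by move=> q /andP[q0 _]; rewrite addr_ge0 ?mulr_ge0// sqr_ge0.
rewrite indT mul1r; congr (_%:E).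
transitivity (a * b * (a + b) / 2)%R; first by field.
have -> : (a + b = 2 * h (x * s - y * c))%R by rewrite /a /b; ring.
have -> : (a * b = h (x * s - y * c) ^+ 2 - (x * c + y * s) ^+ 2)%R by rewrite /a /b; ring.
by rewrite chord_sqr//; field.
Qed.

Lemma chord_length_moment (u : R) :
  \int[mu]_r ((Num.max 0%R r)%:E * \int[mu]_x
     (ind R (disk (x, u) && disk (x + r, u)%R))%:E) = (4 / 3 * h u ^+ 3)%:E.
Proof.
pose I x r : \bar R := (Num.max 0%R r)%:E * (ind R (disk (x, u) && disk (x + r, u)%R))%:E.
transitivity (\int[mu]_r \int[mu]_x I x r).
  apply: eq_integral => r _; symmetry; apply: nnm_integralZl.
    by rewrite lee_fin le_max lexx.
  by rewrite /disk; nnmt.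
transitivity (\int[mu]_x \int[mu]_r I x r).
  by apply: tonelli_swap; rewrite /I /disk; nnmt.
transitivity (\int[mu]_x \int[mu]_y I x (y - x)%R).
  apply: eq_integral => x _; symmetry; apply: (@integral_shift _ (- x)%R (I x)).
  by rewrite /I /disk; nnmt.
have [u1|u1] := leP (u ^+ 2)%R 1%R; last first.
  have -> : h u = 0%R by rewrite /chord ler0_sqrtr// subr_le0 ltW.
  rewrite expr0n/= mulr0 integral0_eq// => x _; rewrite integral0_eq// => y _.
  by rewrite /I /disk/= sqr_le_chord leNgt u1/= indF mule0.
have h0 := chord_ge0 u.
transitivity (\int[mu]_x ((ind R (- h u <= x <= h u)%R)%:E * (((h u - x) ^+ 2)%:E * (2^-1)%:E))).
  apply: eq_integral => x _.
  case: (boolP (- h u <= x <= h u)%R) => xh; last first.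
    rewrite indF mul0e integral0_eq// => y _.
    by rewrite /I /disk/= sqr_le_chord (negbTE xh) andbF/= indF mule0.
  transitivity (\int[mu]_y ((ind R (x <= y <= h u)%R)%:E * (- x + 1 * y)%:E)).
    apply: eq_integral => y _; rewrite /I (addrC x (y - x)%R) subrK /disk/= !sqr_le_chord u1 xh/=.
    case: (leP x y) => xy /=.
      rewrite (max_idPr _) ?subr_ge0// mul1r (addrC _ y) muleC; congr ((ind R _)%:E * _).
      by apply/andb_idl => ?; move/andP: xh => [? ?]; lra.
    by rewrite (max_idPl _) ?subr_le0 ?(ltW xy)// mul0e indF mul0e.
  move/andP: xh => [xh1 xh2]; rewrite integral_affine//; last by move=> y /andP[? ?]; lra.
  by rewrite indT mul1e -EFinM; congr (_%:E); field.
transitivity (\int[mu]_x ((ind R (- h u <= x <= h u)%R)%:E * ((h u - x) ^+ 2)%:E) * (2^-1)%:E).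
  symmetry; etransitivity.
    by symmetry; apply: nnm_integralZr; [rewrite lee_fin invr_ge0|nnmt].
  by apply: eq_integral => x _; rewrite muleA.
rewrite integral_square; last by lra.
by rewrite -EFinM; congr (_%:E); field.
Qed.

End chord_moment.

(** * Crossing of segments *)

Section segments.
Context {R : realType}.
Local Notation V := (R * R)%type.
Implicit Types (A B C D X u v : V).

Definition cross u v : R := u.1 * v.2 - u.2 * v.1.

Definition on_segment X A B : bool :=
  (cross (B - A) (X - A) == 0) && (dot2 (A - X) (B - X) <= 0).

Definition meetb A B C D : bool :=
  if cross (B - A) (D - C) != 0 then
    (cross (B - A) (C - A) * cross (B - A) (D - A) <= 0) &&
    (cross (D - C) (A - C) * cross (D - C) (B - C) <= 0)
  else [|| on_segment C A B, on_segment D A B, on_segment A C D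
         | on_segment B C D].

Lemma pair_ext (z w : V) : z.1 = w.1 -> z.2 = w.2 -> z = w.
Proof. by case: z w => ? ? [? ?] /= -> ->. Qed.

Lemma segmentP A B X : segment A B X <->
  exists a, [/\ 0 <= a <= 1, X.1 = A.1 + a * (B.1 - A.1)
              & X.2 = A.2 + a * (B.2 - A.2)].
Proof.
split=> [[a /=]|[a [a01 X1 X2]]].
  rewrite in_itv/= => a01 <-; exists a; split => //=; rewrite /GRing.scale/=; ring.
exists a; first by rewrite /= in_itv.
by apply: pair_ext; rewrite /= ?X1 ?X2 /GRing.scale/=; ring.
Qed.

Lemma sqr_sum_eq0 (x y : R) : x ^+ 2 + y ^+ 2 = 0 -> x = 0 /\ y = 0.
Proof.
move=> /eqP; rewrite paddr_eq0 ?sqr_ge0// !sqrf_eq0 => /andP[/eqP-> /eqP->].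
by [].
Qed.

Lemma on_segmentP A B X : segment A B X <-> on_segment X A B.
Proof.
split=> [/segmentP[a [/andP[a0 a1] X1 X2]]|].
  apply/andP; split; rewrite /cross /dot2/= X1 X2; first by apply/eqP; ring.
  rewrite (_ : _ + _ = - (a * (1 - a) * ((B.1 - A.1) ^+ 2 + (B.2 - A.2) ^+ 2))); last by ring.
  rewrite oppr_le0; apply: mulr_ge0; last by rewrite addr_ge0 ?sqr_ge0.
  by apply: mulr_ge0 => //; lra.
case/andP => /eqP; rewrite /cross /dot2/= => cr dt; apply/segmentP.
have [u0|u0] := eqVneq ((B.1 - A.1) ^+ 2 + (B.2 - A.2) ^+ 2) 0.
  have [b1 b2] := sqr_sum_eq0 u0.
  have e1 : B.1 = A.1 by lra.
  have e2 : B.2 = A.2 by lra.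
  move: dt; rewrite e1 e2 => dt.
  have [|x1 x2] := @sqr_sum_eq0 (A.1 - X.1) (A.2 - X.2).
    apply/eqP; rewrite eq_le addr_ge0 ?sqr_ge0// andbT.
    by apply: le_trans dt; rewrite le_eqVlt; apply/orP; left; apply/eqP; ring.
  by exists 0; split; [rewrite lexx ler01|lra|lra].
have up : 0 < (B.1 - A.1) ^+ 2 + (B.2 - A.2) ^+ 2.
  by rewrite lt_neqAle eq_sym u0 addr_ge0 ?sqr_ge0.
set n := _ + _ in u0 up.
pose a := ((X.1 - A.1) * (B.1 - A.1) + (X.2 - A.2) * (B.2 - A.2)) / n.
have an : a * n = (X.1 - A.1) * (B.1 - A.1) + (X.2 - A.2) * (B.2 - A.2).
  by rewrite /a mulfVK.
have E1 : X.1 - A.1 = a * (B.1 - A.1).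
  apply: (mulIf u0); rewrite mulrAC an /n.
  apply/eqP; rewrite -subr_eq0; apply/eqP.
  transitivity (- (B.2 - A.2) * ((B.1 - A.1) * (X.2 - A.2) - (B.2 - A.2) * (X.1 - A.1))).
    by ring.
  by rewrite cr mulr0.
have E2 : X.2 - A.2 = a * (B.2 - A.2).
  apply: (mulIf u0); rewrite mulrAC an /n.
  apply/eqP; rewrite -subr_eq0; apply/eqP.
  transitivity ((B.1 - A.1) * ((B.1 - A.1) * (X.2 - A.2) - (B.2 - A.2) * (X.1 - A.1))).
    by ring.
  by rewrite cr mulr0.
exists a; split; [|lra|lra].
have : a * (a - 1) * n <= 0.
  apply: le_trans dt; rewrite le_eqVlt; apply/orP; left; apply/eqP.
  transitivity ((a * (B.1 - A.1)) ^+ 2 + (a * (B.2 - A.2)) ^+ 2 - a * n).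
    by rewrite /n; ring.
  by rewrite -E1 -E2 an; ring.
rewrite pmulr_lle0// => aa; apply/andP; split; nra.
Qed.

Lemma mul_le0_itv (x r : R) : 0 < r -> (x * (x - r) <= 0) = (0 <= x <= r).
Proof. by move=> r0; apply/idP/andP => [|[]]; nra. Qed.

(* For non-parallel lines the common point is [A + a u = C + b v] with
   [a = cross v (A - C) / cross u v] and [b = - cross u (C - A) / cross u v]. *)
Lemma meetP A B C D : segment A B `&` segment C D !=set0 <-> meetb A B C D.
Proof.
rewrite /meetb; have [k0|k0] /= := eqVneq (cross (B - A) (D - C)) 0; last first.
  set k := cross _ _ in k0.
  have kk : 0 < k ^+ 2 by rewrite exprn_even_gt0.
  set p := cross (B - A) (C - A); set w := cross (D - C) (A - C).
  have -> : cross (B - A) (D - A) = p + k by rewrite /p /k /cross/=; ring.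
  have -> : cross (D - C) (B - C) = w - k by rewrite /w /k /cross/=; ring.
  have cond (x : R) : (x * (x - k) <= 0) = (0 <= x / k <= 1).
    have -> : x * (x - k) = (x / k) * (x / k - 1) * k ^+ 2 by field.
    by rewrite pmulr_lle0//; apply/idP/andP => [|[]]; nra.
  have -> : p * (p + k) = (- p) * (- p - k) by ring.
  rewrite !cond; split=> [[X [/segmentP[a [a01 X1 X2]] /segmentP[b [b01 Y1 Y2]]]]|].
    have e1 : A.1 + a * (B.1 - A.1) = C.1 + b * (D.1 - C.1) by rewrite -X1.
    have e2 : A.2 + a * (B.2 - A.2) = C.2 + b * (D.2 - C.2) by rewrite -X2.
    have f1 : a * (B.1 - A.1) - b * (D.1 - C.1) = C.1 - A.1 by lra.
    have f2 : a * (B.2 - A.2) - b * (D.2 - C.2) = C.2 - A.2 by lra.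
    have -> : w = a * k.
      transitivity ((C.1 - A.1) * (D.2 - C.2) - (C.2 - A.2) * (D.1 - C.1)).
        by rewrite /w /cross/=; ring.
      by rewrite -f1 -f2 /k /cross/=; ring.
    have -> : - p = b * k.
      transitivity ((B.2 - A.2) * (C.1 - A.1) - (B.1 - A.1) * (C.2 - A.2)).
        by rewrite /p /cross/=; ring.
      by rewrite -f1 -f2 /k /cross/=; ring.
    by rewrite !mulfK// a01 b01.
  case/andP=> pk wk.
  have X1 : A.1 + w / k * (B.1 - A.1) = C.1 + - p / k * (D.1 - C.1).
    transitivity ((A.1 * k + w * (B.1 - A.1)) / k); first by field.
    transitivity ((C.1 * k - p * (D.1 - C.1)) / k); last by field.
    by congr (_ / _); rewrite /w /p /k /cross/=; ring.
  have X2 : A.2 + w / k * (B.2 - A.2) = C.2 + - p / k * (D.2 - C.2).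
    transitivity ((A.2 * k + w * (B.2 - A.2)) / k); first by field.
    transitivity ((C.2 * k - p * (D.2 - C.2)) / k); last by field.
    by congr (_ / _); rewrite /w /p /k /cross/=; ring.
  exists (A.1 + w / k * (B.1 - A.1), A.2 + w / k * (B.2 - A.2)); split.
    by apply/segmentP; exists (w / k).
  by apply/segmentP; exists (- p / k).
have endA X Y : segment X Y X.
  by apply/segmentP; exists 0; split; [rewrite lexx ler01|ring|ring].
have endB X Y : segment X Y Y.
  by apply/segmentP; exists 1; split; [rewrite lexx ler01|ring|ring].
split; last first.
  by case/or4P => /on_segmentP h; [exists C|exists D|exists A|exists B].
case=> [X [/segmentP[a [/andP[a0 a1] X1 X2]] XCD]].
have [n0|n0] := eqVneq ((B.1 - A.1) ^+ 2 + (B.2 - A.2) ^+ 2) 0.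
  have [u1 u2] := sqr_sum_eq0 n0.
  have XA : X = A by apply: pair_ext; rewrite ?X1 ?X2 ?u1 ?u2 mulr0 addr0.
  by apply/or4P/Or43/on_segmentP; rewrite -XA.
move/segmentP : XCD => [b [/andP[b0 b1] Y1 Y2]].
have {Y1}e1 : A.1 + a * (B.1 - A.1) = C.1 + b * (D.1 - C.1) by rewrite -X1.
have {Y2}e2 : A.2 + a * (B.2 - A.2) = C.2 + b * (D.2 - C.2) by rewrite -X2.
set n := _ + _ in n0.
pose l := ((B.1 - A.1) * (D.1 - C.1) + (B.2 - A.2) * (D.2 - C.2)) / n.
have ln : l * n = (B.1 - A.1) * (D.1 - C.1) + (B.2 - A.2) * (D.2 - C.2).
  by rewrite /l mulfVK.
have v1 : D.1 - C.1 = l * (B.1 - A.1).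
  apply: (mulIf n0); rewrite mulrAC ln.
  apply/eqP; rewrite -subr_eq0; apply/eqP.
  transitivity (- (B.2 - A.2) * cross (B - A) (D - C)); last by rewrite k0 mulr0.
  by rewrite /n /cross/=; ring.
have v2 : D.2 - C.2 = l * (B.2 - A.2).
  apply: (mulIf n0); rewrite mulrAC ln.
  apply/eqP; rewrite -subr_eq0; apply/eqP.
  transitivity ((B.1 - A.1) * cross (B - A) (D - C)); last by rewrite k0 mulr0.
  by rewrite /n /cross/=; ring.
rewrite v1 in e1; rewrite v2 in e2.
pose g := a - b * l.
have c1 : C.1 = A.1 + g * (B.1 - A.1) by rewrite /g; lra.
have c2 : C.2 = A.2 + g * (B.2 - A.2) by rewrite /g; lra.
have d1 : D.1 = A.1 + (g + l) * (B.1 - A.1) by lra.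
have d2 : D.2 = A.2 + (g + l) * (B.2 - A.2) by lra.
have gl : 0 <= g + b * l <= 1 by rewrite /g subrK a0.
clearbody g.
have [g01|g01] := boolP (0 <= g <= 1).
  by apply/or4P/Or41/on_segmentP/segmentP; exists g.
have [h01|h01] := boolP (0 <= g + l <= 1).
  by apply/or4P/Or42/on_segmentP/segmentP; exists (g + l).
have l0 : l != 0 by apply: contraNneq g01 => l0; move: gl; rewrite l0 mulr0 addr0.
apply/or4P/Or43/on_segmentP/segmentP; exists (- g / l); split.
- have -> : (0 <= - g / l <= 1) = (- g * (- g - l) <= 0).
    have -> : - g * (- g - l) = (- g / l) * (- g / l - 1) * l ^+ 2 by field.
    rewrite pmulr_lle0 ?exprn_even_gt0//.
    by apply/andP/idP => [[]|]; nra.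
  have [g0|g0] := leP 0 g.
    have g1 : 1 < g by move: g01; rewrite g0/= -ltNge.
    have l1 : l < 0 by move/andP: gl => [_ gl]; nra.
    have h0 : g + l < 0.
      move: h01; rewrite negb_and -!ltNge => /orP[//|h1].
      by move/andP: gl => [_ gl]; nra.
    by nra.
  have l1 : 0 < l by move/andP: gl => [gl _]; nra.
  have h0 : 1 < g + l.
    move: h01; rewrite negb_and -!ltNge => /orP[h1|//].
    by move/andP: gl => [gl _]; nra.
  by nra.
- rewrite v1 c1; field.
  by [].
- rewrite v2 c2; field.
  by [].
Qed.

End segments.

Section swaps.
Context {R : realType}.
Local Notation mu := (@leb R).
Local Notation mu2 := (@leb2 R).
Local Open Scope ereal_scope.

Lemma integral_flip (p : R) (f : R -> \bar R) : nnm f ->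
  \int[mu]_x f (p - x)%R = \int[mu]_x f x.
Proof.
move=> nf; rewrite -(integral_shift p nf).
rewrite -[RHS]integral_reflect; last by nnmt.
by apply: eq_integral => x _; rewrite addrC.
Qed.

(* Oblique coordinates [(p - b c, u - b s)] with respect to the horizontal line
   of height [u] and the direction [(c, s)]. *)
Lemma planar_oblique (u c s : R) (f : R * R -> \bar R) : (0 < s)%R -> nnm f ->
  \int[mu2]_z f z =
  \int[mu]_p \int[mu]_b (s%:E * f (p - b * c, u - b * s)%R).
Proof.
move=> s0 nf; have s0' := ltW s0.
rewrite (planarEr nf).
transitivity (\int[mu]_b \int[mu]_p (s%:E * f (p - b * c, u - b * s)%R)); last first.
  by apply: tonelli_swap; nnmt.
rewrite -(@integral_flip u); last by nnmt.
rewrite -(@integral_scale _ s)//; last by nnmt.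
apply: eq_integral => b _; symmetry.
etransitivity; first by apply: nnm_integralZl; [rewrite lee_fin|nnmt].
apply: (congr1 (mule _)); rewrite (mulrC s b).
by apply: (@integral_shift _ (- (b * c))%R (fun p => f (p, u - b * s)%R)); nnmt.
Qed.

Lemma fubini_product (f g : (R * R) * (R * R) -> \bar R) : nnm f -> nnm g ->
  \int[mu]_q \int[mu]_r \int[mu]_u \int[mu]_a \int[mu]_p \int[mu]_b
    (f ((u, p), (r, a)) * g ((u, p), (q, b))) =
  \int[mu]_u \int[mu]_p ((\int[mu]_r \int[mu]_a f ((u, p), (r, a))) *
                         (\int[mu]_q \int[mu]_b g ((u, p), (q, b)))).
Proof.
move=> nf ng.
pose f1 z r := \int[mu]_a f (z, (r, a)).
pose g1 z q := \int[mu]_b g (z, (q, b)).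
have nf1 : nnm (fun w : (R * R) * R => f1 w.1 w.2) by rewrite /f1; nnmt.
have ng1 : nnm (fun w : (R * R) * R => g1 w.1 w.2) by rewrite /g1; nnmt.
have nf1' z : nnm (f1 z) by rewrite /f1; nnmt.
have ng1' z : nnm (g1 z) by rewrite /g1; nnmt.
have f1_ge0 z r : 0 <= f1 z r by have [_] := nf1' z.
have g1_ge0 z r : 0 <= g1 z r by have [_] := ng1' z.
have nf1c d (T : measurableType d) (k : T -> R * R) (l : T -> R) :
    measurable_fun setT k -> measurable_fun setT l -> nnm (fun x => f1 (k x) (l x)).
  by move=> mk ml; apply: (nnm_comp nf1 (g := fun x => (k x, l x))); meas.
have ng1c d (T : measurableType d) (k : T -> R * R) (l : T -> R) :
    measurable_fun setT k -> measurable_fun setT l -> nnm (fun x => g1 (k x) (l x)).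
  by move=> mk ml; apply: (nnm_comp ng1 (g := fun x => (k x, l x))); meas.
transitivity (\int[mu]_q \int[mu]_r \int[mu]_u \int[mu]_p
    (f1 (u, p) r * g1 (u, p) q)).
  apply: eq_integral => q _; apply: eq_integral => r _; apply: eq_integral => u _.
  transitivity (\int[mu]_a \int[mu]_p (f ((u, p), (r, a)) * g1 (u, p) q)).
    apply: eq_integral => a _; apply: eq_integral => p _.
    by apply: nnm_integralZl; [case: nf|nnmt].
  etransitivity; first apply: tonelli_swap.
    apply: nnmM; first by nnmt.
    by apply: ng1c; meas.
  apply: eq_integral => p _.
  by apply: nnm_integralZr; [exact: g1_ge0|nnmt].
transitivity (\int[mu]_u \int[mu]_p ((\int[mu]_r f1 (u, p) r) *
    (\int[mu]_q g1 (u, p) q))); last by [].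
clearbody f1 g1.
transitivity (\int[mu]_u \int[mu]_p \int[mu]_q \int[mu]_r
    (f1 (u, p) r * g1 (u, p) q)).
  transitivity (\int[mu]_q \int[mu]_u \int[mu]_p \int[mu]_r
      (f1 (u, p) r * g1 (u, p) q)).
    apply: eq_integral => q _.
    etransitivity; first apply: tonelli_swap.
      by apply: nnm_integral; apply: nnmM; [apply: nf1c|apply: ng1c]; meas.
    apply: eq_integral => u _; apply: tonelli_swap.
    by apply: nnmM; [apply: nf1c|apply: ng1c]; meas.
  etransitivity; first apply: tonelli_swap.
    by apply: nnm_integral; apply: nnm_integral; apply: nnmM;
      [apply: nf1c|apply: ng1c]; meas.
  apply: eq_integral => u _; apply: tonelli_swap.
  by apply: nnm_integral; apply: nnmM; [apply: nf1c|apply: ng1c]; meas.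
apply: eq_integral => u _; apply: eq_integral => p _.
transitivity (\int[mu]_q ((\int[mu]_r f1 (u, p) r) * g1 (u, p) q)).
  by apply: eq_integral => q _; apply: nnm_integralZr.
by apply: nnm_integralZl => //; apply: nnm_integral_ge0.
Qed.

End swaps.

Section acos.
Context {R : realType}.
Local Open Scope ring_scope.

Lemma measurable_acos : measurable_fun setT (@acos R).
Proof.
pose clip (x : R) := Num.max (-1) (Num.min x 1).
have clipI x : -1 <= clip x <= 1.
  by rewrite /clip le_max lexx ge_max ge_min lexx orbT/=; lra.
have -> : @acos R = fun x => if -1 <= x <= 1 then acos (clip x) else acos 2.
  apply/funext => x; case: ifPn => x1.
    by case/andP: x1 => x1 x2; rewrite /clip (min_idPl x2) (max_idPr x1).
  rewrite acos.unlock; congr (get _); apply/seteqP; split => y /= [_ yx].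
    by move: x1; rewrite -yx cos_geN1 cos_le1.
  by have := cos_le1 y; rewrite yx lern1.
apply: measurable_fun_ifT => //; first by meas.
apply: nonincreasing_measurable => // x y xy.
have cxy : clip x <= clip y by rewrite /clip le_max2// le_min2.
rewrite leNgt; apply/negP => lt_acos.
have acosI z : acos (clip z) \in `[0, pi].
  by rewrite in_itv/= acos_ge0 ?acos_lepi.
have := ltr_cos (acosI x) (acosI y); rewrite lt_acos !acosK ?in_itv//= => yx.
by move: cxy; rewrite leNgt yx.
Qed.

End acos.

Section events.
Context {R : realType}.
Local Notation V := (R * R)%type.
Implicit Types (E : set R) (z : (V * V) * (V * V)).

Definition in_disk4 z : bool :=
  [&& disk z.1.1, disk z.1.2, disk z.2.1 & disk z.2.2].

Definition meet4 z : bool := meetb z.1.1 z.1.2 z.2.1 z.2.2.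

Definition angle4 z : R := angle (z.1.2 - z.1.1) (z.2.2 - z.2.1).

Lemma measurable_in_disk4 : measurable_fun setT in_disk4.
Proof. by rewrite /in_disk4 /disk; meas. Qed.

Lemma measurable_meet4 : measurable_fun setT meet4.
Proof.
have mc (f g p q : (V * V) * (V * V) -> V) : measurable_fun setT f ->
    measurable_fun setT g -> measurable_fun setT p -> measurable_fun setT q ->
    measurable_fun setT (fun z => cross (g z - f z) (q z - p z)).
  by move=> *; rewrite /cross; meas.
have ms (f g p : (V * V) * (V * V) -> V) : measurable_fun setT f ->
    measurable_fun setT g -> measurable_fun setT p ->
    measurable_fun setT (fun z => on_segment (f z) (g z) (p z)).
  by move=> *; rewrite /on_segment /cross /dot2; meas.
have mA : measurable_fun setT (fun z : (V * V) * (V * V) => z.1.1) by meas.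
have mB : measurable_fun setT (fun z : (V * V) * (V * V) => z.1.2) by meas.
have mC : measurable_fun setT (fun z : (V * V) * (V * V) => z.2.1) by meas.
have mD : measurable_fun setT (fun z : (V * V) * (V * V) => z.2.2) by meas.
rewrite /meet4 /meetb; apply: measurable_fun_ifT.
- by apply: measurable_neg; apply: measurable_fun_eqr => //; exact: mc.
- by apply: measurable_and; apply: measurable_fun_ler => //;
    apply: measurable_funM; exact: mc.
- by repeat apply: measurable_or; exact: ms.
Qed.

Lemma measurable_angle4 : measurable_fun setT angle4.
Proof.
rewrite /angle4 /angle; apply: (measurableT_comp measurable_acos).
by rewrite /norm2 /dot2; meas.
Qed.

Definition meet_angle E z : \bar R :=
  ((ind R (in_disk4 z && meet4 z))%:E * (\1_E (angle4 z))%:E)%E.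

Lemma nnm_meet_angle E : measurable E -> nnm (meet_angle E).
Proof.
move=> mE; have m1 := measurable_in_disk4; have m2 := measurable_meet4.
apply: nnmM; apply: nnm_EFin.
- by meas.
- by move=> z; exact: ind_ge0.
- by apply: measurableT_comp; [exact: measurable_indic|exact: measurable_angle4].
- by move=> z; rewrite indicE.
Qed.

End events.

(** * The crossing density at a fixed angle *)

Section invariance.
Context {R : realType}.
Local Notation V := (R * R)%type.
Implicit Types (A B C D : V) (E : set R).

Definition reflect (z : V) : V := (z.1, - z.2).

Lemma prot_disk (c s : R) A : c ^+ 2 + s ^+ 2 = 1 -> disk (prot c s A) = disk A.
Proof.
move=> cs; rewrite /disk /prot/=; congr (_ <= _).
rewrite -[RHS]mulr1 -cs; ring.
Qed.

Lemma protB (c s : R) A B : prot c s A - prot c s B = prot c s (A - B).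
Proof. by apply: pair_ext; rewrite /prot/=; ring. Qed.

Lemma prot_cross (c s : R) A B : c ^+ 2 + s ^+ 2 = 1 ->
  cross (prot c s A) (prot c s B) = cross A B.
Proof.
move=> cs; rewrite /cross /prot/= -[RHS]mulr1 -cs; ring.
Qed.

Lemma prot_dot (c s : R) A B : c ^+ 2 + s ^+ 2 = 1 ->
  dot2 (prot c s A) (prot c s B) = dot2 A B.
Proof.
move=> cs; rewrite /dot2 /prot/= -[RHS]mulr1 -cs; ring.
Qed.

Lemma prot_norm (c s : R) A : c ^+ 2 + s ^+ 2 = 1 -> norm2 (prot c s A) = norm2 A.
Proof. by move=> cs; rewrite /norm2 prot_dot. Qed.

Lemma reflectB A B : reflect A - reflect B = reflect (A - B).
Proof. by apply: pair_ext; rewrite /reflect/=; ring. Qed.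

Lemma reflect_disk A : disk (reflect A) = disk A.
Proof. by rewrite /disk /reflect/= sqrrN. Qed.

Lemma reflect_cross A B : cross (reflect A) (reflect B) = - cross A B.
Proof. by rewrite /cross /reflect/=; ring. Qed.

Lemma reflect_dot A B : dot2 (reflect A) (reflect B) = dot2 A B.
Proof. by rewrite /dot2 /reflect/=; ring. Qed.

Lemma reflect_norm A : norm2 (reflect A) = norm2 A.
Proof. by rewrite /norm2 reflect_dot. Qed.

Lemma meet_angle_rot E (c s : R) A B C D : c ^+ 2 + s ^+ 2 = 1 ->
  meet_angle E ((prot c s A, prot c s B), (prot c s C, prot c s D)) =
  meet_angle E ((A, B), (C, D)).
Proof.
move=> cs; rewrite /meet_angle /in_disk4 /meet4 /angle4 /meetb /on_segment /angle/=.
by rewrite !protB !prot_cross// !prot_dot// !prot_norm// !prot_disk.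
Qed.

Lemma meet_angle_reflect E A B C D :
  meet_angle E ((reflect A, reflect B), (reflect C, reflect D)) =
  meet_angle E ((A, B), (C, D)).
Proof.
rewrite /meet_angle /in_disk4 /meet4 /angle4 /meetb /on_segment /angle/=.
by rewrite !reflectB !reflect_cross !reflect_dot !reflect_norm !reflect_disk
  !oppr_eq0 !mulrNN.
Qed.

End invariance.

Section slice.
Context {R : realType}.
Local Notation V := (R * R)%type.
Local Notation mu := (@leb R).
Local Notation mu2 := (@leb2 R).
Local Notation h := (@chord R).

Lemma angle_horizontal (r q t : R) : 0 < r -> 0 < q -> 0 < t < pi ->
  angle (r, 0) (q * cos t, q * sin t) = t.
Proof.
move=> r0 q0 /andP[t0 tpi]; rewrite /angle /norm2 /dot2/=.
have -> : r * r + 0 * 0 = r ^+ 2 by ring.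
have -> : q * cos t * (q * cos t) + q * sin t * (q * sin t) = q ^+ 2.
  by rewrite -[RHS]mulr1 -(cos2Dsin2 t); ring.
rewrite !sqrtr_sqr !gtr0_norm//.
have -> : (r * (q * cos t) + 0 * (q * sin t)) / (r * q) = cos t.
  by field; rewrite !gt_eqF.
by rewrite cosK// in_itv/= !ltW.
Qed.

Lemma meetb_oblique (a r p u b q c s : R) : 0 < r -> 0 < q -> 0 < s ->
  meetb (a, u) (a + r, u) (p - b * c, u - b * s)
    (p - b * c + q * c, u - b * s + q * s)
  = (0 <= p - a <= r) && (0 <= b <= q).
Proof.
move=> r0 q0 s0; rewrite /meetb ifT; last first.
  rewrite /cross/= (_ : _ - _ = r * q * s); last by ring.
  by rewrite !mulf_neq0// gt_eqF.
rewrite /cross/= andbC; congr (_ && _).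
  rewrite -mul_le0_itv//.
  rewrite (_ : _ * _ = (q * s) ^+ 2 * ((p - a) * (p - a - r))); last by ring.
  by rewrite pmulr_rle0// exprn_even_gt0//= mulf_neq0// gt_eqF.
rewrite -mul_le0_itv//.
rewrite (_ : _ * _ = (r * s) ^+ 2 * (b * (b - q))); last by ring.
by rewrite pmulr_rle0// exprn_even_gt0//= mulf_neq0// gt_eqF.
Qed.

(* [|X|^2] for the crossing point [X] of two lines at signed distances [u], [w]
   from the origin and angle [t]. *)
Definition dist_sqr (t u w : R) : R :=
  (u ^+ 2 + w ^+ 2 + 2 * u * w * cos t) / sin t ^+ 2.

Definition kern (t u w : R) : R :=
  ind R (dist_sqr t u w <= 1) * (h u * h w * (1 - dist_sqr t u w) ^+ 2).

Local Open Scope ereal_scope.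

Lemma nnm_integral2Zl d1 d2 (T1 : measurableType d1) (T2 : measurableType d2)
    (m1 : {measure set T1 -> \bar R}) (m2 : {sigma_finite_measure set T2 -> \bar R})
    (k : \bar R) (f : T1 -> T2 -> \bar R) : 0 <= k ->
  nnm (fun z : T1 * T2 => f z.1 z.2) ->
  \int[m1]_x \int[m2]_y (k * f x y) = k * \int[m1]_x \int[m2]_y f x y.
Proof.
move=> k0 nf; rewrite -nnm_integralZl//; last exact: nnm_integral.
apply: eq_integral => x _; apply: nnm_integralZl => //.
by apply: (nnm_comp nf (g := fun y => (x, y))); apply: measurable_fun_pair.
Qed.

Lemma nnm_kern t : nnm (fun z : R * R => (kern t z.1 z.2)%:E).
Proof. by rewrite /kern /dist_sqr /chord; nnmt. Qed.

Let f (z : V * V) : \bar R := (Num.max 0%R z.2.1)%:E *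
  (ind R [&& 0 <= z.1.2 - z.2.2 <= z.2.1, disk (z.2.2, z.1.1)
    & disk (z.2.2 + z.2.1, z.1.1)]%R)%:E.

Let g t (z : V * V) : \bar R := (Num.max 0%R z.2.1)%:E *
  (ind R [&& 0 <= z.2.2 <= z.2.1,
     disk (z.1.2 - z.2.2 * cos t, z.1.1 - z.2.2 * sin t)
   & disk (z.1.2 + (z.2.1 - z.2.2) * cos t, z.1.1 + (z.2.1 - z.2.2) * sin t)]%R)%:E.

Let nf : nnm f. Proof. by rewrite /f /disk; nnmt. Qed.

Let ng t : nnm (g t). Proof. by rewrite /g /disk; nnmt. Qed.

Let intf u p : \int[mu]_r \int[mu]_a f ((u, p), (r, a)) =
  (ind R (p ^+ 2 + u ^+ 2 <= 1)%R * (h u * (1 - (p ^+ 2 + u ^+ 2))))%:E.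
Proof.
have e : (1 ^+ 2 + 0 ^+ 2 = 1 :> R)%R by rewrite expr1n expr0n addr0.
have := @chord_moment R p u 1 0 e.
rewrite !mulr0 mulr1 sub0r chordN => <-.
apply: eq_integral => r _; rewrite /f/=.
etransitivity; first by apply: nnm_integralZl;
  [rewrite lee_fin le_max lexx|rewrite /disk; nnmt].
apply: (congr1 (mule _)); symmetry; rewrite -(@integral_flip _ p); last first.
  by rewrite /disk; nnmt.
apply: eq_integral => a _; congr (ind R _)%:E.
rewrite !mulr1 !mulr0 !addr0 !subr0.
have -> : (p - (p - a) = a)%R by ring.
by have -> : (p + (r - (p - a)) = a + r)%R by ring.
Qed.

Let intg t u p : \int[mu]_q \int[mu]_b g t ((u, p), (q, b)) =
  (ind R (p ^+ 2 + u ^+ 2 <= 1)%R *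
    (h (p * sin t - u * cos t) * (1 - (p ^+ 2 + u ^+ 2))))%:E.
Proof.
rewrite -(chord_moment p u (cos2Dsin2 t)).
apply: eq_integral => r _; rewrite /g/=.
by apply: nnm_integralZl; [rewrite lee_fin le_max lexx|rewrite /disk; nnmt].
Qed.

Let meet_angle_oblique (E : set R) t q r u a p b : (0 < t < pi)%R ->
  (sin t)%:E * ((Num.max 0%R q)%:E * ((Num.max 0%R r)%:E *
     meet_angle E (((a, u), (a + r, u)%R),
       ((p - b * cos t, u - b * sin t)%R,
        (p - b * cos t + q * cos t, u - b * sin t + q * sin t)%R)))) =
  ((\1_E t * sin t)%:E * f ((u, p), (r, a))) * g t ((u, p), (q, b)).
Proof.
move=> t0pi; have s0 : (0 < sin t)%R by apply: sin_gt0_pi.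
rewrite /f /g /meet_angle /=.
have [q0|q0] := leP q 0%R; first by rewrite !mul0e !mule0.
have [r0|r0] := leP r 0%R; first by rewrite !mul0e !mule0 !mul0e.
have -> : angle4 (((a, u), (a + r, u)%R),
       ((p - b * cos t, u - b * sin t)%R,
        (p - b * cos t + q * cos t, u - b * sin t + q * sin t)%R)) = t.
  rewrite /angle4/=; rewrite -[RHS](angle_horizontal r0 q0 t0pi).
  by congr angle; apply: pair_ext; rewrite /=; ring.
rewrite /meet4 /= meetb_oblique// /in_disk4/=.
have -> : (p + (q - b) * cos t = p - b * cos t + q * cos t)%R by ring.
have -> : (u + (q - b) * sin t = u - b * sin t + q * sin t)%R by ring.
rewrite !ind_and -!EFinM; congr (_%:E); ring.
Qed.

Let kern_oblique t u p : (0 < t < pi)%R ->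
  (ind R (p ^+ 2 + u ^+ 2 <= 1)%R * (h u * (1 - (p ^+ 2 + u ^+ 2))) *
  (ind R (p ^+ 2 + u ^+ 2 <= 1)%R *
    (h (p * sin t - u * cos t) * (1 - (p ^+ 2 + u ^+ 2)))) =
  kern t u (sin t * p - u * cos t))%R.
Proof.
move=> t0pi; have s0 : (0 < sin t)%R by apply: sin_gt0_pi.
rewrite /kern /dist_sqr (mulrC (sin t)).
have -> : (u ^+ 2 + (p * sin t - u * cos t) ^+ 2 +
    2 * u * (p * sin t - u * cos t) * cos t = (p ^+ 2 + u ^+ 2) * sin t ^+ 2)%R.
  by rewrite sin2cos2 sqrrB !exprMn sin2cos2; ring.
rewrite mulfK ?sqrf_eq0 ?gt_eqF//.
case: (_ <= 1)%R; rewrite ?indT ?indF; ring.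
Qed.

Lemma meet_slice (E : set R) (t : R) : measurable E -> (0 < t < pi)%R ->
  \int[mu]_q ((Num.max 0%R q)%:E * \int[mu]_r ((Num.max 0%R r)%:E *
     \int[mu2]_A \int[mu2]_C
       meet_angle E ((A, (A.1 + r, A.2)%R), (C, (C.1 + q * cos t, C.2 + q * sin t)%R))))
  = (\1_E t)%:E * \int[mu]_u \int[mu]_w (kern t u w)%:E.
Proof.
move=> mE t0pi; have s0 : (0 < sin t)%R by apply: sin_gt0_pi.
have s0' := ltW s0.
have nF := nnm_meet_angle mE.
have E0 : (0 <= \1_E t :> R)%R by rewrite indicE.
have k0 : 0 <= (\1_E t * sin t)%:E :> \bar R by rewrite lee_fin mulr_ge0.
pose f' z := (\1_E t * sin t)%:E * f z.
have nf' : nnm f' by apply: nnmM => //; apply: nnm_EFin => // z; rewrite -lee_fin.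
transitivity (\int[mu]_q \int[mu]_r \int[mu]_u \int[mu]_a \int[mu]_p \int[mu]_b
    (f' ((u, p), (r, a)) * g t ((u, p), (q, b)))).
  apply: eq_integral => q _.
  etransitivity; first by symmetry; apply: nnm_integralZl;
    [rewrite lee_fin le_max lexx|nnmt].
  apply: eq_integral => r _; rewrite /=.
  pose G (z : V * V) := (Num.max 0%R q)%:E * ((Num.max 0%R r)%:E *
    meet_angle E ((z.1, (z.1.1 + r, z.1.2)%R),
      (z.2, (z.2.1 + q * cos t, z.2.2 + q * sin t)%R))).
  have nG : nnm G by rewrite /G; nnmt.
  transitivity (\int[mu2]_A \int[mu2]_C G (A, C)).
    symmetry; rewrite /G.
    etransitivity; first by apply: nnm_integral2Zl;
      [rewrite lee_fin le_max lexx|nnmt].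
    apply: (congr1 (mule _)).
    by apply: nnm_integral2Zl; [rewrite lee_fin le_max lexx|nnmt].
  transitivity (\int[mu]_u \int[mu]_a \int[mu2]_C G ((a, u), C)).
    by apply: planarEr; nnmt.
  apply: eq_integral => u _; apply: eq_integral => a _.
  rewrite (@planar_oblique _ u (cos t) (sin t) (fun C => G ((a, u), C))); [|exact: s0|by nnmt].
  apply: eq_integral => p _; apply: eq_integral => b _.
  by rewrite /G /= meet_angle_oblique.
rewrite fubini_product//.
transitivity (\int[mu]_u \int[mu]_p ((\1_E t)%:E * ((sin t)%:E *
    (kern t u (sin t * p - u * cos t))%:E))).
  apply: eq_integral => u _; apply: eq_integral => p _.
  rewrite /f' nnm_integral2Zl//; last by nnmt.
  rewrite intf intg -!EFinM -kern_oblique//; congr (_%:E); ring.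
have nk := nnm_kern t.
rewrite nnm_integral2Zl; [|by rewrite lee_fin|by rewrite /kern /dist_sqr /chord; nnmt].
apply: (congr1 (mule _)); apply: eq_integral => u _.
etransitivity; first apply: (@integral_scale _ _ (fun x => (kern t u (x - u * cos t))%:E)) => //.
  by rewrite /kern /dist_sqr /chord; nnmt.
apply: (@integral_shift _ _ (fun x => (kern t u x)%:E)).
by rewrite /kern /dist_sqr /chord; nnmt.
Qed.

End slice.

Section gstar.
Context {R : realType}.
Local Notation V := (R * R)%type.
Local Notation mu := (@leb R).
Local Notation mu2 := (@leb2 R).
Local Notation h := (@chord R).

Lemma dist_sqr_ge0 (t u w : R) : 0 < sin t -> 0 <= dist_sqr t u w.
Proof.
move=> s0; rewrite /dist_sqr mulr_ge0 ?invr_ge0 ?sqr_ge0//.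
have -> : u ^+ 2 + w ^+ 2 + 2 * u * w * cos t =
    (w + u * cos t) ^+ 2 + (u * sin t) ^+ 2.
  rewrite [(u * _) ^+ 2]exprMn sin2cos2; ring.
by rewrite addr_ge0 ?sqr_ge0.
Qed.

Lemma chord_le1 (x : R) : h x <= 1.
Proof.
by rewrite -[leRHS]sqrtr1 ler_sqrt ?ler01// lerBlDr lerDl sqr_ge0.
Qed.

Lemma chord_out (x : R) : 1 <= x ^+ 2 -> h x = 0.
Proof. by move=> x1; rewrite /chord ler0_sqrtr// subr_le0. Qed.

Lemma kern_ge0 (t u w : R) : 0 <= kern t u w.
Proof. by rewrite /kern; nonneg; rewrite chord_ge0. Qed.

Lemma kern_le1 (t u w : R) : 0 < sin t -> kern t u w <= 1.
Proof.
move=> s0; have d0 := dist_sqr_ge0 u w s0; rewrite /kern.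
have [d1|d1] := leP (dist_sqr t u w) 1; last by rewrite indF mul0r.
rewrite indT mul1r; apply: mulr_ile1; rewrite ?sqr_ge0 ?mulr_ge0 ?chord_ge0//.
  by apply: mulr_ile1; rewrite ?chord_ge0 ?chord_le1.
by rewrite expr_le1//; lra.
Qed.

Lemma kernNN (t u w : R) : kern t (- u) (- w) = kern t u w.
Proof.
rewrite /kern /dist_sqr !chordN !sqrrN.
by have -> : 2 * - u * - w = 2 * u * w by ring.
Qed.

Lemma kern_out1 (t u w : R) : 1 <= u ^+ 2 -> kern t u w = 0.
Proof. by move=> u1; rewrite /kern (chord_out u1) !mul0r mulr0. Qed.

Lemma kern_out2 (t u w : R) : 1 <= w ^+ 2 -> kern t u w = 0.
Proof. by move=> w1; rewrite /kern (chord_out w1) mulr0 !mul0r mulr0. Qed.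

Lemma gstar_integrandE (e t u w : R) : 0 < t < pi -> e ^+ 2 = 1 ->
  0 <= u <= 1 -> 0 <= w <= 1 ->
  gstar_integrand e t u w = (4 / pi) ^+ 2 * kern t u (e * w).
Proof.
move=> t0pi e1 u01 w01; have s0 : 0 < sin t by apply: sin_gt0_pi.
rewrite /gstar_integrand /gstar1 u01 w01 indT mulr1 /kern.
have -> : u ^+ 2 + w ^+ 2 + 2 * e * u * w * cos t =
    u ^+ 2 + (e * w) ^+ 2 + 2 * u * (e * w) * cos t.
  by rewrite [(e * _) ^+ 2]exprMn e1; ring.
have -> : h (e * w) = h w by rewrite /chord exprMn e1 mul1r.
rewrite -/(dist_sqr t u (e * w)) -/(h u) -/(h w).
have -> : (`|u * cos t + e * w| <= h u * `|sin t|) = (dist_sqr t u (e * w) <= 1).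
  have u1 : u ^+ 2 <= 1 by rewrite expr_le1//; case/andP: u01.
  rewrite -[LHS]ler_sqr ?nnegrE ?mulr_ge0 ?normr_ge0 ?chord_ge0//.
  rewrite exprMn !real_normK ?num_real// chord_sqr//.
  rewrite /dist_sqr ler_pdivrMr ?exprn_gt0// mul1r.
  rewrite sin2cos2; apply/idP/idP => ?; nra.
by ring.
Qed.

Local Open Scope ereal_scope.

Lemma integral_fold_ge (f : R -> \bar R) : nnm f ->
  \int[mu]_x f x = \int[mu]_x ((ind R (0 <= x)%R)%:E * (f x + f (- x)%R)).
Proof.
move=> nf; rewrite integral_fold//.
pose g x := f x + f (- x)%R.
have ng : nnm g by rewrite /g; nnmt.
have [mg g0] := ng.
transitivity (\int[mu]_x ((ind R (0 < x)%R)%:E * g x) +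
              \int[mu]_x ((ind R (x == 0)%R)%:E * g x)).
  rewrite (integral_ind mu (fun x : R => x == 0)%R) (_ : [set x | _] = [set 0%R]); last first.
    by apply/seteqP; split => x /eqP.
  by rewrite (@lebE _ [set 0%R])//; [rewrite integral_set1 adde0|exact: measurable_funTS].
rewrite -nnm_integralD; [|by nnmt|by nnmt].
apply: eq_integral => x _; rewrite -/(g x).
by case: (ltgtP x 0%R) => _; rewrite ?indT ?indF ?mul0e ?mul1e ?adde0 ?add0e.
Qed.

Definition slice_mass (t : R) : \bar R := \int[mu]_u \int[mu]_w (kern t u w)%:E.

Lemma nnm_slice_mass : nnm slice_mass.
Proof. by rewrite /slice_mass /kern /dist_sqr /chord; nnmt. Qed.

Definition quarter_kern (e t u w : R) : R :=
  (ind R (0 <= w <= 1) * (ind R (0 <= u <= 1) * kern t u (e * w)))%R.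

Lemma slice_massE t : slice_mass t = 2%:E *
  (\int[mu]_u \int[mu]_w (quarter_kern (-1) t u w)%:E +
   \int[mu]_u \int[mu]_w (quarter_kern 1 t u w)%:E).
Proof.
have indE (x y : R) : ((1 <= x ^+ 2 -> y = 0) ->
    ind R (0 <= x) * y = ind R (0 <= x <= 1) * y)%R.
  move=> y0; have [x1|x1] := leP x 1%R; first by rewrite andbT.
  by rewrite andbF y0 ?mulr0// expr_ge1// ltW// (lt_trans _ x1).
pose F u : \bar R := \int[mu]_w (ind R (0 <= w)%R * (kern t u w + kern t u (- w)))%:E.
have nF : nnm F.
  rewrite /F; apply: nnm_integral; apply: nnm_EFin.
    by rewrite /kern /dist_sqr /chord; meas.
  by move=> z; rewrite mulr_ge0 ?ind_ge0// addr_ge0// kern_ge0.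
have nk u : nnm (fun w : R => (kern t u w)%:E).
  by rewrite /kern /dist_sqr /chord; nnmt.
have nq e : nnm (fun z : R * R => (quarter_kern e t z.1 z.2)%:E).
  by rewrite /quarter_kern /kern /dist_sqr /chord; nnmt.
have nq' e u : nnm (fun w : R => (quarter_kern e t u w)%:E).
  by rewrite /quarter_kern /kern /dist_sqr /chord; nnmt.
transitivity (\int[mu]_u F u).
  apply: eq_integral => u _; rewrite integral_fold_ge//.
have FN u : F (- u)%R = F u.
  rewrite /F; apply: eq_integral => w _; apply: (congr1 EFin); congr (_ * _)%R.
  by rewrite -kernNN opprK -[X in (_ + X)%R]kernNN !opprK addrC.
transitivity (\int[mu]_u (2%:E * ((ind R (0 <= u)%R)%:E * F u))).
  rewrite integral_fold_ge//; apply: eq_integral => u _.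
  by rewrite FN muleCA -[2%R]/(1 + 1)%R EFinD ge0_muleDl// mul1e.
rewrite nnm_integralZl//; last by nnmt.
apply: (congr1 (mule _)).
rewrite -nnm_integralD; [|exact: nnm_integral|exact: nnm_integral].
apply: eq_integral => u _; rewrite -nnm_integralD//.
rewrite /F -nnm_integralZl ?lee_fin ?ind_ge0//; last first.
  apply: nnm_EFin; first by rewrite /kern /dist_sqr /chord; meas.
  by move=> z; rewrite mulr_ge0 ?ind_ge0// addr_ge0// kern_ge0.
apply: eq_integral => w _; rewrite -EFinM -EFinD; congr (_%:E).
rewrite /quarter_kern mulN1r mul1r -mulrDr -mulrDr [in RHS]addrC.
rewrite mulrCA !indE//.
- by move=> u1; rewrite !kern_out1 ?addr0.
- move=> w1; rewrite !kern_out2 ?sqrrN// addr0 mulr0//.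
- by move=> u1; rewrite !kern_out1 ?addr0.
Qed.

Lemma integral_ind01 : \int[mu]_x (ind R (0 <= x <= 1)%R)%:E = 1.
Proof.
transitivity (\int[mu]_x ((ind R (0 <= x <= 1)%R)%:E * (1 + 0 * x)%:E)).
  by apply: eq_integral => x _; rewrite mul0r addr0 mule1.
rewrite integral_affine ?ler01//; first by congr (_%:E); ring.
by move=> x _; rewrite mul0r addr0.
Qed.

Lemma integral01_le1 (g : R -> \bar R) : nnm g -> (forall x, g x <= 1) ->
  \int[mu]_x ((ind R (0 <= x <= 1)%R)%:E * g x) <= 1.
Proof.
move=> ng g1.
have [mg g0] : nnm (fun x : R => (ind R (0 <= x <= 1)%R)%:E * g x) by nnmt.
rewrite -integral_ind01; apply: ge0_le_integral => //.
  by apply/measurable_EFinP; meas.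
move=> x _; rewrite -[leRHS]mule1; apply: lee_wpmul2l => //.
by rewrite lee_fin; exact: ind_ge0.
Qed.

Lemma Rintegral01 (f : R -> R) (g : R -> \bar R) : nnm g ->
  (forall x, (0 <= x <= 1)%R -> (f x)%:E = g x) ->
  (\int[lebesgue_measure]_(x in `[0%R, 1%R]) f x)%R =
  fine (\int[mu]_x ((ind R (0 <= x <= 1)%R)%:E * g x)).
Proof.
move=> [mg g0] fg; rewrite /Rintegral; congr fine.
rewrite (integral_ind mu (fun x : R => 0 <= x <= 1)%R).
rewrite (_ : [set x | _] = `[0%R, 1%R]%classic); last first.
  by apply/seteqP; split => x /=; rewrite in_itv.
rewrite lebE//; last exact: measurable_funTS.
by apply: eq_integral => x; rewrite inE/= in_itv/=; exact: fg.
Qed.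

Lemma gstar_sum (e t : R) : (0 < t < pi)%R -> (e ^+ 2 = 1)%R ->
  (\int[lebesgue_measure]_(w in `[0, 1]) \int[lebesgue_measure]_(u in `[0, 1])
     gstar_integrand e t u w)%R%:E =
  ((4 / pi) ^+ 2)%:E * \int[mu]_u \int[mu]_w (quarter_kern e t u w)%:E.
Proof.
move=> t0pi e1; have s0 : (0 < sin t)%R by apply: sin_gt0_pi.
pose c : R := ((4 / pi) ^+ 2)%R.
have c0 : (0 <= c)%R by exact: sqr_ge0.
have mk : measurable_fun setT (fun z : R * R => kern t z.1 (e * z.2))%R.
  by rewrite /kern /dist_sqr /chord; meas.
have nk : nnm (fun z : R * R => (kern t z.1 (e * z.2))%:E).
  by apply: nnm_EFin => // z; exact: kern_ge0.
pose J w := \int[mu]_u ((ind R (0 <= u <= 1)%R)%:E * (kern t u (e * w))%:E).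
have nJ : nnm J by rewrite /J; apply: nnm_integral; nnmt; apply: (nnm_comp nk (g := fun z : R * R => (z.2, z.1))); meas.
have nku w : nnm (fun u : R => (kern t u (e * w))%:E).
  by apply: (nnm_comp nk (g := fun u : R => (u, w))); meas.
have J1 w : J w <= 1.
  by apply: integral01_le1 => // u; rewrite lee_fin kern_le1.
have J0 w : 0 <= J w by case: nJ.
have Jfin w : J w \is a fin_num.
  by rewrite ge0_fin_numE// (le_lt_trans (J1 w))// ltry.
rewrite (@Rintegral01 _ (fun w => c%:E * J w)); first last.
- move=> w w01; rewrite (@Rintegral01 _ (fun u => c%:E * (kern t u (e * w))%:E)); first last.
  + by move=> u u01; rewrite gstar_integrandE.
  + by nnmt.
  have -> : \int[mu]_u ((ind R (0 <= u <= 1)%R)%:E * (c%:E * (kern t u (e * w))%:E)) =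
      c%:E * J w.
    rewrite /J -nnm_integralZl//; last by nnmt.
    by apply: eq_integral => u _; rewrite muleCA.
  by rewrite fineK// fin_numM.
- by nnmt.
have -> : \int[mu]_w ((ind R (0 <= w <= 1)%R)%:E * (c%:E * J w)) =
    c%:E * \int[mu]_w ((ind R (0 <= w <= 1)%R)%:E * J w).
  rewrite -nnm_integralZl; [|by rewrite lee_fin exprn_ge0// divr_ge0// pi_ge0|by nnmt].
  by apply: eq_integral => w _; rewrite muleCA.
rewrite fineK; last first.
  rewrite fin_numM// ge0_fin_numE; last by apply: nnm_integral_ge0; nnmt.
  by rewrite (le_lt_trans (integral01_le1 nJ J1))// ltry.
apply: (congr1 (mule _)).
have nq : nnm (fun z : R * R => (quarter_kern e t z.1 z.2)%:E).
  by rewrite /quarter_kern /kern /dist_sqr /chord; nnmt.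
rewrite [RHS]tonelli_swap//; apply: eq_integral => w _.
by rewrite /J -nnm_integralZl ?lee_fin ?ind_ge0//; nnmt.
Qed.

Lemma gstarE (t : R) : (0 < t < pi)%R ->
  (gstar t)%:E = (4 / pi ^+ 3)%:E * slice_mass t.
Proof.
move=> t0pi.
have e1 : ((-1) ^+ 2 = 1 :> R)%R by rewrite sqrrN expr1n.
have e2 : (1 ^+ 2 = 1 :> R)%R by rewrite expr1n.
pose I e : R := (\int[lebesgue_measure]_(w in `[0, 1])
  \int[lebesgue_measure]_(u in `[0, 1]) gstar_integrand e t u w)%R.
have IN1 := gstar_sum t0pi e1; rewrite -/(I _) in IN1.
have I1 := gstar_sum t0pi e2; rewrite -/(I _) in I1.
have -> : gstar t = ((2 * pi)^-1 * (I (-1) + I 1))%R.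
  rewrite /gstar t0pi -/I !big_cons big_nil.
  exact: (congr1 (fun x => (2 * pi)^-1 * (I (-1) + x))%R (addr0 _)).
clearbody I; rewrite EFinM EFinD IN1 I1.
have nq e : nnm (fun z : R * R => (quarter_kern e t z.1 z.2)%:E).
  by rewrite /quarter_kern /kern /dist_sqr /chord; nnmt.
have I0 e : 0 <= \int[mu]_u \int[mu]_w (quarter_kern e t u w)%:E.
  by apply: nnm_integral_ge0; exact: nnm_integral.
rewrite slice_massE -ge0_muleDr// !muleA -!EFinM; congr (_%:E * _).
by move: (@pi R) (lt0r_neq0 (pi_gt0 R)) => p p0; field.
Qed.

Lemma gstar_out (t : R) : ~~ (0 < t < pi)%R -> gstar t = 0%R.
Proof. by move=> /negbTE t0pi; rewrite /gstar t0pi. Qed.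

Lemma gstar_ge0 (t : R) : (0 <= gstar t)%R.
Proof.
have [t0pi|t0pi] := boolP (0 < t < pi)%R; last by rewrite gstar_out.
rewrite -lee_fin gstarE// mule_ge0 ?lee_fin ?divr_ge0 ?exprn_ge0 ?pi_ge0//.
by case: nnm_slice_mass.
Qed.

Lemma measurable_gstar : measurable_fun setT (@gstar R).
Proof.
have := nnm_slice_mass => ns.
have nG : nnm (fun t : R => (ind R (0 < t < pi)%R)%:E * ((4 / pi ^+ 3)%:E * slice_mass t)).
  by nnmt; rewrite invr_ge0 exprn_ge0// pi_ge0.
apply/measurable_EFinP.
rewrite (_ : EFin \o _ = fun t => (ind R (0 < t < pi)%R)%:E * ((4 / pi ^+ 3)%:E * slice_mass t)).
  by case: nG.
apply/funext => t /=; have [t0pi|t0pi] := boolP (0 < t < pi)%R.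
  by rewrite indT mul1e gstarE.
by rewrite indF mul0e gstar_out.
Qed.

Lemma integral_meet_angle (E : set R) : measurable E ->
  \int[mu2]_A \int[mu2]_B \int[mu2]_C \int[mu2]_D meet_angle E ((A, B), (C, D)) =
  (pi ^+ 4)%:E * \int[mu]_t ((\1_E t)%:E * (gstar t)%:E).
Proof.
move=> mE; have nF := nnm_meet_angle mE.
rewrite four_points_polar//; last 2 first.
- by move=> *; exact: meet_angle_rot.
- by move=> *; exact: meet_angle_reflect.
have nE : nnm (fun t : R => (\1_E t)%:E : \bar R).
  by apply: nnm_EFin; [exact: measurable_indic|move=> t; rewrite indicE].
have ng : nnm (fun t : R => (gstar t)%:E).
  by apply: nnm_EFin; [exact: measurable_gstar|exact: gstar_ge0].
have pi0 := pi_ge0 R.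
have p4 : (0 <= pi ^+ 4 :> R)%R by rewrite exprn_ge0.
have p1 : (0 <= 4 * pi :> R)%R by rewrite mulr_ge0.
transitivity (\int[mu]_t ((4 * pi)%:E * ((ind R (0 < t < pi)%R)%:E *
    ((\1_E t)%:E * slice_mass t)))).
  symmetry; etransitivity; first apply: nnm_integralZl => //.
    by have ns := nnm_slice_mass; nnmt.
  apply: (congr1 (mule _)); apply: eq_integral => t _.
  have [t0pi|t0pi] := boolP (0 < t < pi)%R; last by rewrite indF !mul0e.
  by rewrite meet_slice.
symmetry; etransitivity; first by symmetry; apply: nnm_integralZl => //; exact: nnmM.
apply: eq_integral => t _.
have [t0pi|t0pi] := boolP (0 < t < pi)%R; last by rewrite indF gstar_out// !mul0e !mule0.
rewrite indT mul1e gstarE// [RHS]muleCA [LHS]muleCA; congr (_ * _).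
rewrite muleA -EFinM; congr (_%:E * _).
by clear; move: (@pi R) (lt0r_neq0 (pi_gt0 R)) => p p0; field.
Qed.

End gstar.

(** * Laws of independent points *)

Section rectangles.
Context d1 d2 (T1 : measurableType d1) (T2 : measurableType d2) (R : realType).
Variable m' : {measure set (T1 * T2) -> \bar R}.
Local Open Scope ereal_scope.

Lemma measure_rect_unique (m : {measure set (T1 * T2) -> \bar R}) : m setT < +oo ->
  (forall A B, measurable A -> measurable B -> m (A `*` B) = m' (A `*` B)) ->
  forall X, measurable X -> m X = m' X.
Proof.
move=> moo mm' X mX.
pose C : set (set (T1 * T2)) :=
  [set C | exists A, measurable A /\ exists B, measurable B /\ C = A `*` B].
apply: (measure_unique C (fun=> setT)) => //.
- rewrite measurable_prod_measurableType //; congr (<<s _ >>).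
  rewrite predeqE; split => [[A mA [B mB <-]]|[A [mA [B [mB ->]]]]].
    by exists A; split => //; exists B.
  by exists A => //; exists B.
- move=> /= _ _ [X1 [mX1 [X2 [mX2 ->]]]] [Y1 [mY1 [Y2 [mY2 ->]]]].
  rewrite -setXI; exists (X1 `&` Y1); split; first exact: measurableI.
  by exists (X2 `&` Y2); split => //; exact: measurableI.
- by move=> n; exists setT; split => //; exists setT; split => //; rewrite setXTT.
- by rewrite bigcup_const.
- by move=> A [A1 [mA1 [A2 [mA2 ->]]]]; exact: mm'.
Qed.

Lemma pushforward_rect_unique d (T : measurableType d)
    (mu : {measure set T -> \bar R}) (f : T -> T1 * T2) :
  measurable_fun setT f -> mu setT < +oo ->
  (forall A B, measurable A -> measurable B ->
    mu (f @^-1` (A `*` B)) = m' (A `*` B)) ->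
  forall X, measurable X -> mu (f @^-1` X) = m' X.
Proof.
move=> mf muoo mum' X mX.
exact: (@measure_rect_unique (pushforward mu f)).
Qed.

End rectangles.

Section joint_law.
Context d (T : measurableType d) d1 (S : measurableType d1) (R : realType).
Variables (P : probability T R) (A B C D : {mfun T >-> S}).
Local Open Scope ereal_scope.

Definition independent4 := forall E1 E2 E3 E4 : set S,
  measurable E1 -> measurable E2 -> measurable E3 -> measurable E4 ->
  P (A @^-1` E1 `&` B @^-1` E2 `&` (C @^-1` E3 `&` D @^-1` E4)) =
  P (A @^-1` E1) * P (B @^-1` E2) * (P (C @^-1` E3) * P (D @^-1` E4)).

Hypothesis indep : independent4.

Let mAB : measurable_fun setT (fun w => (A w, B w)).
Proof. exact: measurable_fun_pair. Qed.

Let mCD : measurable_fun setT (fun w => (C w, D w)).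
Proof. exact: measurable_fun_pair. Qed.

Let PA := distribution P A.
Let PB := distribution P B.
Let PC := distribution P C.
Let PD := distribution P D.

Let mpre (X : {mfun T >-> S}) E : measurable E -> measurable (X @^-1` E).
Proof. by move=> mE; exact: measurable_funPTI. Qed.

Let mpre2 d2 (S' : measurableType d2) (f : T -> S') E :
  measurable_fun setT f -> measurable E -> measurable (f @^-1` E).
Proof. by move=> mf mE; rewrite -[X in measurable X]setTI; exact: mf. Qed.

Let law_AB X E3 E4 : measurable X -> measurable E3 -> measurable E4 ->
  P ((fun w => (A w, B w)) @^-1` X `&` (C @^-1` E3 `&` D @^-1` E4)) =
  (PA \x PB) X * (PC E3 * PD E4).
Proof.
move=> mX m3 m4; have mF : measurable (C @^-1` E3 `&` D @^-1` E4).
  by apply: measurableI; exact: mpre.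
have k0 : (0 <= fine (PC E3 * PD E4))%R by rewrite fine_ge0// mule_ge0.
have kE : (fine (PC E3 * PD E4))%:E = PC E3 * PD E4.
  by rewrite fineK// fin_numM// fin_num_measure.
pose m' := mscale (NngNum k0) (PA \x PB)%E.
have m'E Z : m' Z = PC E3 * PD E4 * (PA \x PB) Z by rewrite -kE.
transitivity (mrestr P mF ((fun w => (A w, B w)) @^-1` X)); first by [].
rewrite (@pushforward_rect_unique _ _ _ _ _ m' _ _ (mrestr P mF))//.
- exact: (etrans (m'E X) (muleC _ _)).
- rewrite -[X in X < _]/(P (setT `&` _)).
  by rewrite (le_lt_trans (probability_le1 P _)) ?ltry//; exact: measurableI.
- move=> E1 E2 m1 m2.
  transitivity (P (A @^-1` E1 `&` B @^-1` E2 `&` (C @^-1` E3 `&` D @^-1` E4))).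
    by [].
  rewrite indep//; symmetry; apply: (etrans (m'E _)).
  by rewrite product_measure1E// muleC.
Qed.

Let PAB : probability (S * S)%type R := (PA \x PB)%E.
Let PCD : probability (S * S)%type R := (PC \x PD)%E.

Let law_CD X Y : measurable X -> measurable Y ->
  P ((fun w => (A w, B w)) @^-1` X `&` (fun w => (C w, D w)) @^-1` Y) =
  PAB X * PCD Y.
Proof.
move=> mX mY; have mF : measurable ((fun w => (A w, B w)) @^-1` X) by exact: mpre2.
have fAB : PAB X \is a fin_num by exact: fin_num_measure.
have k0 : (0 <= fine (PAB X))%R by rewrite fine_ge0.
have kE : (fine (PAB X))%:E = PAB X by rewrite fineK.
pose m' := mscale (NngNum k0) PCD.
have m'E Z : m' Z = PAB X * PCD Z by rewrite -kE.
rewrite setIC.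
transitivity (mrestr P mF ((fun w => (C w, D w)) @^-1` Y)); first by [].
rewrite (@pushforward_rect_unique _ _ _ _ _ m' _ _ (mrestr P mF))//.
- rewrite -[X in X < _]/(P (setT `&` _)).
  by rewrite (le_lt_trans (probability_le1 P _)) ?ltry//; exact: measurableI.
- move=> E3 E4 m3 m4.
  transitivity (P ((fun w => (A w, B w)) @^-1` X `&` (C @^-1` E3 `&` D @^-1` E4))).
    by rewrite setIC.
  rewrite law_AB//; symmetry; apply: (etrans (m'E _)).
  by congr (_ * _); exact: product_measure1E.
Qed.

Lemma joint_law X : measurable X ->
  P ((fun w => ((A w, B w), (C w, D w))) @^-1` X) = (PAB \x PCD) X.
Proof.
move=> mX; have mW : measurable_fun setT (fun w => ((A w, B w), (C w, D w))).
  exact: measurable_fun_pair.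
apply: (@pushforward_rect_unique _ _ _ _ _ (PAB \x PCD) _ _ P) => //.
  by rewrite (le_lt_trans (probability_le1 P _)) ?ltry.
move=> E F mE mF; rewrite [RHS]product_measure1E//.
exact: law_CD.
Qed.

Lemma integral_joint_law X : measurable X ->
  P ((fun w => ((A w, B w), (C w, D w))) @^-1` X) =
  \int[PA]_a \int[PB]_b \int[PC]_c \int[PD]_e (\1_X ((a, b), (c, e)))%:E.
Proof.
move=> mX; rewrite joint_law//.
have n1 : nnm (fun z : (S * S) * (S * S) => (\1_X z)%:E : \bar R).
  by apply: nnm_EFin; [exact: measurable_indic|move=> z; rewrite indicE].
transitivity (\int[(PAB \x PCD)]_z (\1_X z)%:E).
  rewrite [RHS]integral_indic; [|exact: measurableT|exact: mX].
  by apply: (congr1 (PAB \x PCD)%E); rewrite setIT.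
rewrite (tonelli_prod PAB PCD n1).
pose F z := \int[PCD]_w (\1_X (z, w))%:E : \bar R.
have nF : nnm F.
  apply: nnm_integral => /=.
  by apply: (nnm_comp n1 (g := fun z => (z.1, z.2))); meas.
transitivity (\int[PAB]_z F z); first by [].
rewrite (tonelli_prod PA PB nF).
apply: eq_integral => a _; apply: eq_integral => b _.
have n2 : nnm (fun w : S * S => (\1_X ((a, b), w))%:E : \bar R).
  by apply: (nnm_comp n1 (g := fun w => ((a, b), w))); meas.
exact: (tonelli_prod PC PD n2).
Qed.

End joint_law.

Section uniform.
Context {R : realType}.
Local Notation V := (R * R)%type.
Local Notation mu2 := (@leb2 R).
Local Open Scope ereal_scope.

Definition disk_density (z : V) : R := (pi^-1 * ind R (disk z))%R.

Lemma nnm_disk_density : nnm (EFin \o disk_density).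
Proof.
apply: nnm_EFin; first by rewrite /disk_density /disk; meas.
by move=> z; rewrite mulr_ge0 ?ind_ge0// invr_ge0 pi_ge0.
Qed.

Lemma leb2E (X : set V) : measurable X ->
  leb2 X = (lebesgue_measure \x lebesgue_measure)%E X.
Proof.
move=> mX; rewrite leb2.unlock.
transitivity (\int[leb]_x leb (xsection X x)); first by [].
rewrite lebE//.
  by rewrite leb.unlock.
exact: measurable_fun_xsection.
Qed.

Lemma unit_diskE : @unit_disk R = [set z | disk z].
Proof.
apply/seteqP; split => z; rewrite /unit_disk /= /norm2 /disk /dot2 -!expr2 => z1.
  have z0 : (0 <= z.1 ^+ 2 + z.2 ^+ 2)%R by rewrite addr_ge0 ?sqr_ge0.
  by rewrite -(sqr_sqrtr z0) expr_le1// sqrtr_ge0.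
by rewrite -[leRHS]sqrtr1 ler_sqrt.
Qed.

Lemma measurable_disk : measurable [set z : V | disk z].
Proof.
rewrite (_ : [set z | _] = @disk R @^-1` [set true])//.
rewrite -[X in measurable X]setTI.
have md : measurable_fun setT (@disk R) by rewrite /disk; meas.
exact: md.
Qed.

Context d (T : measurableType d) (P : probability T R).

Lemma uniform_density (X : {RV P >-> V}) : uniform_in_disk X ->
  forall E, measurable E ->
  distribution P X E = \int[mu2]_(z in E) (disk_density z)%:E.
Proof.
move=> uX E mE; rewrite uX// unit_diskE.
have mED : measurable (E `&` [set z : V | disk z]).
  by apply: measurableI => //; exact: measurable_disk.
have p0 : (0 <= pi^-1 :> R)%R by rewrite invr_ge0 pi_ge0.
transitivity ((pi^-1)%:E * mu2 (E `&` [set z : V | disk z])).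
  rewrite leb2E//.
  exact: (@integral_cst _ (measurableTypeR R * measurableTypeR R)%type R
    (lebesgue_measure \x lebesgue_measure)%E).
transitivity (\int[mu2]_(z in E `&` [set z : V | disk z]) (pi^-1)%:E).
  by rewrite integral_cst.
rewrite integral_mkcondr; apply: eq_integral => z _.
rewrite patchE /disk_density; have [dz|dz] := boolP (disk z).
  by rewrite mem_set// indT mulr1.
by rewrite memNset ?indF ?mulr0//; exact/negP.
Qed.

Lemma integral_uniform (X : {RV P >-> V}) (f : V -> \bar R) :
  uniform_in_disk X -> nnm f ->
  \int[distribution P X]_z f z = \int[mu2]_z (f z * (disk_density z)%:E).
Proof.
move=> uX nf; apply: integral_density => //; last exact: nnm_disk_density.
exact: uniform_density.
Qed.

End uniform.

Section iid.
Context {R : realType}.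
Local Notation V := (R * R)%type.
Local Notation mu2 := (@leb2 R).
Local Open Scope ereal_scope.
Context d (T : measurableType d) (P : probability T R).
Variables A B C D : {RV P >-> V}.
Hypotheses (uA : uniform_in_disk A) (uB : uniform_in_disk B).
Hypotheses (uC : uniform_in_disk C) (uD : uniform_in_disk D).
Hypothesis indep : independent4 P A B C D.

Lemma integral2_uniform (X Y : {RV P >-> V}) (F : V * V -> \bar R) :
  uniform_in_disk X -> uniform_in_disk Y -> nnm F ->
  \int[distribution P X]_a \int[distribution P Y]_b F (a, b) =
  (pi ^- 2)%:E * \int[mu2]_a \int[mu2]_b
    ((ind R (disk a && disk b))%:E * F (a, b)).
Proof.
move=> uX uY nF.
have nw := @nnm_disk_density R.
have w0 z : 0 <= (disk_density z)%:E :> \bar R by move: nw => [_]; exact.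
have nw' : nnm (fun z : V => (disk_density z)%:E) := nw.
have md : measurable_fun setT (@disk R) by rewrite /disk; meas.
have nFa a : nnm (fun b => F (a, b)) by nnmt.
have ninner : nnm (fun a => \int[mu2]_b (F (a, b) * (disk_density b)%:E)).
  apply: nnm_integral; apply: nnmM => /=; first by nnmt.
  by apply: (nnm_comp nw'); meas.
have p2 : (0 <= pi ^- 2 :> R)%R by rewrite invr_ge0 sqr_ge0.
have nr : nnm (fun z : V * V => (ind R (disk z.1 && disk z.2))%:E * F (z.1, z.2)).
  by nnmt.
transitivity (\int[distribution P X]_a
    \int[mu2]_b (F (a, b) * (disk_density b)%:E)).
  by apply: eq_integral => a _; exact: integral_uniform.
rewrite integral_uniform//.
rewrite -(nnm_integral2Zl _ _ _ nr)//=; apply: eq_integral => a _.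
rewrite -nnm_integralZr//; last by apply: nnmM; [exact: nFa|exact: nw'].
apply: eq_integral => b _.
rewrite [RHS]muleA -EFinM -muleA -EFinM [LHS]muleC; congr (_%:E * _).
by rewrite /disk_density ind_and -exprVn expr2; ring.
Qed.

Lemma iid_uniform_prob (X : set ((V * V) * (V * V))) : measurable X ->
  P ((fun w => ((A w, B w), (C w, D w))) @^-1` X) =
  (pi ^- 4)%:E * \int[mu2]_a \int[mu2]_b \int[mu2]_c \int[mu2]_e
    ((ind R (in_disk4 ((a, b), (c, e))))%:E * (\1_X ((a, b), (c, e)))%:E).
Proof.
move=> mX; rewrite integral_joint_law//.
pose F (z : (V * V) * (V * V)) : \bar R := (\1_X z)%:E.
have nF : nnm F.
  by apply: nnm_EFin; [exact: measurable_indic|move=> z; rewrite indicE].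
have FE a b c e : (\1_X ((a, b), (c, e)))%:E = F ((a, b), (c, e)) by [].
clearbody F.
transitivity (\int[distribution P A]_a \int[distribution P B]_b
    \int[distribution P C]_c \int[distribution P D]_e F ((a, b), (c, e))).
  by do 4! (apply: eq_integral => ? _).
transitivity ((pi ^- 4)%:E * \int[mu2]_a \int[mu2]_b \int[mu2]_c \int[mu2]_e
    ((ind R (in_disk4 ((a, b), (c, e))))%:E * F ((a, b), (c, e)))); last first.
  by apply: (congr1 (mule _)); do 4! (apply: eq_integral => ? _); rewrite FE.
clear FE; have md : measurable_fun setT (@disk R) by rewrite /disk; meas.
have p2 : (0 <= pi ^- 2 :> R)%R by rewrite invr_ge0 sqr_ge0.
pose G (z : V * V) := (pi ^- 2)%:E * \int[mu2]_c \int[mu2]_e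
    ((ind R (disk c && disk e))%:E * F (z, (c, e))).
have nG : nnm G by rewrite /G; nnmt.
transitivity (\int[distribution P A]_a \int[distribution P B]_b G (a, b)).
  apply: eq_integral => a _; apply: eq_integral => b _.
  by apply: (integral2_uniform (F := fun z => F ((a, b), z)) uC uD); nnmt.
rewrite (integral2_uniform uA uB nG).
rewrite (_ : pi ^- 4 = pi ^- 2 * pi ^- 2)%R; last first.
  by rewrite -!exprVn -exprD.
rewrite EFinM -muleA; apply: (congr1 (mule _)).
symmetry; etransitivity; first by symmetry; apply: nnm_integral2Zl => //;
  apply: nnm_integral; apply: nnm_integral; rewrite /in_disk4; nnmt.
apply: eq_integral => a _; apply: eq_integral => b _.
rewrite /G muleCA; apply: (congr1 (mule _)).
symmetry; etransitivity; first by symmetry; apply: nnm_integral2Zl;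
  [rewrite lee_fin ind_ge0|nnmt].
apply: eq_integral => c _; apply: eq_integral => e _.
rewrite muleA -EFinM -ind_and /in_disk4/=.
by rewrite !andbA.
Qed.

Lemma prob_meet_angle (E : set R) : measurable E ->
  P ([set w | meet4 ((A w, B w), (C w, D w))] `&`
     [set w | E (angle4 ((A w, B w), (C w, D w)))]) =
  \int[leb]_t ((\1_E t)%:E * (gstar t)%:E).
Proof.
move=> mE.
pose X : set ((V * V) * (V * V)) := [set z | meet4 z] `&` (angle4 @^-1` E).
have mX : measurable X.
  apply: measurableI.
    rewrite (_ : [set z | _] = @meet4 R @^-1` [set true])//.
    by rewrite -[X in measurable X]setTI; exact: measurable_meet4.
  by rewrite -[X in measurable X]setTI; exact: measurable_angle4.
rewrite [LHS](_ : _ = P ((fun w => ((A w, B w), (C w, D w))) @^-1` X)) //.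
rewrite iid_uniform_prob//.
transitivity ((pi ^- 4)%:E * \int[mu2]_a \int[mu2]_b \int[mu2]_c \int[mu2]_e
    meet_angle E ((a, b), (c, e))).
  apply: (congr1 (mule _)); do 4! (apply: eq_integral => ? _).
  rewrite /meet_angle ind_and EFinM -muleA; congr (_ * _); rewrite -EFinM.
  congr (_%:E); rewrite !indicE /X in_setI -mulnb natrM; congr (_%:R * _)%R.
  by congr nat_of_bool; apply/idP/idP => [/set_mem|h]; [|exact: mem_set].
rewrite integral_meet_angle// muleA -EFinM mulVf ?mul1e//.
by rewrite expf_neq0// lt0r_neq0// pi_gt0.
Qed.

End iid.

(** * The separation probability *)

Section primitives.
Context {R : realType}.
Implicit Type x : R.

Definition primc2 x := x + sin x * cos x.
Definition primc4 x := 3 / 8 * primc2 x + 1 / 4 * (sin x * cos x ^+ 3).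
Definition primc6 x := 5 / 6 * primc4 x + 1 / 6 * (sin x * cos x ^+ 5).
Definition primc8 x := 7 / 8 * primc6 x + 1 / 8 * (sin x * cos x ^+ 7).
Definition primJ x :=
  (pi ^+ 2 / 4 - x ^+ 2) * primc4 x + x ^+ 3 / 4
  + 3 / 4 * (x * sin x ^+ 2 / 2 - (x - sin x * cos x) / 4)
  + 1 / 2 * (primc4 x / 4 - x * cos x ^+ 4 / 4)
  + x * cos x ^+ 6 / 3 - 4 / 3 * primc6 x + primc8 x.

Lemma is_derive_primc2 x : is_derive x 1 primc2 (2 * cos x ^+ 2).
Proof.
apply: is_derive_eq; rewrite /GRing.scale/=.
have H := sin2cos2 x; ring: H.
Qed.

Lemma is_derive_primc4 x : is_derive x 1 primc4 (cos x ^+ 4).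
Proof.
have d2 := is_derive_primc2 x.
apply: is_derive_eq; rewrite /GRing.scale/=.
have H := sin2cos2 x; by field: H.
Qed.

Lemma is_derive_primc6 x : is_derive x 1 primc6 (cos x ^+ 6).
Proof.
have d2 := is_derive_primc4 x.
apply: is_derive_eq; rewrite /GRing.scale/=.
have H := sin2cos2 x; by field: H.
Qed.

Lemma is_derive_primc8 x : is_derive x 1 primc8 (cos x ^+ 8).
Proof.
have d2 := is_derive_primc6 x.
apply: is_derive_eq; rewrite /GRing.scale/=.
have H := sin2cos2 x; by field: H.
Qed.

Lemma is_derive_primJ x : is_derive x 1 primJ
  (cos x ^+ 4 * (pi ^+ 2 / 4 - primc2 x ^+ 2)).
Proof.
have d4 := is_derive_primc4 x.
have d6 := is_derive_primc6 x.
have d8 := is_derive_primc8 x.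
apply: is_derive_eq; rewrite /GRing.scale/= /primc4 /primc2.
move: (@pi R) => p.
have H := sin2cos2 x; by field: H.
Qed.

Local Notation mu := (@leb R).
Local Notation h := (@chord R).

Lemma primc2N x : primc2 (- x) = - primc2 x.
Proof. by rewrite /primc2 sinN cosN; ring. Qed.

Lemma primc2_pihalf : primc2 (pi / 2) = pi / 2.
Proof. by rewrite /primc2 sin_pihalf cos_pihalf; ring. Qed.

Lemma primJ_pihalf : primJ (pi / 2) = pi ^+ 3 / 32 + 35 * pi / 768.
Proof.
rewrite /primJ /primc8 /primc6 /primc4 /primc2 sin_pihalf cos_pihalf.
by move: (@pi R) => p; field.
Qed.

Lemma primJN x : primJ (- x) = - primJ x.
Proof.
rewrite /primJ /primc8 /primc6 /primc4 /primc2 sinN cosN.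
by move: (@pi R) => p; field.
Qed.

Lemma pihalf_ge0 : 0 <= pi / 2 :> R.
Proof. by rewrite divr_ge0 ?pi_ge0. Qed.

Lemma chord_sin x : - (pi / 2) <= x <= pi / 2 -> h (sin x) = cos x.
Proof. by move=> xpi; rewrite /chord -cos2sin2 sqrtr_sqr ger0_norm// cos_ge0_pihalf. Qed.

Lemma continuous_chord : continuous h.
Proof.
move=> x; apply: (@continuous_comp _ _ _ (fun x => 1 - x ^+ 2) Num.sqrt).
  by apply: continuousB; [exact: cst_continuous|exact: exprn_continuous].
exact: sqrt_continuous.
Qed.

Lemma sin_le x y : - (pi / 2) <= x <= pi / 2 -> - (pi / 2) <= y <= pi / 2 ->
  x <= y -> sin x <= sin y.
Proof.
move=> xp yp; rewrite !le_eqVlt => /predU1P[->|xy]; first by rewrite eqxx.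
by apply/orP; right; rewrite ltr_sin ?in_itv.
Qed.

Local Open Scope ereal_scope.

Lemma integral_subst_sin (G : R -> R) (b : R) : (- (pi / 2) <= b <= pi / 2)%R ->
  {within `[(-1)%R, sin b], continuous G} ->
  (forall y, (-1 <= y <= sin b)%R -> (0 <= G y)%R) ->
  \int[mu]_(y in `[(-1)%R, sin b]) (G y)%:E =
  \int[mu]_t ((ind R (- (pi / 2) <= t <= b)%R)%:E * (G (sin t) * cos t)%:E).
Proof.
move=> /andP[ab bpi] cG G0.
have sa : sin (- (pi / 2)) = (-1)%R :> R by rewrite sinN sin_pihalf.
have mG : measurable_fun `[(-1)%R, sin b]%classic G.
  exact: subspace_continuous_measurable_fun.
rewrite lebE//; last exact/measurable_EFinP.
have d1 : (sin^`() = cos :> (R -> R))%classic.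
  by apply/funext => x; rewrite derive1E derive_val.
rewrite -sa (@integration_by_substitution_increasing R sin G)//.
- rewrite d1 (integral_ind mu (fun t : R => - (pi / 2) <= t <= b)%R).
  rewrite (_ : [set t | _] = `[(- (pi / 2))%R, b]%classic); last first.
    by apply/seteqP; split => t /=; rewrite in_itv.
  have sI t : (- (pi / 2) <= t <= b)%R -> (-1 <= sin t <= sin b)%R.
    move=> /andP[t1 t2]; rewrite sin_geN1 sin_le ?(le_trans t2) ?t1//.
    by rewrite ab.
  rewrite lebE//.
    apply/measurable_EFinP; apply: measurable_funM; last first.
      by apply: measurable_funTS; exact: measurable_cos.
    apply: (measurable_comp (measurable_itv `[(-1)%R, sin b]) _ mG).
      by move=> _ [t /= + <-]; rewrite !in_itv/=; exact: sI.
    by apply: measurable_funTS; exact: measurable_sin.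
  move=> t /=; rewrite in_itv/= => tI; rewrite lee_fin mulr_ge0 ?G0 ?sI//.
  by apply: cos_ge0_pihalf; move/andP: tI => [-> /le_trans ->].
- move=> x y; rewrite !in_itv/= => /andP[x1 x2] /andP[y1 y2] xy.
  by rewrite ltr_sin// in_itv/= ?x1 ?y1 (le_trans _ bpi).
- by rewrite d1 => x _; exact: continuous_cos.
- by rewrite d1; apply/cvg_ex; exists (cos (- (pi / 2))); apply: cvg_at_right_filter; exact: continuous_cos.
- by rewrite d1; apply/cvg_ex; exists (cos b); apply: cvg_at_left_filter; exact: continuous_cos.
- split.
  + by move=> x _; exact: derivable_sin.
  + by apply: cvg_at_right_filter; exact: continuous_sin.
  + by apply: cvg_at_left_filter; exact: continuous_sin.
- by rewrite sa.
Qed.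

End primitives.

Section caps.
Context {R : realType}.
Local Notation V := (R * R)%type.
Local Notation mu := (@leb R).
Local Notation mu2 := (@leb2 R).
Local Notation h := (@chord R).
Implicit Type x : R.
Local Open Scope ereal_scope.

Definition cap (u : R) : \bar R := \int[mu]_y ((ind R (y < u)%R)%:E * (2 * h y)%:E).

Lemma nnm_cap : nnm cap.
Proof. by rewrite /cap /chord; nnmt. Qed.

Lemma cap_sin x : (- (pi / 2) <= x <= pi / 2)%R ->
  cap (sin x) = (pi / 2 + primc2 x)%:E.
Proof.
move=> xpi; have ch : continuous (fun y => 2 * h y)%R.
  move=> y; apply: (@continuousM _ _ (fun=> 2%R) h y).
    exact: cst_continuous.
  exact: continuous_chord.
have h0 y : (0 <= 2 * h y)%R by rewrite mulr_ge0// chord_ge0.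
have h0' y : 0 <= (2 * h y)%:E by rewrite lee_fin.
have mh : measurable_fun setT (fun y : R => (2 * h y)%:E).
  by apply/measurable_EFinP; exact: continuous_measurable_fun.
transitivity (\int[mu]_(y in `[(-1)%R, sin x]) (2 * h y)%:E).
  rewrite [RHS]lebE//; last exact: measurable_funTS.
  rewrite -integral_itv_bndo_bndc; last exact: measurable_funTS.
  rewrite -lebE//; last exact: measurable_funTS.
  rewrite -integral_indicE; apply: eq_integral => y _; rewrite in_itv/=.
  have [y1|y1] := leP (-1)%R y; first by [].
  rewrite (chord_out (x := y)); first by rewrite mulr0 !mule0.
  by rewrite -sqrrN expr_ge1//; lra.
rewrite integral_subst_sin//; last first.
  by apply: continuous_subspaceT.
transitivity (\int[mu]_t ((ind R (- (pi / 2) <= t <= x)%R)%:E * (2 * cos t ^+ 2)%:E)).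
  apply: eq_integral => t _.
  have [tx|tx] := boolP (- (pi / 2) <= t <= x)%R; last by rewrite indF !mul0e.
  rewrite chord_sin ?expr2 ?mulrA//.
  by move/andP: tx => [-> tx]/=; move/andP: xpi => [_]; exact: le_trans.
have [ax _] := andP xpi; rewrite (integral_FTC ax is_derive_primc2).
- by rewrite primc2N primc2_pihalf opprK addrC.
- move=> t; apply: (@continuousM _ _ (fun=> 2%R) (fun t => cos t ^+ 2)%R t).
    exact: cst_continuous.
  apply: (@continuous_comp _ _ _ cos (fun y : R => y ^+ 2)%R).
    exact: continuous_cos.
  exact: exprn_continuous.
- by move=> t _; rewrite mulr_ge0// sqr_ge0.
Qed.

Lemma primc2_bound x : (- (pi / 2) <= x <= pi / 2)%R -> (primc2 x ^+ 2 <= pi ^+ 2 / 4)%R.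
Proof.
move=> xpi; have [_ c0] := nnm_cap.
have Nxpi : (- (pi / 2) <= - x <= pi / 2)%R.
  by case/andP: xpi => ? ?; apply/andP; split; lra.
have := c0 (sin x); rewrite cap_sin// lee_fin => c1.
have := c0 (sin (- x)); rewrite cap_sin// lee_fin primc2N => c2.
rewrite -subr_ge0 (_ : _ - _ = (pi / 2 + primc2 x) * (pi / 2 - primc2 x))%R.
  exact: mulr_ge0.
by move: (@pi R) => p; field.
Qed.

Lemma continuous_primc2 : continuous (@primc2 R).
Proof.
move=> x; apply/differentiable_continuous/derivable1_diffP.
by case: (is_derive_primc2 x).
Qed.

Lemma asin_continuous : {within `[(-1)%R, 1%R], continuous (@asin R)}.
Proof.
have pi0 := @pi_ge0 R.
have := @segment_can_le_continuous R (- (pi / 2)) (pi / 2) sin asin.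
rewrite sinN sin_pihalf; apply.
- by rewrite ge0_cp// divr_ge0.
- by apply: continuous_subspaceT; exact: continuous_sin.
- exact: sinK.
Qed.

Let J t : R := (8 / 3 * (cos t ^+ 3 * (pi ^+ 2 / 4 - primc2 t ^+ 2)))%R.

Let continuous_J : continuous J.
Proof.
move=> t; apply: (@continuousM _ _ (fun=> 8 / 3)%R
    (fun t => cos t ^+ 3 * (pi ^+ 2 / 4 - primc2 t ^+ 2))%R t).
  exact: cst_continuous.
apply: (@continuousM _ _ (fun t => cos t ^+ 3)%R
    (fun t => pi ^+ 2 / 4 - primc2 t ^+ 2)%R t).
  apply: (@continuous_comp _ _ _ cos (fun y : R => y ^+ 3)%R).
    exact: continuous_cos.
  exact: exprn_continuous.
apply: (@continuousB _ _ _ (fun=> pi ^+ 2 / 4)%R (fun t => primc2 t ^+ 2)%R t).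
  exact: cst_continuous.
apply: (@continuous_comp _ _ _ primc2 (fun y : R => y ^+ 2)%R).
  exact: continuous_primc2.
exact: exprn_continuous.
Qed.

Let J_ge0 t : (- (pi / 2) <= t <= pi / 2)%R -> (0 <= J t)%R.
Proof.
move=> tx; rewrite /J mulr_ge0 ?mulr_ge0 ?exprn_ge0 ?cos_ge0_pihalf//.
by rewrite subr_ge0 primc2_bound.
Qed.

Lemma cap_product : \int[mu]_u ((4 / 3 * h u ^+ 3)%:E *
    (2%:E * (cap u * cap (- u)%R))) = (pi ^+ 3 / 6 + 35 * pi / 144)%:E.
Proof.
have asinI (u : R) : (-1 <= u <= 1)%R -> (- (pi / 2) <= asin u <= pi / 2)%R.
  by move=> u1; rewrite asin_geNpi2 ?asin_lepi2.
transitivity (\int[mu]_(u in `[(-1)%R, sin (pi / 2)]) (J (asin u))%:E).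
  rewrite sin_pihalf -integral_indicE; apply: eq_integral => u _.
  rewrite in_itv/=; have [u1|u1] := boolP (-1 <= u <= 1)%R; last first.
    rewrite indF mul0e chord_out ?expr0n/= ?mulr0 ?mul0e//.
    rewrite leNgt; apply: contra u1 => u1; rewrite -ler_norml.
    by rewrite -(@expr_le1 _ 2%N)// real_normK ?num_real// ltW.
  have -> : h u = cos (asin u) by rewrite cos_asin.
  rewrite indT mul1e -{2 3}(@asinK _ u) ?in_itv// -sinN !cap_sin; first last.
  - exact: asinI.
  - by have /andP[? ?] := asinI _ u1; apply/andP; split; lra.
  rewrite -!EFinM /J primc2N; congr (_%:E).
  by move: (@pi R) => p; field.
have pp : (- (@pi R / 2) <= @pi R / 2 <= @pi R / 2)%R.
  by rewrite lexx andbT ge0_cp// pihalf_ge0.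
rewrite (integral_subst_sin (G := J \o asin))//; last 2 first.
- rewrite sin_pihalf; apply: within_continuous_comp; last exact: asin_continuous.
  by move=> u _; exact: continuous_J.
- by move=> y; rewrite sin_pihalf => y1; rewrite /= J_ge0// asinI.
have [ax _] := andP pp.
pose f (t : R) := (cos t ^+ 4 * (pi ^+ 2 / 4 - primc2 t ^+ 2))%R.
transitivity (\int[mu]_t ((ind R (- (pi / 2) <= t <= pi / 2)%R)%:E *
    (8 / 3 * f t)%:E)).
  apply: eq_integral => t _.
  have [tx|tx] := boolP (- (pi / 2) <= t <= pi / 2)%R; last by rewrite indF !mul0e.
  rewrite indT !mul1e /= sinK ?in_itv// /J /f; congr (_%:E).
  by move: (@pi R) (primc2 t) => p k; field.
have dF (t : R) : is_derive t 1%R (fun t => 8 / 3 * primJ t)%R (8 / 3 * f t)%R.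
  by have d := is_derive_primJ t; exact: is_derive_eq.
rewrite (integral_FTC ax dF)//.
- rewrite primJN primJ_pihalf; congr (_%:E).
  by move: (@pi R) => p; field.
- move=> t; have -> : (fun t => 8 / 3 * f t)%R = (fun t => J t * cos t)%R.
    by apply/funext => x; rewrite /J /f; ring.
  apply: (@continuousM _ _ J cos t); first exact: continuous_J.
  exact: continuous_cos.
- move=> t tx; have -> : (8 / 3 * f t = J t * cos t)%R by rewrite /J /f; ring.
  by rewrite mulr_ge0 ?J_ge0 ?cos_ge0_pihalf.
Qed.

End caps.

Section separation.
Context {R : realType}.
Local Notation V := (R * R)%type.
Local Notation mu := (@leb R).
Local Notation mu2 := (@leb2 R).
Local Notation h := (@chord R).
Implicit Types (A B C D z : V).

Definition orient A B C : R := cross (B - A) (C - A).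

Definition sepb (z : (V * V) * (V * V)) : bool :=
  orient z.1.1 z.1.2 z.2.1 * orient z.1.1 z.1.2 z.2.2 < 0.

Definition collinear (z : (V * V) * (V * V)) : bool := orient z.1.1 z.1.2 z.2.1 == 0.

Let measurable_orient : measurable_fun setT (fun p => orient p.1.1 p.1.2 p.2).
Proof. by rewrite /orient /cross; meas. Qed.

Lemma measurable_sepb : measurable_fun setT sepb.
Proof.
apply: measurable_fun_ltr => //; apply: measurable_funM.
  by apply: (measurableT_comp measurable_orient (g := fun z : (V * V) * (V * V) => (z.1, z.2.1))); meas.
by apply: (measurableT_comp measurable_orient (g := fun z : (V * V) * (V * V) => (z.1, z.2.2))); meas.
Qed.

Lemma measurable_collinear : measurable_fun setT collinear.
Proof. by rewrite /collinear /orient /cross; meas. Qed.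

Lemma prot_orient (c s : R) A B C : c ^+ 2 + s ^+ 2 = 1 ->
  orient (prot c s A) (prot c s B) (prot c s C) = orient A B C.
Proof. by move=> cs; rewrite /orient !protB prot_cross. Qed.

Lemma orient_horizontal (r : R) A C : orient A (A.1 + r, A.2) C = r * (C.2 - A.2).
Proof. by rewrite /orient /cross/=; ring. Qed.

Local Open Scope ereal_scope.

Lemma integral_disk_row (y : R) :
  \int[mu]_x (ind R (disk (x, y)))%:E = (2 * h y)%:E.
Proof.
have [y1|y1] := leP (y ^+ 2)%R 1%R; last first.
  have h0 : h y = 0%R by rewrite /chord ler0_sqrtr// subr_le0 ltW.
  rewrite h0 mulr0 integral0_eq// => x _; rewrite /disk/= leNgt.
  by rewrite (lt_le_trans y1) ?lerDr ?sqr_ge0// indF.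
transitivity (\int[mu]_(x in `[(- h y)%R, h y]) (cst 1%:E x : \bar R)).
  rewrite -integral_indicE; apply: eq_integral => x _.
  by rewrite in_itv mule1 /disk/= sqr_le_chord y1.
rewrite integral_cst//= leb_itv/= lte_fin mul1e.
have h0 := chord_ge0 y; case: ltP => hy.
  by rewrite -EFinB; congr (_%:E); ring.
by congr (_%:E); lra.
Qed.

Lemma integral_disk_below (u : R) :
  \int[mu2]_z (ind R (disk z && (z.2 < u)%R))%:E = cap u.
Proof.
rewrite planarEr; last by rewrite /disk; nnmt.
apply: eq_integral => y _; rewrite -integral_disk_row.
etransitivity; last by apply: nnm_integralZl; [rewrite lee_fin ind_ge0|rewrite /disk; nnmt].
by apply: eq_integral => x _; rewrite ind_and mulrC EFinM.
Qed.

Lemma integral_disk_above (u : R) :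
  \int[mu2]_z (ind R (disk z && (u < z.2)%R))%:E = cap (- u)%R.
Proof.
rewrite -integral_disk_below -[RHS](@planar_reflect _ (fun z : V => _)) /=; last first.
  by rewrite /disk; nnmt.
by apply: eq_integral => z _; rewrite /disk/= sqrrN ltrN2.
Qed.

Lemma integral_fibers (f g : V -> \bar R) : nnm f -> nnm g ->
  \int[mu2]_C \int[mu2]_D (f C * g D) = \int[mu2]_C f C * \int[mu2]_D g D.
Proof.
move=> nf ng; rewrite -nnm_integralZr//; last first.
  by apply: nnm_integral_ge0.
by apply: eq_integral => C _; rewrite nnm_integralZl//; case: nf.
Qed.

Lemma sep_slice (r u : R) : (0 < r)%R ->
  \int[mu2]_C \int[mu2]_D (ind R [&& disk C, disk D
    & r * (C.2 - u) * (r * (D.2 - u)) < 0]%R)%:E = 2%:E * (cap u * cap (- u)%R).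
Proof.
move=> r0.
pose lo (z : V) : \bar R := (ind R (disk z && (z.2 < u)%R))%:E.
pose up (z : V) : \bar R := (ind R (disk z && (u < z.2)%R))%:E.
have nlo : nnm lo by rewrite /lo /disk; nnmt.
have nup : nnm up by rewrite /up /disk; nnmt.
transitivity (\int[mu2]_C \int[mu2]_D (lo C * up D + up C * lo D)).
  apply: eq_integral => C _; apply: eq_integral => D _.
  rewrite /lo /up -!EFinM -EFinD; congr (_%:E).
  have -> : (r * (C.2 - u) * (r * (D.2 - u)) < 0)%R =
      (((C.2 < u) && (u < D.2)) || ((u < C.2) && (D.2 < u)))%R.
    rewrite (_ : _ * _ = r ^+ 2 * ((C.2 - u) * (D.2 - u)))%R; last by ring.
    rewrite pmulr_rlt0 ?exprn_gt0//.
    apply/idP/orP => [cd|[/andP[c e]|/andP[c e]]]; [|by nra|by nra].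
    by have [c|c|c] := ltgtP C.2 u; [left; nra|right; nra|nra].
  rewrite !ind_and; case: (disk C); case: (disk D);
    rewrite ?indT ?indF; case: ltgtP => c; case: ltgtP => e;
    rewrite ?indT ?indF; ring.
rewrite /=.
transitivity (\int[mu2]_C (\int[mu2]_D (lo C * up D) + \int[mu2]_D (up C * lo D))).
  by apply: eq_integral => C _; apply: nnm_integralD; nnmt.
rewrite nnm_integralD; [|by nnmt|by nnmt].
rewrite !integral_fibers// integral_disk_below integral_disk_above.
by rewrite (muleC (cap (- u)%R)) -mule2n mule_natl.
Qed.

Lemma integral_sep :
  \int[mu2]_A \int[mu2]_B \int[mu2]_C \int[mu2]_D
    (ind R (in_disk4 ((A, B), (C, D)) && sepb ((A, B), (C, D))))%:E =
  (pi ^+ 4 / 3 + 35 * pi ^+ 2 / 72)%:E.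
Proof.
have m1 := @measurable_in_disk4 R; have m2 := measurable_sepb.
rewrite (@four_points_rot R (fun z : (V * V) * (V * V) => (ind R (in_disk4 z && sepb z))%:E)); last 2 first.
- by nnmt.
- move=> c s A B C D cs _.
  by rewrite /in_disk4 /sepb/= !prot_disk// !prot_orient.
pose S u : \bar R := 2%:E * (cap u * cap (- u)%R).
have nS : nnm S by have nc := @nnm_cap R; rewrite /S; nnmt.
pose I (r x u : R) : \bar R := (ind R (disk (x, u) && disk (x + r, u)%R))%:E.
transitivity ((2 * pi)%:E * \int[mu]_r \int[mu]_u
    ((S u * (Num.max 0%R r)%:E) * \int[mu]_x I r x u)).
  apply: (congr1 (mule _)); apply: eq_integral => r _.
  have [r0|r0] := leP r 0%R.
    rewrite mul0e; symmetry; apply: integral0_eq => u _.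
    by rewrite mule0 mul0e.
  transitivity (r%:E * \int[mu2]_A (I r A.1 A.2 * S A.2)).
    apply: (congr1 (mule _)); apply: eq_integral => A _.
    rewrite /S -(sep_slice A.2 r0) /I.
    rewrite -nnm_integral2Zl; [|by rewrite lee_fin ind_ge0|by rewrite /disk; nnmt].
    apply: eq_integral => C _; apply: eq_integral => D _.
    rewrite /in_disk4 /sepb /= !orient_horizontal -EFinM -ind_and.
    by case: A => ? ?; rewrite -!andbA.
  rewrite planarEr; last by rewrite /I /disk; nnmt.
  symmetry.
  etransitivity; last first.
    apply: nnm_integralZl; first by rewrite lee_fin ltW.
    by rewrite /I /disk; nnmt.
  apply: eq_integral => u _.
  rewrite muleAC [LHS]muleC; apply: (congr1 (mule _)) => /=.
  rewrite [LHS]muleC; symmetry; apply: nnm_integralZr; first by case: nS.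
  by rewrite /I /disk; nnmt.
rewrite tonelli_swap; last by rewrite /I /disk; nnmt.
transitivity ((2 * pi)%:E * \int[mu]_u ((4 / 3 * h u ^+ 3)%:E * S u)).
  apply: (congr1 (mule _)); apply: eq_integral => u _.
  rewrite muleC -chord_length_moment -nnm_integralZl; [|by case: nS|by rewrite /disk; nnmt].
  by apply: eq_integral => r _; rewrite -muleA.
rewrite cap_product -EFinM; congr (_%:E).
by move: (@pi R) => p; field.
Qed.

Lemma integral_ind_eq (u : R) (f : R -> \bar R) : nnm f ->
  \int[mu]_y ((ind R (y == u))%:E * f y) = 0.
Proof.
move=> [mf f0]; transitivity (\int[mu]_(y in `[u, u]) f y).
  rewrite -integral_indicE; apply: eq_integral => y _.
  by rewrite in_itv/= eq_le andbC.
rewrite lebE//; last exact: measurable_funTS.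
by rewrite set_itv1 integral_set1.
Qed.

Lemma integral_collinear :
  \int[mu2]_A \int[mu2]_B \int[mu2]_C \int[mu2]_D
    (ind R (in_disk4 ((A, B), (C, D)) && collinear ((A, B), (C, D))))%:E = 0.
Proof.
have m1 := @measurable_in_disk4 R; have m2 := measurable_collinear.
rewrite (@four_points_rot R (fun z : (V * V) * (V * V) => (ind R (in_disk4 z && collinear z))%:E)); last 2 first.
- by nnmt.
- move=> c s A B C D cs _.
  by rewrite /in_disk4 /collinear/= !prot_disk// !prot_orient.
rewrite integral0_eq ?mule0// => r _.
have [r0|r0] := leP r 0%R; first by rewrite mul0e.
rewrite integral0_eq ?mule0// => A _.
pose g C := \int[mu2]_D (ind R (in_disk4 ((A, (A.1 + r, A.2)%R), (C, D))))%:E.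
have ng : nnm g by rewrite /g; nnmt.
transitivity (\int[mu2]_C ((ind R (C.2 == A.2))%:E * g C)).
  apply: eq_integral => C _; rewrite -nnm_integralZl; [|by rewrite lee_fin ind_ge0|by nnmt].
  apply: eq_integral => D _; rewrite -EFinM -ind_and andbC /collinear /= orient_horizontal.
  by rewrite mulf_eq0 gt_eqF//= subr_eq0.
rewrite planarEr; last by nnmt.
rewrite -[RHS](@integral_ind_eq A.2 (fun y => \int[mu]_x g (x, y))); last by nnmt.
apply: eq_integral => y _ /=.
by apply: nnm_integralZl; [rewrite lee_fin ind_ge0|nnmt].
Qed.

End separation.

(** * Points in general position *)

Section generic_position.
Context {R : realType}.
Local Notation V := (R * R)%type.
Implicit Types (A B C D : V).

Lemma meetb_generic A B C D : orient A B C != 0 -> orient A B D != 0 ->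
  orient A C D != 0 -> orient B C D != 0 ->
  meetb A B C D = sepb ((A, B), (C, D)) && sepb ((C, D), (A, B)).
Proof.
rewrite /meetb /sepb/= -!/(orient _ _ _) => nC nD nA nB.
have eA : orient C D A = orient A C D by rewrite /orient /cross/=; ring.
have eB : orient C D B = orient B C D by rewrite /orient /cross/=; ring.
have k : cross (B - A) (D - C) = orient A B D - orient A B C.
  by rewrite /orient /cross/=; ring.
rewrite eA eB k; case: ifPn => [_|]; first by rewrite !le_eqVlt !mulf_eq0
  (negbTE nA) (negbTE nB) (negbTE nC) (negbTE nD).
rewrite negbK subr_eq0 => /eqP CD; rewrite /on_segment -!/(orient _ _ _) eA eB.
rewrite (negbTE nA) (negbTE nB) (negbTE nC) (negbTE nD)/= CD -expr2.
by rewrite ltNge sqr_ge0.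
Qed.

(* In convex position exactly one pairing of the points crosses, and its two
   lines are the only separating ones; otherwise one point lies in the triangle
   of the others, and exactly the three lines through it separate. *)
Lemma generic_count A B C D : orient A B C != 0 -> orient A B D != 0 ->
  orient A C D != 0 -> orient B C D != 0 ->
  ind R (sepb ((A, B), (C, D))) + (ind R (sepb ((C, D), (A, B)))
  + (ind R (sepb ((A, C), (B, D))) + (ind R (sepb ((B, D), (A, C)))
  + (ind R (sepb ((A, D), (B, C))) + (ind R (sepb ((B, C), (A, D)))
  + (ind R (meetb A B C D) + (ind R (meetb A C B D) + ind R (meetb A D B C)))))))) = 3.
Proof.
move=> nC nD nA nB.
have eACB : orient A C B = - orient A B C by rewrite /orient /cross/=; ring.
have eADB : orient A D B = - orient A B D by rewrite /orient /cross/=; ring.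
have eADC : orient A D C = - orient A C D by rewrite /orient /cross/=; ring.
have eCDA : orient C D A = orient A C D by rewrite /orient /cross/=; ring.
have eCDB : orient C D B = orient B C D by rewrite /orient /cross/=; ring.
have eBDA : orient B D A = orient A B D by rewrite /orient /cross/=; ring.
have eBDC : orient B D C = - orient B C D by rewrite /orient /cross/=; ring.
have eBCA : orient B C A = orient A B C by rewrite /orient /cross/=; ring.
have eCBD : orient C B D = - orient B C D by rewrite /orient /cross/=; ring.
have eDBC : orient D B C = orient B C D by rewrite /orient /cross/=; ring.
have e : orient B C D - orient A C D + orient A B D - orient A B C = 0.
  by rewrite /orient /cross/=; ring.
rewrite !meetb_generic ?eACB ?eADB ?eADC ?eCBD ?eDBC ?oppr_eq0// !ind_and /sepb/=.
rewrite eACB eADB eADC eCDA eCDB eBDA eBDC eBCA !mulr_lt0 !oppr_eq0 nA nB nC nD !oppr_lt0 /=.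
move: nA nB nC nD e; move: (orient B C D) (orient A C D) (orient A B D) (orient A B C).
move=> a b c d a0 b0 c0 d0 e.
case/orP: (lt_total a0) => {}a0; case/orP: (lt_total b0) => {}b0;
  case/orP: (lt_total c0) => {}c0; case/orP: (lt_total d0) => {}d0; try lra;
  rewrite ?a0 ?b0 ?c0 ?d0 ?(lt_gtF a0) ?(lt_gtF b0) ?(lt_gtF c0) ?(lt_gtF d0) /=
    ?indT ?indF; ring.
Qed.

End generic_position.

Section independent4_permutations.
Context d (T : measurableType d) d1 (S : measurableType d1) (R : realType).
Variables (P : probability T R).
Implicit Types (A B C D : {mfun T >-> S}).
Local Open Scope ereal_scope.

Lemma independent4_swap12 A B C D :
  independent4 P A B C D -> independent4 P B A C D.
Proof.
move=> i E1 E2 E3 E4 m1 m2 m3 m4.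
by rewrite (setIC (B @^-1` _)) (muleC (P (B @^-1` _))) i.
Qed.

Lemma independent4_swap23 A B C D :
  independent4 P A B C D -> independent4 P A C B D.
Proof.
move=> i E1 E2 E3 E4 m1 m2 m3 m4.
by rewrite setIACA muleACA i.
Qed.

Lemma independent4_swap34 A B C D :
  independent4 P A B C D -> independent4 P A B D C.
Proof.
move=> i E1 E2 E3 E4 m1 m2 m3 m4.
by rewrite (setIC (D @^-1` _)) (muleC (P (D @^-1` _))) i.
Qed.

End independent4_permutations.

Section uniform_events.
Context {R : realType}.
Local Notation V := (R * R)%type.
Local Notation mu2 := (@leb2 R).
Local Open Scope ereal_scope.
Context d (T : measurableType d) (P : probability T R).

Section events.
Variables A B C D : {RV P >-> V}.
Hypotheses (uA : uniform_in_disk A) (uB : uniform_in_disk B).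
Hypotheses (uC : uniform_in_disk C) (uD : uniform_in_disk D).
Hypothesis indep : independent4 P A B C D.

Lemma prob_event (b : (V * V) * (V * V) -> bool) : measurable_fun setT b ->
  P [set w | b ((A w, B w), (C w, D w))] =
  (pi ^- 4)%:E * \int[mu2]_A \int[mu2]_B \int[mu2]_C \int[mu2]_D
    (ind R (in_disk4 ((A, B), (C, D)) && b ((A, B), (C, D))))%:E.
Proof.
move=> mb; have bE z : \1_[set z | b z] z = ind R (b z).
  by rewrite indicE; congr ((nat_of_bool _)%:R); apply/idP/idP; rewrite inE.
rewrite [LHS](iid_uniform_prob uA uB uC uD indep (X := [set z | b z])).
  apply: (congr1 (mule _)); do 4! (apply: eq_integral => ? _).
  by rewrite -EFinM ind_and bE.
rewrite (_ : [set z | _] = b @^-1` [set true])//.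
by rewrite -[X in measurable X]setTI; exact: mb.
Qed.

Lemma prob_sep : P [set w | sepb ((A w, B w), (C w, D w))] =
  (1 / 3 + 35 / (72 * pi ^+ 2))%:E.
Proof.
rewrite prob_event ?integral_sep -?EFinM; last exact: measurable_sepb.
by congr (_%:E); move: (@pi R) (lt0r_neq0 (pi_gt0 R)) => p p0; field.
Qed.

Lemma ae_not_collinear : {ae P, forall w, orient (A w) (B w) (C w) != 0%R}.
Proof.
have mABCD : measurable_fun setT (fun w => ((A w, B w), (C w, D w))) by meas.
exists [set w | collinear ((A w, B w), (C w, D w))]; split.
- rewrite -[X in measurable X]setTI.
  rewrite (_ : _ `&` _ = setT `&` (@collinear R \o (fun w => ((A w, B w), (C w, D w)))) @^-1` [set true])//.
  by apply: measurableT_comp => //; exact: measurable_collinear.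
- by rewrite prob_event ?integral_collinear ?mule0//; exact: measurable_collinear.
- by move=> w /= /negP; rewrite negbK.
Qed.

Lemma prob_meet : P [set w | meet4 ((A w, B w), (C w, D w))] =
  \int[leb]_t (gstar t : R)%:E.
Proof.
have := prob_meet_angle uA uB uC uD indep (E := setT) measurableT.
rewrite setIT => ->; apply: eq_integral => t _.
by rewrite indicT mul1e.
Qed.

End events.

Variables A B C D : {RV P >-> V}.
Hypotheses (uA : uniform_in_disk A) (uB : uniform_in_disk B).
Hypotheses (uC : uniform_in_disk C) (uD : uniform_in_disk D).
Hypothesis indep : independent4 P A B C D.

Lemma expect_ind (b : T -> bool) : measurable_fun setT b ->
  \int[P]_w (ind R (b w))%:E = P [set w | b w].
Proof.
move=> mb; transitivity (\int[P]_(w in [set w | b w]) 1%:E).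
  rewrite -(integral_ind P b (fun=> 1%:E))//.
  by apply: eq_integral => w _; rewrite mule1.
rewrite integral_cst ?mul1e//.
rewrite -[X in measurable X]setTI (_ : [set w | _] = b @^-1` [set true])//.
exact: mb.
Qed.

Lemma prob_meet_exact : P [set w | meet4 ((A w, B w), (C w, D w))] =
  (3^-1 * (1 - 35 / (12 * pi ^+ 2)))%:E.
Proof.
have iACBD := independent4_swap23 indep.
have iABDC := independent4_swap34 indep.
have iACDB := independent4_swap34 iACBD.
have iADBC := independent4_swap23 iABDC.
have iBCDA := independent4_swap34 (independent4_swap23 (independent4_swap12 indep)).
have iBDAC := independent4_swap34 (independent4_swap23 iBCDA).
have iBCAD := independent4_swap34 iBCDA.
have iCDAB := independent4_swap23 (independent4_swap12 iACDB).
have ms := @measurable_sepb R; have mm := @measurable_meet4 R.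
pose q : \bar R := (1 / 3 + 35 / (72 * pi ^+ 2))%:E.
pose m := \int[leb]_t (gstar t : R)%:E.
pose s X Y Z W (w : T) : \bar R := (ind R (sepb (((X w, Y w), (Z w, W w)) : (V * V) * (V * V))))%:E.
pose t X Y Z W (w : T) : \bar R := (ind R (meet4 (((X w, Y w), (Z w, W w)) : (V * V) * (V * V))))%:E.
pose f w := s A B C D w + (s C D A B w + (s A C B D w + (s B D A C w + (s A D B C w +
  (s B C A D w + (t A B C D w + (t A C B D w + t A D B C w))))))).
have ns (X Y Z W : {RV P >-> V}) : nnm (s X Y Z W) by rewrite /s; nnmt.
have nt (X Y Z W : {RV P >-> V}) : nnm (t X Y Z W) by rewrite /t; nnmt.
have Es (X Y Z W : {RV P >-> V}) : uniform_in_disk X -> uniform_in_disk Y ->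
    uniform_in_disk Z -> uniform_in_disk W -> independent4 P X Y Z W ->
    \int[P]_w s X Y Z W w = q.
  by move=> uX uY uZ uW i; rewrite /s expect_ind ?prob_sep//; meas.
have Et (X Y Z W : {RV P >-> V}) : uniform_in_disk X -> uniform_in_disk Y ->
    uniform_in_disk Z -> uniform_in_disk W -> independent4 P X Y Z W ->
    \int[P]_w t X Y Z W w = m.
  by move=> uX uY uZ uW i; rewrite /t expect_ind ?prob_meet//; meas.
have nf : nnm f by rewrite /f; repeat first [exact: ns|exact: nt|apply: nnmD].
have fE : \int[P]_w f w = q + (q + (q + (q + (q + (q + (m + (m + m))))))).
  rewrite /f; do 8! (rewrite nnm_integralD; [|by first [exact: ns|exact: nt]
    |by repeat first [exact: ns|exact: nt|apply: nnmD]]).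
  by rewrite !Es// !Et.
have f3 : \int[P]_w f w = 3%:E.
  transitivity (\int[P]_w (cst 3%:E w : \bar R)); last first.
    by rewrite integral_cst// [X in _ * X]probability_setT mule1.
  apply: ge0_ae_eq_integral => //; first by case: nf.
    by move=> w _; case: nf => _; exact.
    by move=> w _; rewrite lee_fin.
  have nC := ae_not_collinear uA uB uC uD indep.
  have nD := ae_not_collinear uA uB uD uC iABDC.
  have nB := ae_not_collinear uA uC uD uB iACDB.
  have nA := ae_not_collinear uB uC uD uA iBCDA.
  have nAB : {ae P, forall w, orient (B w) (C w) (D w) != 0%R /\
      orient (A w) (C w) (D w) != 0%R} by apply: filterS2 nA nB => w.
  apply: filterS3 nAB nC nD => w [a b] c e _.
  by rewrite /f /s /t -!EFinD generic_count.
rewrite (prob_meet uA uB uC uD indep) -/m; clearbody m.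
move: fE; rewrite f3 /q; case: m {Et} => [x| |]//; rewrite -!EFinD => -[] e.
congr (_%:E); move: e; move: (@pi R) (lt0r_neq0 (pi_gt0 R)) => p p0 e.
have -> : (35 / (12 * p ^+ 2) = 6 * (35 / (72 * p ^+ 2)))%R by field.
lra.
Qed.

End uniform_events.

(** * Numerical bounds *)

Section taylor.
Context {R : realType}.
Implicit Types x y : R.

Lemma ge0_of_derive (F f : R -> R) : (forall x, is_derive x 1 F (f x)) ->
  (forall x, 0 <= x -> 0 <= f x) -> F 0 = 0 -> forall x, 0 <= x -> 0 <= F x.
Proof.
move=> dF f0 F0 x x0; rewrite -F0.
have F1 y : derive1 F y = f y by rewrite derive1E; have := dF y => -[_].
apply: (@ger0_derive1_ndecry _ F 0) => //.
- by move=> y; rewrite in_itv/= andbT F1 => y0; apply: f0; exact: ltW.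
- apply: continuous_subspaceT => y.
  by apply/differentiable_continuous/derivable1_diffP; case: (dF y).
Qed.

(* Computes without unary natural numbers, unlike [n`!%:R]. *)
Fixpoint rfact n : R := if n is m.+1 then n%:R * rfact m else 1.

Lemma rfact_neq0 n : rfact n != 0.
Proof. by elim: n => [|n IH] /=; rewrite ?oner_eq0// mulf_neq0// pnatr_eq0. Qed.

Fixpoint cos_taylor n x : R :=
  if n is m.+1 then cos_taylor m x + (-1) ^+ n * (x ^+ n.*2 / rfact n.*2) else 1.

Fixpoint sin_taylor n x : R :=
  if n is m.+1 then sin_taylor m x + (-1) ^+ n * (x ^+ n.*2.+1 / rfact n.*2.+1) else x.

Let dterm k (c : R) x :
  is_derive x 1 (fun x => c * (x ^+ k.+1 / rfact k.+1)) (c * (x ^+ k / rfact k)).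
Proof.
have k1 : k.+1%:R != 0 :> R by rewrite pnatr_eq0.
have k0 : rfact k != 0 :> R by exact: rfact_neq0.
pose e := c / rfact k.+1.
rewrite [X in is_derive _ _ X](_ : _ = fun x => e * x ^+ k.+1); last first.
  by apply/funext => y; rewrite /e; ring.
have -> : c * (x ^+ k / rfact k) = e * (k.+1%:R * x ^+ k).
  by rewrite /e /=; field; rewrite k0 addrC natr1 k1.
have d : is_derive x 1 (fun y : R => y ^+ k.+1) (k.+1%:R * x ^+ k).
  rewrite [X in is_derive _ _ X](_ : _ = id ^+ k.+1); last first.
    by apply/funext => y; rewrite exprfctE.
  by rewrite -[X in is_derive _ _ _ X]mulr1; exact: (is_deriveX k.+1 (is_derive_id x 1)).
by clearbody e; apply: is_derive_eq; rewrite /GRing.scale/=; ring.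
Qed.

Lemma is_derive_sin_taylor n x : is_derive x 1 (sin_taylor n) (cos_taylor n x).
Proof.
elim: n => [|n IH] /=; first exact: is_derive_id.
have d := dterm n.+1.*2 ((-1) ^+ n.+1) x.
exact: is_deriveD.
Qed.

Lemma is_derive_cos_taylor n x : is_derive x 1 (cos_taylor n.+1) (- sin_taylor n x).
Proof.
elim: n => [|n IH].
  have d := dterm 1 (-1) x.
  rewrite [cos_taylor _](_ : _ = fun x => 1 + (-1) * (x ^+ 2 / rfact 2)); last first.
    by apply/funext => y.
  by apply: is_derive_eq; rewrite expr1 /=; field.
have d := dterm n.*2.+3 ((-1) ^+ n.+2) x.
rewrite [cos_taylor _](_ : _ = fun x => cos_taylor n.+1 x +
  (-1) ^+ n.+2 * (x ^+ n.*2.+4 / rfact n.*2.+4)); last by apply/funext => y.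
apply: is_derive_eq => /=; rewrite !exprS; ring.
Qed.

Lemma cos_taylor0 n : cos_taylor n 0 = 1 :> R.
Proof. by elim: n => //= n ->; rewrite doubleS expr0n mul0r mulr0 addr0. Qed.

Lemma sin_taylor0 n : sin_taylor n 0 = 0 :> R.
Proof. by elim: n => //= n ->; rewrite expr0n mul0r mulr0 addr0. Qed.

Lemma taylor_bound n : (forall x, 0 <= x -> 0 <= (-1) ^+ n * (cos_taylor n x - cos x)) /\
  (forall x, 0 <= x -> 0 <= (-1) ^+ n * (sin_taylor n x - sin x)).
Proof.
have step m : (forall x, 0 <= x -> 0 <= (-1) ^+ m * (cos_taylor m x - cos x)) ->
    forall x, 0 <= x -> 0 <= (-1) ^+ m * (sin_taylor m x - sin x).
  move=> H; apply: (@ge0_of_derive _ (fun x => (-1) ^+ m * (cos_taylor m x - cos x))) => //.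
    move=> x; have d := is_derive_sin_taylor m x.
    by apply: is_derive_eq; rewrite /GRing.scale/=; ring.
  by rewrite sin_taylor0 sin0 subrr mulr0.
elim: n => [|n [_ IH]].
  have H x : 0 <= x -> 0 <= (-1) ^+ 0 * (cos_taylor 0 x - cos x).
    by rewrite expr0 mul1r/= subr_ge0 cos_le1.
  by split => //; exact: step.
have H : forall x, 0 <= x -> 0 <= (-1) ^+ n.+1 * (cos_taylor n.+1 x - cos x).
  apply: (@ge0_of_derive _ (fun x => (-1) ^+ n * (sin_taylor n x - sin x))) => //.
    move=> x; have d := is_derive_cos_taylor n x.
    by apply: is_derive_eq; rewrite /GRing.scale/= exprS; ring.
  by rewrite cos_taylor0 cos0 subrr mulr0.
by split => //; exact: step.
Qed.

Lemma sin_pi6 : sin (pi / 6) = 2^-1 :> R.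
Proof.
set t : R := pi / 6.
have e : sin (t + t + t) = 1.
  by rewrite -sin_pihalf; congr sin; rewrite /t; field.
have s0 : 0 < sin t.
  by apply: sin_gt0_pihalf; have := pi_gt0 R; rewrite /t; lra.
rewrite sinD sinD cosD in e.
have c2 : cos t * cos t = 1 - sin t * sin t by rewrite -!expr2 cos2sin2.
have {}e : (sin t + 1) * (2 * sin t - 1) ^+ 2 = 0.
  transitivity (1 - (3 * (sin t * (cos t * cos t)) - sin t ^+ 3)).
    by rewrite c2; ring.
  by rewrite -[X in X - _]e; ring.
move/eqP: e; rewrite mulf_eq0 sqrf_eq0 => /orP[|] /eqP e; lra.
Qed.

Lemma pi6_gt x : 0 <= x <= 1 -> sin x < 2^-1 -> x < pi / 6.
Proof.
move=> /andP[x0 x1]; rewrite -sin_pi6 => sx.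
have p2 := pi_ge2 R; rewrite -ltr_sin// in_itv/=; lra.
Qed.

Lemma pi6_lt x : 0 <= x <= 1 -> 2^-1 < sin x -> pi / 6 < x.
Proof.
move=> /andP[x0 x1]; rewrite -sin_pi6 => sx.
have p2 := pi_ge2 R; rewrite -ltr_sin// in_itv/=; lra.
Qed.

Let xlo : R := 523 / 10 ^+ 3 + 598 / 10 ^+ 6 + 775 / 10 ^+ 9 + 598 / 10 ^+ 12.
Let xup : R := 523 / 10 ^+ 3 + 598 / 10 ^+ 6 + 775 / 10 ^+ 9 + 599 / 10 ^+ 12.

Lemma pi6_bounds : xlo < pi / 6 < xup.
Proof.
apply/andP; split.
  apply: pi6_gt; first by rewrite /xlo; lra.
  have [_ /(_ xlo)] := taylor_bound 6.
  rewrite -signr_odd/= expr0 mul1r subr_ge0 => H.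
  apply: (le_lt_trans (H _)); first by rewrite /xlo; lra.
  by rewrite /= !doubleS double0 /xlo; lra.
apply: pi6_lt; first by rewrite /xup; lra.
have [_ /(_ xup)] := taylor_bound 5.
rewrite -signr_odd/= expr1 mulN1r oppr_ge0 subr_le0 => H.
apply: (lt_le_trans _ (H _)); last by rewrite /xup; lra.
by rewrite /= !doubleS double0 /xup; lra.
Qed.

Lemma meet_value_bounds :
  234 / 10 ^+ 3 + 826 / 10 ^+ 6 + 627 / 10 ^+ 9 + 14 / 10 ^+ 12
    <= 3^-1 * (1 - 35 / (12 * @pi R ^+ 2))
    < 234 / 10 ^+ 3 + 826 / 10 ^+ 6 + 627 / 10 ^+ 9 + 15 / 10 ^+ 12.
Proof.
have /andP[] := pi6_bounds; rewrite /xlo /xup.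
have -> : 35 / (12 * pi ^+ 2) = 35 / 432 / (pi / 6) ^+ 2 :> R.
  by have := lt0r_neq0 (pi_gt0 R); move: (@pi R) => p p0; field.
move: (pi / 6) => x x1 x2.
have sqr_mono (a b : R) : 0 < a -> a < b -> a ^+ 2 <= b ^+ 2.
  by move=> a0 ab; rewrite ler_sqr ?nnegrE ?ltW// (lt_trans a0).
have x0 : 0 < x by apply: lt_trans x1; lra.
have up := sqr_mono _ _ x0 x2.
have /sqr_mono/(_ x1) lo : 0 < 523 / 10 ^+ 3 + 598 / 10 ^+ 6 + 775 / 10 ^+ 9 + 598 / 10 ^+ 12 :> R.
  by lra.
have y0 : 0 < x ^+ 2 by rewrite exprn_gt0.
move: (x ^+ 2) y0 up lo => y y0 up lo {x x0 x1 x2}.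
apply/andP; split.
  suff : 35 / 432 / y <= 1 - 3 * (234 / 10 ^+ 3 + 826 / 10 ^+ 6 + 627 / 10 ^+ 9 + 14 / 10 ^+ 12) by lra.
  by rewrite ler_pdivrMr//; lra.
suff : 1 - 3 * (234 / 10 ^+ 3 + 826 / 10 ^+ 6 + 627 / 10 ^+ 9 + 15 / 10 ^+ 12) < 35 / 432 / y by lra.
by rewrite ltr_pdivlMr//; lra.
Qed.

End taylor.

Lemma mutually_independent4 d (T : measurableType d) d' (S : measurableType d')
    (R : realType) (P : probability T R) (A B C D : {RV P >-> S}) :
  mutually_independent (fun i : 'I_4 => tnth [tuple A; B; C; D] i) ->
  independent4 P A B C D.
Proof.
move=> ind E1 E2 E3 E4 m1 m2 m3 m4.
have := ind [set: 'I_4]%SET (tnth [tuple E1; E2; E3; E4]).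
rewrite (eq_bigl predT) => [|i]; last by rewrite finset.in_setT.
rewrite !big_ord_recl big_ord0 mule1 !(tnth_nth A) !(tnth_nth E1) /= -muleA => <-.
  congr (P _); apply/seteqP; split => w /=.
    move=> [[w1 w2] [w3 w4]] i _; rewrite /= (tnth_nth A) (tnth_nth E1).
    by case: i => -[|[|[|[|//]]]] ?.
  move=> H; have H' (i : 'I_4) : tnth [tuple E1; E2; E3; E4] i (tnth [tuple A; B; C; D] i w).
    by apply: H => /=; rewrite finset.in_setT.
  have := H' ord0; have := H' (lift ord0 ord0).
  have := H' (lift ord0 (lift ord0 ord0)); have := H' (lift ord0 (lift ord0 (lift ord0 ord0))).
  by rewrite !(tnth_nth A) !(tnth_nth E1).
move=> i _; rewrite (tnth_nth E1).
by case: i => -[|[|[|[|//]]]] ?.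
Qed.

Section gstar_mass.
Context {R : realType}.
Local Open Scope ereal_scope.

Lemma integral_leb_set (E : set R) (f : R -> R) : measurable E ->
  measurable_fun setT f -> (forall x, 0 <= f x)%R ->
  \int[lebesgue_measure]_(x in E) (f x)%:E = \int[leb]_x ((\1_E x)%:E * (f x)%:E).
Proof.
move=> mE mf f0.
have mf' : measurable_fun E (fun x => (f x)%:E).
  by apply: measurable_funTS; apply/measurable_EFinP.
rewrite -[LHS](lebE mE mf'); last by move=> x _; rewrite lee_fin.
rewrite [LHS]integral_mkcond; apply: eq_integral => x _.
rewrite patchE indicE; case: ifP => _; [by rewrite mul1e|by rewrite mul0e].
Qed.

Lemma gstar_massE (x : R) : \int[leb]_t (gstar t)%:E = x%:E -> gstar_mass R = x.
Proof.
rewrite /gstar_mass /Rintegral integral_leb_set; [|by []|exact: measurable_gstar|exact: gstar_ge0].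
move=> xE; rewrite -[RHS]/(fine x%:E) -xE; congr fine; apply: eq_integral => t _.
rewrite indicE; case: (boolP (t \in _)) => [_|]; first by rewrite mul1e.
move=> tpi; rewrite gstar_out ?mule0//.
by apply: contraNN tpi => /andP[? ?]; apply/mem_set; rewrite /= in_itv/= !ltW.
Qed.

End gstar_mass.

Theorem theorem2p1 (R : realType) (d : measure_display) (T : measurableType d)
    (P : probability T R) (A B C D : {RV P >-> (R * R)%type})
    (indep : mutually_independent (fun i : 'I_4 => tnth [tuple A; B; C; D] i))
    (unifA : uniform_in_disk A) (unifB : uniform_in_disk B)
    (unifC : uniform_in_disk C) (unifD : uniform_in_disk D) :
  let meet : set T :=
    [set w | segment (A w) (B w) `&` segment (C w) (D w) !=set0] in
  let Theta : T -> R := fun w => angle (B w - A w) (D w - C w) in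
  let c : R := gstar_mass R in
  [/\ c%:E = P meet,
      c = 3^-1 * (1 - 35 / (12 * pi ^+ 2)),
      234 / 10 ^+ 3 + 826 / 10 ^+ 6 + 627 / 10 ^+ 9 + 14 / 10 ^+ 12 <= c
        < 234 / 10 ^+ 3 + 826 / 10 ^+ 6 + 627 / 10 ^+ 9 + 15 / 10 ^+ 12,
      cond_density P Theta meet (@gdens R)
    & forall theta : R, 0 <= theta <= pi ->
        cond_prob P [set w | Theta w <= theta] meet
          = \int[lebesgue_measure]_(s in `[0, theta]) gdens s].
Proof.
have {}indep := mutually_independent4 indep.
move=> meet Theta c.
have meetE : meet = [set w | meet4 ((A w, B w), (C w, D w))].
  by apply/seteqP; split => w /meetP.
have Pmeet : P meet = (3^-1 * (1 - 35 / (12 * pi ^+ 2)))%:E.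
  by rewrite meetE; exact: prob_meet_exact.
have cE : c = 3^-1 * (1 - 35 / (12 * pi ^+ 2)).
  by apply: gstar_massE; rewrite -Pmeet meetE; symmetry; exact: prob_meet.
have cP : c%:E = P meet by rewrite Pmeet cE.
have cb := @meet_value_bounds R; rewrite -cE in cb.
have c0 : 0 < c by case/andP: cb => cb _; apply: lt_le_trans cb; lra.
have mg : measurable_fun setT (@gdens R).
  have mgs := @measurable_gstar R; rewrite /gdens.
  by meas.
have gd0 (x : R) : 0 <= gdens x.
  have c0' : 0 <= gstar_mass R by exact: ltW.
  by rewrite /gdens mulr_ge0 ?ind_ge0// divr_ge0 ?gstar_ge0.
have gdE (x : R) : gdens x = c^-1 * gstar x.
  rewrite /gdens; have [x0|/gstar_out->] := boolP (0 < x < pi).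
    by rewrite indT mulr1 mulrC.
  by rewrite mul0r mul0r mulr0.
have dens E : measurable E -> (cond_prob P (Theta @^-1` E) meet)%:E =
    (\int[lebesgue_measure]_(x in E) (gdens x)%:E)%E.
  move=> mE; rewrite integral_leb_set//.
  have nE : nnm (fun t : R => (\1_E t)%:E : \bar R).
    by apply: nnm_EFin; [exact: measurable_indic|move=> t; rewrite indicE].
  have ng : nnm (fun t : R => (gstar t)%:E).
    by apply: nnm_EFin; [exact: measurable_gstar|exact: gstar_ge0].
  have nEg := nnmM nE ng.
  have fin : (\int[leb]_t ((\1_E t)%:E * (gstar t)%:E))%E \is a fin_num.
    rewrite ge0_fin_numE; last exact: nnm_integral_ge0.
    apply: (@le_lt_trans _ _ (\int[leb]_t (gstar t : R)%:E)%E).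
      apply: ge0_le_integral => //; [by move=> t _; case: nEg|by case: nEg
        |by case: ng|].
      move=> t _; rewrite -EFinM lee_fin indicE.
      by case: (_ \in _); rewrite ?mul1r// mul0r gstar_ge0.
    by rewrite -(prob_meet unifA unifB unifC unifD indep) -meetE -cP ltry.
  rewrite /cond_prob -cP setIC meetE (prob_meet_angle unifA unifB unifC unifD indep mE).
  transitivity ((c^-1)%:E * \int[leb]_t ((\1_E t)%:E * (gstar t)%:E))%E.
    by rewrite EFinM fineK// muleC.
  rewrite -nnm_integralZl ?lee_fin ?invr_ge0 ?(ltW c0)//.
  by apply: eq_integral => t _; rewrite gdE EFinM muleCA.
have last theta : 0 <= theta <= pi -> cond_prob P [set w | Theta w <= theta] meet
    = \int[lebesgue_measure]_(s in `[0, theta]) gdens s.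
  move=> _; apply: (@EFin_inj R).
  have {}dens := dens `]-oo, theta]%classic (measurable_itv _).
  rewrite (_ : Theta @^-1` _ = [set w | Theta w <= theta]) in dens; last first.
    by apply/seteqP; split => w /=; rewrite in_itv.
  have restr : (\int[lebesgue_measure]_(x in `]-oo, theta]%classic) (gdens x)%:E =
      \int[lebesgue_measure]_(x in `[0%R, theta]%classic) (gdens x)%:E)%E.
    rewrite !integral_leb_set//; apply: eq_integral => t _.
    have [/andP[t0 _]|tpi] := boolP (0 < t < pi); last first.
      by rewrite gdE gstar_out// mulr0 !mule0.
    congr (_%:E * _)%E; rewrite !indicE; congr ((nat_of_bool _)%:R).
    by apply/idP/idP; rewrite !inE/= !in_itv/= (ltW t0).
  by rewrite dens restr /Rintegral fineK// -restr -dens.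
by split.
Qed.
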